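(* Let $W\in\mathbb{C}^{Nd\times 2Nd}$ have full rank and let $A$ be the restriction of the operator $A_0$ to the domain $$D(A)=\Big\{x\in D(A_0):\ W\begin{pmatrix} f_{\partial,\mathcal{H}x}\\ e_{\partial,\mathcal{H}x}\end{pmatrix}=0\Big\}.$$ Then the following are equivalent. 1. $A$ generates a contraction $C_0$-semigroup on $(X,\langle\cdot,\cdot\rangle_{\mathcal{H}})$. 2. $A$ is dissipative, i.e. $\operatorname{Re}\langle Ax,x\rangle_{\mathcal{H}}\le 0$ for all $x\in D(A)$. 3. $W\Sigma W^*\ge 0$ and $\operatorname{Re}P_0\le 0$, where $\Sigma=\begin{pmatrix}0&I\\ I&0\end{pmatrix}\in\mathbb{C}^{2Nd\times 2Nd}$ (with blocks of size $Nd\times Nd$). In that case $A$ has compact resolvent.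
   Context: Fix integers $N,d\ge 1$. Let $P_0,P_1,\dots,P_N\in\mathbb{C}^{d\times d}$ satisfy $P_k^*=(-1)^{k-1}P_k$ for $k=1,\dots,N$, with $P_N$ invertible; $P_0$ is arbitrary. Write $\operatorname{Re}P_0:=\frac12(P_0+P_0^* )$. Let $\mathcal{H}:(0,1)\to\mathbb{C}^{d\times d}$ be measurable and such that there are constants $0<m_0\le M_0$ with, for a.e. $\zeta\in(0,1)$, $\mathcal{H}(\zeta)$ self-adjoint and $m_0|\xi|^2\le \xi^*\mathcal{H}(\zeta)\xi\le M_0|\xi|^2$ for all $\xi\in\mathbb{C}^d$. Let $X=L_2(0,1;\mathbb{C}^d)$ with inner product $\langle f,g\rangle_{\mathcal{H}}=\int_0^1 f(\zeta)^*\mathcal{H}(\zeta)g(\zeta)\,d\zeta$ and the associated norm. Define $A_0:D(A_0)\subset X\to X$ by $A_0x=\sum_{k=0}^N P_k\frac{d^k}{d\zeta^k}(\mathcal{H}x)$, $D(A_0)=\{x\in X:\mathcal{H}x\in H^N(0,1;\mathbb{C}^d)\}$ (Sobolev space). For $y\in H^N(0,1;\mathbb{C}^d)$ put $\Phi(y)=(y(1),y'(1),\dots,y^{(N-1)}(1),y(0),y'(0),\dots,y^{(N-1)}(0))\in\mathbb{C}^{2Nd}$. The boundary port variables $f_{\partial,\mathcal{H}x},e_{\partial,\mathcal{H}x}\in\mathbb{C}^{Nd}$ of $x\in D(A_0)$ are defined by $$\begin{pmatrix} f_{\partial,\mathcal{H}x}\\ e_{\partial,\mathcal{H}x}\end{pmatrix}=\frac1{\sqrt2}\begin{pmatrix}Q&-Q\\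 I&I\end{pmatrix}\Phi(\mathcal{H}x),$$ where $Q\in\mathbb{C}^{Nd\times Nd}$ is the block matrix with $d\times d$ blocks $Q_{ij}=(-1)^{i-1}P_{i+j-1}$ if $i+j\le N+1$ and $Q_{ij}=0$ otherwise ($1\le i,j\le N$). *)

(* Defs.v *)
From HB Require Import structures.
From mathcomp Require Import all_boot all_order all_algebra.
From mathcomp Require Import all_classical all_reals all_analysis.
From mathcomp Require Import measurable_realfun.
From mathcomp.real_closed Require Import complex.
From mathcomp Require Import ring lra.
Import Order.TTheory GRing.Theory Num.Theory.
Import numFieldNormedType.Exports.

Set Implicit Arguments.
Unset Strict Implicit.
Unset Printing Implicit Defensive.

Local Open Scope classical_set_scope.
Local Open Scope ring_scope.
Local Open Scope complex_scope.
Local Open Scope sesquilinear_scope.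

Section matrices.
Variable R : realType.

Definition sesq n (A : 'M[R[i]]_n) (u v : 'cV[R[i]]_n) : R[i] :=
  (u ^t* *m A *m v) 0 0.

Definition sqnorm n (u : 'cV[R[i]]_n) : R :=
  \sum_i (complex.Re (u i 0) ^+ 2 + complex.Im (u i 0) ^+ 2).

Definition herm_part n (A : 'M[R[i]]_n) : 'M[R[i]]_n := 2^-1 *: (A + A ^t*).

(* [0 <= z] in [R[i]] means that [z] is real and nonnegative. *)
Definition psdmx n (A : 'M[R[i]]_n) : Prop :=
  A ^t* = A /\ forall u : 'cV[R[i]]_n, 0 <= sesq A u u.

Definition nsdmx n (A : 'M[R[i]]_n) : Prop := psdmx (- A).

Lemma sesqE n (A : 'M[R[i]]_n) u v :
  sesq A u v = \sum_i \sum_j (u i 0)^* * A i j * v j 0.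
Proof.
rewrite /sesq mxE exchange_big /=; apply: eq_bigr => j _.
rewrite mxE big_distrl /=; apply: eq_bigr => i _.
by rewrite !mxE.
Qed.

Lemma sesq_parallelogram n (A : 'M[R[i]]_n) u v (r : R) : r != 0 ->
  complex.Re (sesq A (u + v) (u + v)) +
    complex.Re (sesq A (r%:C *: u - (r^-1)%:C *: v) (r%:C *: u - (r^-1)%:C *: v)) =
  (1 + r ^+ 2) * complex.Re (sesq A u u) +
  (1 + r ^- 2) * complex.Re (sesq A v v).
Proof.
move=> r0; rewrite !sesqE !raddf_sum /= !mulr_sumr -!big_split /=.
apply: eq_bigr => i _; rewrite !raddf_sum /= !mulr_sumr -!big_split /=.
apply: eq_bigr => j _; rewrite !mxE.
case: (u i 0) (v i 0) (u j 0) (v j 0) (A i j) => [a b] [a' b'] [c e] [c' e'] [x y].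
by simpc => /=; field.
Qed.

Lemma sesqZ n (A : 'M[R[i]]_n) u (a : R[i]) :
  complex.Re (sesq A (a *: u) (a *: u)) =
  (complex.Re a ^+ 2 + complex.Im a ^+ 2) * complex.Re (sesq A u u).
Proof.
rewrite !sesqE !raddf_sum /= !mulr_sumr; apply: eq_bigr => i _.
rewrite !raddf_sum /= !mulr_sumr; apply: eq_bigr => j _; rewrite !mxE.
case: a (u i 0) (u j 0) (A i j) => [a b] [c e] [c' e'] [x y].
by simpc => /=; ring.
Qed.

Lemma sqnorm_ge0 n (u : 'cV[R[i]]_n) : 0 <= sqnorm u.
Proof. by apply: sumr_ge0 => i _; rewrite addr_ge0 ?sqr_ge0. Qed.

Lemma sqnorm_eq0 n (u : 'cV[R[i]]_n) : sqnorm u = 0 -> u = 0.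
Proof.
move=> /eqP; rewrite psumr_eq0; last first.
  by move=> i _; rewrite addr_ge0 ?sqr_ge0.
move=> /allP u0; apply/matrixP => i j; rewrite (ord1 j) mxE.
have := u0 i (mem_index_enum i); rewrite /= paddr_eq0 ?sqr_ge0// !sqrf_eq0.
by case: (u i 0) => a b /= /andP[/eqP -> /eqP ->].
Qed.

Lemma sqnorm0 n : sqnorm (0 : 'cV[R[i]]_n) = 0.
Proof. by rewrite /sqnorm big1// => i _; rewrite mxE /= expr0n addr0. Qed.

Lemma sqnormZ n (u : 'cV[R[i]]_n) (a : R[i]) :
  sqnorm (a *: u) = (complex.Re a ^+ 2 + complex.Im a ^+ 2) * sqnorm u.
Proof.
rewrite mulr_sumr; apply: eq_bigr => i _; rewrite mxE.
by case: a (u i 0) => [a b] [x y] /=; ring.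
Qed.

Lemma sqnormD n (u v : 'cV[R[i]]_n) :
  sqnorm (u + v) <= 2 * sqnorm u + 2 * sqnorm v.
Proof.
rewrite !mulr_sumr -big_split /=; apply: ler_sum => i _; rewrite mxE.
case: (u i 0) (v i 0) => [a b] [x y] /=.
by have := sqr_ge0 (a - x); have := sqr_ge0 (b - y); nra.
Qed.

End matrices.

Section measure01.
Variable R : realType.

(* The open unit interval; all functions are total on [R], and only their
   restriction to [I01] up to null sets is relevant. *)
Definition I01 : set R := `]0, 1[.

Notation mu := (@lebesgue_measure R).

#[global] Instance ae_lebesgue_filter : Filter (almost_everywhere mu).
Proof. exact: ae_filter_ringOfSetsType. Qed.

#[global] Instance ae_lebesgue_nbhs_filter :
  Filter (nbhs (almost_everywhere mu)).
Proof. exact: ae_lebesgue_filter. Qed.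

Lemma measurable_I01 : measurable I01.
Proof. exact: measurable_itv. Qed.

(* [R[i]] carries no measurable structure in the library; measurability and
   integration are taken on real and imaginary parts. *)
Definition cmeasurable (f : R -> R[i]) : Prop :=
  measurable_fun I01 (fun z => complex.Re (f z)) /\
  measurable_fun I01 (fun z => complex.Im (f z)).

Definition cintegral (f : R -> R[i]) : R[i] :=
  (\int[mu]_(z in I01) complex.Re (f z))%R +i*
  (\int[mu]_(z in I01) complex.Im (f z))%R.

Lemma cmeasurable_cst c : cmeasurable (fun=> c).
Proof. by split; exact: measurable_cst. Qed.

Lemma cmeasurableD f g :
  cmeasurable f -> cmeasurable g -> cmeasurable (fun z => f z + g z).
Proof.
move=> [f1 f2] [g1 g2]; split.
  rewrite (_ : (fun _ => _) = (fun z => complex.Re (f z) + complex.Re (g z)));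
    first exact: measurable_funD.
  by apply/funext => z; rewrite raddfD.
rewrite (_ : (fun _ => _) = (fun z => complex.Im (f z) + complex.Im (g z)));
  first exact: measurable_funD.
by apply/funext => z; rewrite raddfD.
Qed.

Lemma cmeasurableM f g :
  cmeasurable f -> cmeasurable g -> cmeasurable (fun z => f z * g z).
Proof.
move=> [f1 f2] [g1 g2]; split.
  rewrite (_ : (fun _ => _) = (fun z => complex.Re (f z) * complex.Re (g z) -
    complex.Im (f z) * complex.Im (g z))).
    by apply: measurable_funB; exact: measurable_funM.
  by apply/funext => z; case: (f z) (g z) => [a b] [c e].
rewrite (_ : (fun _ => _) = (fun z => complex.Re (f z) * complex.Im (g z) +
    complex.Im (f z) * complex.Re (g z))).
  by apply: measurable_funD; exact: measurable_funM.
by apply/funext => z; case: (f z) (g z) => [a b] [c e].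
Qed.

Lemma cmeasurableJ f : cmeasurable f -> cmeasurable (fun z => (f z)^*).
Proof.
move=> [f1 f2]; split.
  by rewrite (_ : (fun _ => _) = (fun z => complex.Re (f z)))//;
    apply/funext => z; case: (f z).
rewrite (_ : (fun _ => _) = (fun z => - complex.Im (f z))).
  exact: measurable_funN.
by apply/funext => z; case: (f z).
Qed.

Lemma cmeasurable_sum n (F : 'I_n -> R -> R[i]) :
  (forall i, cmeasurable (F i)) -> cmeasurable (fun z => \sum_i F i z).
Proof.
move=> mF; elim: n F mF => [|n IH] F mF.
  rewrite (_ : (fun _ => _) = (fun=> 0)); first exact: cmeasurable_cst.
  by apply/funext => z; rewrite big_ord0.
rewrite (_ : (fun _ => _) =
    (fun z => F ord0 z + \sum_(i < n) F (lift ord0 i) z)).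
  by apply: cmeasurableD => //; exact: (IH (fun i => F (lift ord0 i))).
by apply/funext => z; rewrite big_ord_recl.
Qed.

Lemma ae_le_Rintegral (f g : R -> R) :
  mu.-integrable I01 (EFin \o f) -> mu.-integrable I01 (EFin \o g) ->
  {ae mu, forall z, I01 z -> f z <= g z} ->
  (\int[mu]_(z in I01) f z <= \int[mu]_(z in I01) g z)%R.
Proof.
move=> fi gi fg; rewrite -subr_ge0 -RintegralB//; last exact: measurable_I01.
have mf : measurable_fun I01 f by have /integrableP[/measurable_EFinP] := fi.
have mg : measurable_fun I01 g by have /integrableP[/measurable_EFinP] := gi.
have -> : (\int[mu]_(z in I01) (g z - f z) =
    \int[mu]_(z in I01) `|g z - f z|)%R.
  congr fine; apply: ae_eq_integral; last first.
  - apply: filterS fg => z /[swap] zD /(_ zD) fgz /=.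
    by rewrite ger0_norm// subr_ge0.
  - apply/measurable_EFinP; apply: measurableT_comp => //.
    exact: measurable_funB.
  - by apply/measurable_EFinP; exact: measurable_funB.
  - exact: measurable_I01.
by apply: fine_ge0; apply: integral_ge0 => z _; rewrite lee_fin.
Qed.

Lemma ae_eq_Rintegral (f g : R -> R) :
  measurable_fun I01 f -> measurable_fun I01 g ->
  {ae mu, forall z, I01 z -> f z = g z} ->
  (\int[mu]_(z in I01) f z = \int[mu]_(z in I01) g z)%R.
Proof.
move=> mf mg fg; congr fine; apply: ae_eq_integral.
- exact: measurable_I01.
- exact/measurable_EFinP.
- exact/measurable_EFinP.
- by apply: filterS fg => z /[swap] zD /(_ zD) /= ->.
Qed.

Lemma ae_le_integrable (f g : R -> R) :
  measurable_fun I01 f -> mu.-integrable I01 (EFin \o g) ->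
  {ae mu, forall z, I01 z -> `|f z| <= g z} ->
  mu.-integrable I01 (EFin \o f).
Proof.
move=> mf gi fg; apply/integrableP; split; first exact/measurable_EFinP.
have mg : measurable_fun I01 g by have /integrableP[/measurable_EFinP] := gi.
have /integrableP[_ gfin] := gi; apply: le_lt_trans gfin.
apply: ae_ge0_le_integral => //.
- exact: measurable_I01.
- by apply: measurableT_comp => //; exact/measurable_EFinP.
- by apply: measurableT_comp => //; exact/measurable_EFinP.
- apply: filterS fg => z /[swap] zD /(_ zD) fgz /=.
  by rewrite lee_fin (le_trans fgz)// ler_norm.
Qed.

End measure01.

Section L2.
Variables (R : realType) (d : nat).

Notation mu := (@lebesgue_measure R).

Definition square_integrable : {pred R -> 'cV[R[i]]_d} :=
  mem [set f : R -> 'cV[R[i]]_d | (forall i, cmeasurable (fun z => f z i 0)) /\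
               mu.-integrable (@I01 R) (fun z : R => (sqnorm (f z))%:E)].

Lemma measurable_sqnorm (f : R -> 'cV[R[i]]_d) :
  (forall i, cmeasurable (fun z => f z i 0)) ->
  measurable_fun (@I01 R) (fun z => sqnorm (f z)).
Proof.
move=> mf; rewrite (_ : (fun _ => _) = (fun z =>
  complex.Re (\sum_i (f z i 0)^* * f z i 0))).
  suff [] : cmeasurable (fun z => \sum_i (f z i 0)^* * f z i 0) by [].
  by apply: cmeasurable_sum => i; apply: cmeasurableM => //; exact: cmeasurableJ.
apply/funext => z; rewrite raddf_sum; apply: eq_bigr => i _ /=.
by case: (f z i 0) => a b /=; ring.
Qed.

Lemma square_integrable_submod_closed : submod_closed square_integrable.
Proof.
split.
  rewrite inE; split=> [i|].
    rewrite (_ : (fun _ => _) = (fun=> 0)); first exact: cmeasurable_cst.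
    by apply/funext => z; rewrite mxE.
  rewrite (_ : (fun _ => _) = cst 0%E); first exact: integrable0.
  by apply/funext => z; rewrite sqnorm0.
move=> a f g; rewrite !inE => -[mf fi] [mg gi].
have mh i : cmeasurable (fun z => (a *: f + g) z i 0).
  rewrite (_ : (fun _ => _) = (fun z => a * f z i 0 + g z i 0)).
    by apply: cmeasurableD => //; apply: cmeasurableM => //; exact: cmeasurable_cst.
  by apply/funext => z; rewrite !mxE.
split=> //; set c := complex.Re a ^+ 2 + complex.Im a ^+ 2.
apply: (@ae_le_integrable _ _ (fun z => (2 * c) * sqnorm (f z) + 2 * sqnorm (g z))).
- exact: measurable_sqnorm.
- rewrite (_ : _ \o _ = (fun z => (2 * c)%:E * (sqnorm (f z))%:E +
      2%:E * (sqnorm (g z))%:E)%E) //.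
  apply: integrableD; first exact: measurable_I01.
    by apply: integrableZl => //; exact: measurable_I01.
  by apply: integrableZl => //; exact: measurable_I01.
- apply: nearW => z _; rewrite ger0_norm ?sqnorm_ge0//.
  by rewrite (le_trans (sqnormD _ _))// sqnormZ mulrA.
Qed.

HB.instance Definition _ := GRing.isSubmodClosed.Build R[i]
  (R -> 'cV[R[i]]_d) square_integrable square_integrable_submod_closed.

Record L2fun := MkL2fun {
  L2fun_val :> R -> 'cV[R[i]]_d ;
  L2fun_valP : L2fun_val \in square_integrable }.

HB.instance Definition _ := [isSub for L2fun_val].
HB.instance Definition _ := [Choice of L2fun by <:].
HB.instance Definition _ := [SubChoice_isSubLmodule of L2fun by <:].

Definition ae_null : {pred L2fun} :=
  mem [set f : L2fun | {ae mu, forall z, I01 z -> f z = 0}].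

Lemma ae_null_zmod_closed : zmod_closed ae_null.
Proof.
split; first by rewrite inE; apply: nearW.
move=> f g; rewrite !inE => f0 g0; apply: filterS2 f0 g0 => z f0 g0 zI.
by change ((f z : 'cV_d) - g z = 0); rewrite f0// g0// subr0.
Qed.

HB.instance Definition _ := GRing.isZmodClosed.Build L2fun ae_null
  ae_null_zmod_closed.

Definition L2 : Type := Quotient.quot ae_null.

HB.instance Definition _ := GRing.Zmodule.on L2.
HB.instance Definition _ := EqQuotient.on L2.

Local Open Scope quotient_scope.

Lemma pi_L2P (f g : L2fun) :
  \pi_L2 f = \pi_L2 g <-> {ae mu, forall z, I01 z -> f z = g z}.
Proof.
have -> : (\pi_L2 f = \pi_L2 g) <-> (f - g \in ae_null).
  by rewrite Quotient.idealrBE; split => [->|/eqP].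
rewrite inE; split; apply: filterS => z fg zI; move: (fg zI);
  change (((f - g) : L2fun) z) with ((f z : 'cV_d) - g z).
  by move/eqP; rewrite subr_eq0 => /eqP.
by move=> ->; rewrite subrr.
Qed.

Lemma repr_pi_L2 (f : L2fun) :
  {ae mu, forall z, I01 z -> repr (\pi_L2 f) z = f z}.
Proof. by apply/pi_L2P; rewrite reprK. Qed.

Definition L2_scale (a : R[i]) (x : L2) : L2 := \pi_L2 (a *: repr x).

Lemma pi_L2_scale a f : \pi_L2 (a *: f) = L2_scale a (\pi_L2 f).
Proof.
apply/pi_L2P; apply: filterS (repr_pi_L2 f) => z fz zI /=.
by rewrite /GRing.scale /= fz.
Qed.

Lemma pi_L2D f g : \pi_L2 (f + g) = \pi_L2 f + \pi_L2 g.
Proof. exact: Quotient.pi_add. Qed.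

Lemma L2_scaleA a b x : L2_scale a (L2_scale b x) = L2_scale (a * b) x.
Proof.
elim/quotW: x => f; rewrite -(pi_L2_scale b f) -(pi_L2_scale a (b *: f)).
by rewrite scalerA pi_L2_scale.
Qed.

Lemma L2_scale1 : left_id 1 L2_scale.
Proof. by elim/quotW => f; rewrite -(pi_L2_scale 1 f) scale1r. Qed.

Lemma L2_scaleDr : right_distributive L2_scale +%R.
Proof.
move=> a; elim/quotW => f; elim/quotW => g.
by rewrite -pi_L2D -3!(pi_L2_scale a) -pi_L2D scalerDr.
Qed.

Lemma L2_scaleDl x : {morph L2_scale^~ x : a b / a + b}.
Proof.
by move=> a b; elim/quotW: x => f; rewrite -3!pi_L2_scale -pi_L2D scalerDl.
Qed.

HB.instance Definition _ := GRing.Zmodule_isLmodule.Build R[i] L2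
  L2_scaleA L2_scale1 L2_scaleDr L2_scaleDl.

Definition L2_repr (x : L2) : R -> 'cV[R[i]]_d := repr x.

(* Junk value 0 outside [square_integrable]. *)
Definition L2_class (f : R -> 'cV[R[i]]_d) : L2 := \pi_L2 (insubd 0 f).

Lemma L2_reprP x : L2_repr x \in square_integrable.
Proof. exact: L2fun_valP. Qed.

Lemma L2_reprD x y :
  {ae mu, forall z, I01 z -> L2_repr (x + y) z = L2_repr x z + L2_repr y z}.
Proof.
have := repr_pi_L2 (repr x + repr y).
by rewrite pi_L2D !reprK.
Qed.

Lemma L2_reprZ a x :
  {ae mu, forall z, I01 z -> L2_repr (a *: x) z = a *: L2_repr x z}.
Proof. exact: (repr_pi_L2 (a *: repr x)). Qed.

Lemma L2_repr_eq0 x :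
  {ae mu, forall z, I01 z -> L2_repr x z = 0} -> x = 0.
Proof.
move=> x0; rewrite -[x]reprK (_ : 0 = \pi_L2 0); last first.
  by apply: (addrI (\pi_L2 0)); rewrite -pi_L2D !addr0.
by apply/pi_L2P; apply: filterS x0 => z.
Qed.

End L2.

Section energy_space.
Variables (R : realType) (d : nat).

Notation mu := (@lebesgue_measure R).

(* The form is real where [H z] is self-adjoint, so bounding its real part bounds
   the form. *)
Definition energy_density (H : R -> 'M[R[i]]_d) : Prop :=
  (forall i j, cmeasurable (fun z => H z i j)) /\
  exists m0 M0 : R, [/\ 0 < m0, m0 <= M0 &
    {ae mu, forall z : R, I01 z -> (H z) ^t* = H z /\
      forall u : 'cV[R[i]]_d,
        m0 * sqnorm u <= complex.Re (sesq (H z) u u) <= M0 * sqnorm u}].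

Variables (H : R -> 'M[R[i]]_d) (hH : energy_density H).

Definition weighted_ip (f g : R -> 'cV[R[i]]_d) : R[i] :=
  cintegral (fun z => sesq (H z) (f z) (g z)).

Let q (f : R -> 'cV[R[i]]_d) (z : R) : R := complex.Re (sesq (H z) (f z) (f z)).

Let energy f : R := complex.Re (weighted_ip f f).

Let measurable_q f : f \in @square_integrable R d ->
  measurable_fun (@I01 R) (q f).
Proof.
rewrite inE => -[mf _]; have [mH _] := hH.
suff [] : cmeasurable (fun z => sesq (H z) (f z) (f z)) by [].
rewrite (_ : (fun _ => _) = (fun z =>
    \sum_i \sum_j (f z i 0)^* * H z i j * f z j 0)); last first.
  by apply/funext => z; rewrite sesqE.
apply: cmeasurable_sum => i; apply: cmeasurable_sum => j.
apply: cmeasurableM => //; apply: cmeasurableM => //; exact: cmeasurableJ.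
Qed.

Let q_ge0 f : {ae mu, forall z : R, I01 z -> 0 <= q f z}.
Proof.
have [_ [m0 [M0 [m0_gt0 _]]]] := hH.
apply: filterS => z Hz zI; have [_ /(_ (f z)) /andP[le_m0 _]] := Hz zI.
by rewrite (le_trans _ le_m0)// mulr_ge0 ?sqnorm_ge0// ltW.
Qed.

Let integrable_q f : f \in @square_integrable R d ->
  mu.-integrable (@I01 R) (EFin \o q f).
Proof.
move=> fL2; have [_ [m0 [M0 [m0_gt0 _ HM]]]] := hH.
have := fL2; rewrite inE => -[_ fi].
apply: (@ae_le_integrable _ _ (fun z => M0 * sqnorm (f z))).
- exact: measurable_q.
- rewrite (_ : _ \o _ = (fun z => M0%:E * (sqnorm (f z))%:E)%E) //.
  by apply: integrableZl => //; exact: measurable_I01.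
- apply: filterS2 HM (q_ge0 f) => z Hz qz zI.
  have [_ /(_ (f z)) /andP[_ le_M0]] := Hz zI.
  by rewrite ger0_norm// qz.
Qed.

Let energy_ge0 f : f \in @square_integrable R d -> 0 <= energy f.
Proof.
move=> fL2; have -> : 0 = (\int[mu]_(z in @I01 R) (cst 0 z : R))%R :> R.
  by rewrite /Rintegral integral0_eq.
apply: ae_le_Rintegral => //.
  exact: integrable0.
  exact: integrable_q.
exact: q_ge0.
Qed.

Let energy_ae f g : f \in @square_integrable R d ->
  g \in @square_integrable R d ->
  {ae mu, forall z : R, I01 z -> f z = g z} -> energy f = energy g.
Proof.
move=> fL2 gL2 fg; apply: ae_eq_Rintegral; [exact: measurable_q..|].
by apply: filterS fg => z fgz zI /=; rewrite fgz.
Qed.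

Let energyZ f (a : R[i]) : f \in @square_integrable R d ->
  energy (a *: f) = (complex.Re a ^+ 2 + complex.Im a ^+ 2) * energy f.
Proof.
move=> fL2; rewrite -[RHS]RintegralZl; last exact: integrable_q.
  by congr fine; apply: eq_integral => z _; rewrite /= sesqZ.
exact: measurable_I01.
Qed.

Let energyD_le f g (r : R) : f \in @square_integrable R d ->
  g \in @square_integrable R d -> 0 < r ->
  energy (f + g) <= (1 + r ^+ 2) * energy f + (1 + r ^- 2) * energy g.
Proof.
move=> fL2 gL2 r0.
have mI := @measurable_I01 R.
have fqi : mu.-integrable (@I01 R) (EFin \o (fun z => (1 + r ^+ 2) * q f z)).
  rewrite (_ : _ \o _ = (fun z => (1 + r ^+ 2)%:E * (q f z)%:E)%E) //.
  by apply: integrableZl => //; exact: integrable_q.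
have gqi : mu.-integrable (@I01 R) (EFin \o (fun z => (1 + r ^- 2) * q g z)).
  rewrite (_ : _ \o _ = (fun z => (1 + r ^- 2)%:E * (q g z)%:E)%E) //.
  by apply: integrableZl => //; exact: integrable_q.
rewrite -!RintegralZl//; [|exact: integrable_q..].
rewrite -RintegralD//.
apply: ae_le_Rintegral.
- by apply: integrable_q; rewrite rpredD.
- rewrite (_ : _ \o _ = (fun z => ((1 + r ^+ 2) * q f z)%:E +
    ((1 + r ^- 2) * q g z)%:E)%E) //.
  exact: integrableD.
- apply: filterS (q_ge0 (r%:C *: f - (r^-1)%:C *: g)) => z qz zI.
  rewrite -sesq_parallelogram ?gt_eqF// lerDl.
  exact: qz zI.
Qed.

Let energyD_sqrt f g : f \in @square_integrable R d ->
  g \in @square_integrable R d ->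
  Num.sqrt (energy (f + g)) <= Num.sqrt (energy f) + Num.sqrt (energy g).
Proof.
move=> fL2 gL2; have hD := energyD_le fL2 gL2.
have fgL2 : f + g \in @square_integrable R d by rewrite rpredD.
move: hD (energy_ge0 fL2) (energy_ge0 gL2) (energy_ge0 fgL2).
move: (energy f) (energy g) (energy (f + g)) => a b c hD a0 b0 c0.
set x := Num.sqrt a; set y := Num.sqrt b.
have ax : a = x ^+ 2 by rewrite sqr_sqrtr.
have bx : b = y ^+ 2 by rewrite sqr_sqrtr.
have x0 : 0 <= x := sqrtr_ge0 a; have y0 : 0 <= y := sqrtr_ge0 b.
clearbody x y; subst a b.
have xy0 : 0 <= x + y by exact: addr_ge0.
rewrite -(ger0_norm xy0) -sqrtr_sqr ler_wsqrtr//.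
apply/ler_addgt0Pr => e e0.
have [s [s0 hs]] : exists s : R, 0 < s /\
    (1 + s) * x ^+ 2 + (1 + s^-1) * y ^+ 2 <= (x + y) ^+ 2 + e.
  pose t := e / (x + y + 1).
  have t0 : 0 < t by rewrite divr_gt0// ltr_wpDl.
  have txy : t * (x + y) <= e.
    by rewrite /t mulrAC ler_pdivrMr ?ltr_wpDl// ler_pM2l// lerDl.
  have X0 : 0 < x + t by rewrite ltr_wpDl.
  have Y0 : 0 < y + t by rewrite ltr_wpDl.
  exists ((y + t) / (x + t)); split; first exact: divr_gt0.
  have h1 : (y + t) / (x + t) * x ^+ 2 <= (y + t) * x.
    rewrite -mulrA ler_pM2l// mulrC ler_pdivrMr// expr2 ler_wpM2l//.
    by rewrite lerDl ltW.
  have h2 : ((y + t) / (x + t))^-1 * y ^+ 2 <= (x + t) * y.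
    rewrite invf_div -mulrA ler_pM2l// mulrC ler_pdivrMr// expr2 ler_wpM2l//.
    by rewrite lerDl ltW.
  nra.
apply: le_trans hs.
have : 0 < Num.sqrt s by rewrite sqrtr_gt0.
by move/hD; rewrite sqr_sqrtr// ltW.
Qed.

Let energy_eq0 f : f \in @square_integrable R d -> energy f = 0 ->
  {ae mu, forall z : R, I01 z -> f z = 0}.
Proof.
move=> fL2 f0; have [_ [m0 [M0 [m0_gt0 _ HM]]]] := hH.
have mI := @measurable_I01 R.
have := fL2; rewrite inE => -[mf fi].
have le0 : (m0 * \int[mu]_(z in @I01 R) sqnorm (f z) <= 0)%R.
  rewrite -RintegralZl// -f0; apply: ae_le_Rintegral.
  - rewrite (_ : _ \o _ = (fun z => m0%:E * (sqnorm (f z))%:E)%E) //.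
    exact: integrableZl.
  - exact: integrable_q.
  - by apply: filterS HM => z Hz zI; have [_ /(_ (f z)) /andP[]] := Hz zI.
have I0 : (\int[mu]_(z in @I01 R) `|(sqnorm (f z))%:E| = 0)%E.
  have -> : (\int[mu]_(z in @I01 R) `|(sqnorm (f z))%:E| =
      \int[mu]_(z in @I01 R) (sqnorm (f z))%:E)%E.
    by apply: eq_integral => z _; rewrite gee0_abs// lee_fin sqnorm_ge0.
  rewrite -[LHS]fineK; last exact: integrable_fin_num.
  congr EFin; apply/eqP; rewrite eq_le; apply/andP; split.
    by rewrite -(pmulr_rle0 _ m0_gt0).
  by apply: fine_ge0; apply: integral_ge0 => z _; rewrite lee_fin sqnorm_ge0.
have mf' : measurable_fun (@I01 R) (fun z => (sqnorm (f z))%:E).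
  by apply/measurable_EFinP; exact: measurable_sqnorm.
have /(ae_eq_integral_abs mu mI mf') h := I0.
by apply: filterS h => z hz zI; apply: sqnorm_eq0; move: (hz zI) => -[].
Qed.

(* [L2(0,1;C^d)] normed by the inner product weighted by [H]; the hypothesis
   on [H] is an argument because it makes the norm axioms hold. *)
Definition energy_space of energy_density H : Type := L2 R d.

Local Notation X := (energy_space hH).

HB.instance Definition _ := GRing.Lmodule.on X.

Definition energy_ip (x y : X) : R[i] := weighted_ip (L2_repr x) (L2_repr y).

Definition energy_norm (x : X) : R[i] :=
  (Num.sqrt (complex.Re (energy_ip x x)))%:C.

Let energy_normD x y : energy_norm (x + y) <= energy_norm x + energy_norm y.
Proof.
rewrite -raddfD lecR (le_trans _ (energyD_sqrt (L2_reprP x) (L2_reprP y)))//.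
rewrite (_ : complex.Re _ = energy (L2_repr x + L2_repr y))//.
apply: energy_ae; first exact: L2_reprP.
  by rewrite rpredD ?L2_reprP.
exact: L2_reprD.
Qed.

Let energy_normZ (a : R[i]) x : energy_norm (a *: x) = `|a| * energy_norm x.
Proof.
rewrite normc_def -rmorphM -sqrtrM ?addr_ge0 ?sqr_ge0//.
congr (Num.sqrt _)%:C; rewrite -(energyZ _ (L2_reprP x)).
apply: energy_ae; first exact: L2_reprP.
  by rewrite rpredZ ?L2_reprP.
exact: L2_reprZ.
Qed.

Let energy_norm_eq0 x : energy_norm x = 0 -> x = 0.
Proof.
move=> /(congr1 (@complex.Re R)) /= /eqP; rewrite sqrtr_eq0 => x0.
apply: L2_repr_eq0; apply: energy_eq0; first exact: L2_reprP.
by apply: le_anti; rewrite x0 energy_ge0// L2_reprP.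
Qed.

HB.instance Definition _ := Lmodule_isNormed.Build R[i] X
  energy_normD energy_normZ energy_norm_eq0.

End energy_space.

Arguments energy_ip {R d H} hH x y.
Arguments energy_norm {R d H} hH x.

Section operators.
Variables (R : realType) (V : normedModType R[i]).

(* [action A] is only meaningful on [domain A]. *)
Record unbounded_operator := UnboundedOperator {
  domain : set V ;
  action :> V -> V }.

Definition bounded_linear (S : V -> V) : Prop := linear S /\ continuous S.

(* [T t] is only meaningful for [0 <= t]. *)
Definition C0_semigroup (T : R -> V -> V) : Prop :=
  [/\ forall t, 0 <= t -> bounded_linear (T t),
      T 0 = id,
      forall s t, 0 <= s -> 0 <= t -> T (s + t) = T s \o T t &
      forall x, T t x @[t --> 0^'+] --> x].

Definition contractive (T : R -> V -> V) : Prop :=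
  forall t x, 0 <= t -> `|T t x| <= `|x|.

(* The graph of [A] is that of the infinitesimal generator of [T]. *)
Definition is_generator (A : unbounded_operator) (T : R -> V -> V) : Prop :=
  forall x y, (domain A x /\ A x = y) <->
    (t^-1)%:C *: (T t x - x) @[t --> 0^'+] --> y.

Definition generates_contraction_semigroup (A : unbounded_operator) : Prop :=
  exists T, [/\ C0_semigroup T, contractive T & is_generator A T].

Definition dissipative (ip : V -> V -> R[i]) (A : unbounded_operator) : Prop :=
  forall x, domain A x -> complex.Re (ip (A x) x) <= 0.

(* [l] is in the resolvent set of [A], and [S] is the inverse of [l - A]. *)
Definition is_resolvent (A : unbounded_operator) (l : R[i]) (S : V -> V) : Prop :=
  [/\ bounded_linear S,
      forall x, domain A (S x) /\ l *: S x - A (S x) = x &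
      forall x, domain A x -> S (l *: x - A x) = x].

Definition compact_operator (S : V -> V) : Prop :=
  compact (closure (S @` [set x | `|x| <= 1])).

Definition compact_resolvent (A : unbounded_operator) : Prop :=
  (exists l S, is_resolvent A l S) /\
  (forall l S, is_resolvent A l S -> compact_operator S).

End operators.

Section sobolev.
Variables (R : realType) (d : nat).

Notation mu := (@lebesgue_measure R).

Definition test_function (phi : R -> R) : Prop :=
  (forall n t, derivable (derive1n n phi) t 1) /\
  exists a b, [/\ 0 < a, b < 1 & forall t, ~ (a <= t <= b) -> phi t = 0].

Definition is_weak_derivative k (f g : R -> 'cV[R[i]]_d) : Prop :=
  forall phi, test_function phi -> forall j,
    cintegral (fun z => (derive1n k phi z)%:C * f z j 0) =
    (-1) ^+ k * cintegral (fun z => (phi z)%:C * g z j 0).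

(* The Sobolev space [H^N(0,1;C^d)], as a set of representatives. *)
Definition sobolev (N : nat) : set (R -> 'cV[R[i]]_d) :=
  [set f | f \in @square_integrable R d /\
    forall k, (k <= N)%N ->
      exists2 g, g \in @square_integrable R d & is_weak_derivative k f g].

(* A representative of the weak derivative, which is unique up to null sets;
   junk value 0 if there is none. *)
Definition weak_derivative k (f : R -> 'cV[R[i]]_d) : R -> 'cV[R[i]]_d :=
  xget 0 [set g | g \in @square_integrable R d /\ is_weak_derivative k f g].

(* The representative of [f] that is continuous on the closed interval, where
   it is unique; junk value 0 if there is none. *)
Definition continuous_representative (f : R -> 'cV[R[i]]_d) : R -> 'cV[R[i]]_d :=
  xget 0 [set g : R -> 'cV[R[i]]_d |
    (forall j, {within `[0, 1], continuous (fun z => complex.Re (g z j 0))} /\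
               {within `[0, 1], continuous (fun z => complex.Im (g z j 0))}) /\
    {ae mu, forall z : R, I01 z -> g z = f z}].

End sobolev.

(* The library's size of an [N]-block vector with blocks of size [d]; it equals
   [N * d] by [sum_nat_const] but is not convertible to it. *)
Notation blockdim N d := (\sum_(k < N) d)%N.

Section port_hamiltonian.
Variables (R : realType) (N d : nat) (P : nat -> 'M[R[i]]_d).

Definition boundary_trace (y : R -> 'cV[R[i]]_d) :
    'cV[R[i]]_(blockdim N d + blockdim N d) :=
  col_mx
    (\mxcol_(k < N) continuous_representative (weak_derivative k y) 1)
    (\mxcol_(k < N) continuous_representative (weak_derivative k y) 0).

(* Indices are shifted: block [(i, j)] here is block [(i + 1, j + 1)] when
   counting from 1. *)
Definition port_matrix : 'M[R[i]]_(blockdim N d) :=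
  \mxblock_(i < N, j < N)
    (if (i + j < N)%N then (-1) ^+ i *: P (i + j).+1 else 0).

Definition boundary_port (y : R -> 'cV[R[i]]_d) :
    'cV[R[i]]_(blockdim N d + blockdim N d) :=
  (sqrtC 2)^-1 *:
    (block_mx port_matrix (- port_matrix) 1%:M 1%:M *m boundary_trace y).

Definition swap_mx n : 'M[R[i]]_(n + n) := block_mx 0 1%:M 1%:M 0.

Variables (H : R -> 'M[R[i]]_d) (hH : energy_density H).

Definition density_mul (x : energy_space hH) : R -> 'cV[R[i]]_d :=
  fun z => H z *m L2_repr x z.

Definition maximal_operator : unbounded_operator (energy_space hH) :=
  UnboundedOperator
    [set x | sobolev N (density_mul x)]
    (fun x => L2_class (fun z =>
      \sum_(k < N.+1) P k *m weak_derivative k (density_mul x) z)).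

Variable W : 'M[R[i]]_(blockdim N d, blockdim N d + blockdim N d).

Definition port_operator : unbounded_operator (energy_space hH) :=
  UnboundedOperator
    [set x | domain maximal_operator x /\
             W *m boundary_port (density_mul x) = 0]
    maximal_operator.

End port_hamiltonian.

(* Main.v *)
Require Import Defs.
From HB Require Import structures.
From mathcomp Require Import all_boot all_order all_algebra.
From mathcomp Require Import all_classical all_reals all_analysis.
From mathcomp Require Import measurable_realfun.
From mathcomp.real_closed Require Import complex.
From mathcomp Require Import ring lra zify.
Import Order.TTheory GRing.Theory Num.Theory.
Import numFieldNormedType.Exports.
Set Implicit Arguments.
Unset Strict Implicit.
Unset Printing Implicit Defensive.
Local Open Scope classical_set_scope.
Local Open Scope ring_scope.
Local Open Scope complex_scope.
Local Open Scope sesquilinear_scope.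

Section real_norm.
Variables (R : realType) (V : normedModType R[i]).

Definition rnorm (x : V) : R := complex.Re `|x|.

Lemma rnormE x : `|x| = (rnorm x)%:C.
Proof.
have := normr_ge0 x; rewrite /rnorm; case: `|x| => a b.
by rewrite lecE /= => /andP[/eqP -> _].
Qed.

Lemma rnorm_ge0 x : 0 <= rnorm x.
Proof. by have := normr_ge0 x; rewrite rnormE ler0c. Qed.

Lemma rnormD x y : rnorm (x + y) <= rnorm x + rnorm y.
Proof. by have := ler_normD x y; rewrite !rnormE -raddfD lecR. Qed.

Lemma rnormN x : rnorm (- x) = rnorm x.
Proof. by rewrite /rnorm normrN. Qed.

Lemma rnorm_distC x y : rnorm (x - y) = rnorm (y - x).
Proof. by rewrite /rnorm distrC. Qed.

Lemma rnormB_trans y x z : rnorm (x - z) <= rnorm (x - y) + rnorm (y - z).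
Proof. by rewrite (le_trans _ (rnormD _ _))// addrA subrK. Qed.

Lemma rnorm0 : rnorm 0 = 0.
Proof. by rewrite /rnorm normr0. Qed.

Lemma rnorm0_eq0 x : rnorm x = 0 -> x = 0.
Proof. by move=> x0; apply/normr0_eq0; rewrite rnormE x0. Qed.

Lemma rnormZ (a : R[i]) x : rnorm (a *: x) = complex.Re `|a| * rnorm x.
Proof. by rewrite {1}/rnorm normrZ normc_def rnormE -rmorphM. Qed.

Lemma rnormZr (a : R) x : rnorm (a%:C *: x) = `|a| * rnorm x.
Proof. by rewrite rnormZ normc_def /= expr0n addr0 sqrtr_sqr. Qed.

Lemma cvg_rnorm {T} {F : set_system T} {FF : Filter F} (f : T -> V) (y : V) :
  f @ F --> y <-> forall e : R, 0 < e -> \forall t \near F, rnorm (y - f t) < e.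
Proof.
rewrite cvgrPdist_lt; split => [h e e0|h e].
  have /h : 0 < e%:C by rewrite ltcR.
  by apply: filterS => t; rewrite rnormE ltcR.
case: e => a b; rewrite ltcE /= => /andP[/eqP -> /h].
by apply: filterS => t; rewrite rnormE ltcR.
Qed.

Lemma rnorm_lim_le {T} {F : set_system T} {FF : ProperFilter F} (f : T -> V)
    (y : V) (c : R) :
  f @ F --> y -> (\forall t \near F, rnorm (f t) <= c) -> rnorm y <= c.
Proof.
move=> /cvg_rnorm fy fc; apply/ler_addgt0Pr => e /fy fe.
have [t [h1 h2]] := filter_ex (filterI fe fc).
rewrite -(subrK (f t) y) (le_trans (rnormD _ _))//.
by rewrite addrC lerD// ltW.
Qed.

Lemma rnorm_cvg {T} {F : set_system T} {FF : Filter F} (f : T -> V) (y : V) :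
  f @ F --> y -> rnorm (f t) @[t --> F] --> rnorm y.
Proof.
move=> /cvg_rnorm fy; apply/cvgrPdist_lt => e /fy; apply: filterS => t.
apply: le_lt_trans; rewrite ler_norml; apply/andP; split.
  rewrite lerNl opprB lerBlDr rnorm_distC.
  by rewrite -{1}(subrK y (f t)) rnormD.
by rewrite lerBlDr -{1}(subrK (f t) y) rnormD.
Qed.

Lemma cvg_rnorm_squeeze {T} {F : set_system T} {FF : Filter F}
    (f : T -> V) (y : V) (g : T -> R) :
  (\forall t \near F, rnorm (y - f t) <= g t) -> g @ F --> 0 -> f @ F --> y.
Proof.
move=> fg /cvgrPdist_lt g0; apply/cvg_rnorm => e /g0 ge.
apply: filterS2 fg ge => t ft; rewrite sub0r normrN; apply: le_lt_trans.
exact: le_trans ft (ler_norm _).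
Qed.

Lemma exp2V_cvg0 : (2^-1 : R) ^+ k @[k --> \oo] --> 0.
Proof. by apply: cvg_expr; rewrite ger0_norm; lra. Qed.

Lemma geometric_step_le (u : nat -> V) (C : R) :
  (forall k, rnorm (u k - u k.+1) <= C * 2^-1 ^+ k) ->
  forall k m, rnorm (u k - u (k + m)%N) <= 2 * C * 2^-1 ^+ k.
Proof.
move=> h k m.
have C0 : 0 <= C by have := le_trans (rnorm_ge0 _) (h 0%N); rewrite expr0 mulr1.
suff : rnorm (u k - u (k + m)%N) <= 2 * C * 2^-1 ^+ k * (1 - 2^-1 ^+ m).
  move=> /le_trans; apply; apply: ler_piMr.
    by rewrite !mulr_ge0// exprn_ge0.
  by rewrite lerBlDr lerDl exprn_ge0.
elim: m => [|m IH]; first by rewrite addn0 subrr rnorm0 expr0 subrr mulr0.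
rewrite addnS.
apply: (le_trans (rnormB_trans (u (k + m)%N) _ _)).
apply: (le_trans (lerD IH (h _))) => //.
by rewrite exprD exprS; lra.
Qed.

Definition seq_complete := forall u : nat -> V,
  (forall e : R, 0 < e -> exists n, forall m,
     (n <= m)%N -> rnorm (u n - u m) < e) ->
  exists l : V, u n @[n --> \oo] --> l.

Lemma geometric_cvg (u : nat -> V) (C : R) : seq_complete ->
  (forall k, rnorm (u k - u k.+1) <= C * 2^-1 ^+ k) ->
  exists l : V, u n @[n --> \oo] --> l.
Proof.
move=> comp h; apply: comp => e e0.
have : 2 * C * 2^-1 ^+ k @[k --> \oo] --> 2 * C * 0.
  by apply: cvgMr; exact: exp2V_cvg0.
rewrite mulr0 => /cvgrPdist_lt/(_ _ e0)[n _ /(_ n (leqnn n))].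
rewrite /= sub0r normrN => hn; exists n => m nm.
rewrite -(subnKC nm); apply: le_lt_trans (geometric_step_le h _ _) _.
exact: le_lt_trans (ler_norm _) hn.
Qed.

End real_norm.

Lemma subrACA (V : zmodType) (a b c e : V) : a - b - (c - e) = a - c - (b - e).
Proof. by rewrite [in LHS]opprD [in RHS]opprD addrACA. Qed.

Section real_inner_product.
Variables (R : realType) (V : normedModType R[i]).

Record real_ip (ip : V -> V -> R) : Prop := RealIp {
  ipC : forall x y, ip x y = ip y x ;
  ipDl : forall x y z, ip (x + y) z = ip x z + ip y z ;
  ipZl : forall (a : R) x y, ip (a%:C *: x) y = a * ip x y ;
  ip_rnorm : forall x, ip x x = rnorm x ^+ 2 }.

Variables (ip : V -> V -> R) (ipP : real_ip ip).

Lemma ipDr x y z : ip z (x + y) = ip z x + ip z y.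
Proof. by rewrite (ipC ipP) (ipDl ipP) !(ipC ipP z). Qed.

Lemma ipZr (a : R) x y : ip y (a%:C *: x) = a * ip y x.
Proof. by rewrite (ipC ipP) (ipZl ipP) (ipC ipP y). Qed.

Lemma ipNl x y : ip (- x) y = - ip x y.
Proof. by have := ipZl ipP (-1) x y; rewrite rmorphN1 scaleN1r mulN1r. Qed.

Lemma ipNr x y : ip x (- y) = - ip x y.
Proof. by rewrite !(ipC ipP x) ipNl. Qed.

Lemma ip_polar x y : ip x y = 4^-1 * (rnorm (x + y) ^+ 2 - rnorm (x - y) ^+ 2).
Proof.
rewrite -!(ip_rnorm ipP) !ipDr !(ipDl ipP) !ipNr !ipNl (ipC ipP y x).
by field.
Qed.

Lemma ip_cvg {T} {F : set_system T} {FF : Filter F} (f g : T -> V) (x y : V) :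
  f @ F --> x -> g @ F --> y -> ip (f t) (g t) @[t --> F] --> ip x y.
Proof.
move=> fx gy; rewrite ip_polar.
under eq_fun do rewrite ip_polar.
apply: cvgMr; apply: cvgB; apply: cvgM; apply: rnorm_cvg;
  by [apply: cvgD | apply: cvgB].
Qed.

Lemma ip_cvg_le {T} {F : set_system T} {FF : ProperFilter F} (f g : T -> V)
    (x y : V) (c : R) : f @ F --> x -> g @ F --> y ->
  (\forall t \near F, ip (f t) (g t) <= c) -> ip x y <= c.
Proof.
move=> fx gy h; have hc : ip (f t) (g t) @[t --> F] --> ip x y by exact: ip_cvg.
rewrite -(cvg_lim (@Rhausdorff R) hc).
by apply: limr_le => //; apply/cvg_ex; eexists; exact: hc.
Qed.

End real_inner_product.

Section contraction_generator.
Variables (R : realType) (V : normedModType R[i]) (ip : V -> V -> R).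
Hypothesis ipP : real_ip ip.

Lemma contraction_ip_le x y : rnorm y <= rnorm x -> ip (y - x) x <= 0.
Proof.
move=> yx; rewrite (ipDl ipP) (ipNl ipP) (ip_rnorm ipP).
have : 0 <= rnorm (y - x) ^+ 2 by exact: sqr_ge0.
rewrite -(ip_rnorm ipP) (ipDr ipP) !(ipDl ipP) !(ipNl ipP) !(ipNr ipP).
rewrite (ipC ipP x y) !(ip_rnorm ipP).
have : rnorm y ^+ 2 <= rnorm x ^+ 2 by rewrite ler_sqr ?nnegrE ?rnorm_ge0.
lra.
Qed.

Lemma contraction_derivative_dissipative (T : R -> V -> V) x y :
  contractive T -> (t^-1)%:C *: (T t x - x) @[t --> 0^'+] --> y -> ip y x <= 0.
Proof.
move=> Tc Txy; apply: (ip_cvg_le ipP Txy (cvg_cst x)).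
near=> t; have t0 : 0 < t by near: t; exact: nbhs_right_gt.
rewrite (ipZl ipP) pmulr_rle0 ?invr_gt0//; apply: contraction_ip_le.
by rewrite -lecR -!rnormE Tc// ltW.
Unshelve. all: end_near. Qed.

End contraction_generator.

Section m_dissipative.
Variables (R : realType) (V : normedModType R[i]) (ip : V -> V -> R).
Hypothesis ipP : real_ip ip.
Hypothesis V_complete : seq_complete V.
Variable A : unbounded_operator V.
Local Notation D := (domain A).
Hypothesis A_linear : forall (a : R[i]) x y, D x -> D y ->
  D (a *: x + y) /\ A (a *: x + y) = a *: A x + A y.
Hypothesis A_dissipative : forall x, D x -> ip (A x) x <= 0.
Hypothesis A_range : forall h x, 0 < h -> exists2 z, D z & z - h%:C *: A z = x.

Lemma D0 : D 0.
Proof.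
have [z Dz _] := @A_range 1 0 ltr01.
by have [+ _] := A_linear (-1) Dz Dz; rewrite scaleN1r addNr.
Qed.

Lemma A0 : A 0 = 0.
Proof.
by have [_] := A_linear (-1) D0 D0; rewrite !scaleN1r !addNr.
Qed.

Lemma DD x y : D x -> D y -> D (x + y).
Proof. by move=> Dx Dy; have [+ _] := A_linear 1 Dx Dy; rewrite scale1r. Qed.

Lemma AD x y : D x -> D y -> A (x + y) = A x + A y.
Proof. by move=> Dx Dy; have [_] := A_linear 1 Dx Dy; rewrite !scale1r. Qed.

Lemma DZ a x : D x -> D (a *: x).
Proof. by move=> Dx; have [+ _] := A_linear a Dx D0; rewrite addr0. Qed.

Lemma AZ a x : D x -> A (a *: x) = a *: A x.
Proof. by move=> Dx; have [_] := A_linear a Dx D0; rewrite A0 !addr0. Qed.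

Lemma DB x y : D x -> D y -> D (x - y).
Proof. by move=> Dx Dy; rewrite -scaleN1r; apply: DD => //; exact: DZ. Qed.

Lemma AB x y : D x -> D y -> A (x - y) = A x - A y.
Proof.
move=> Dx Dy; rewrite -scaleN1r (AD Dx (DZ _ Dy)) (AZ _ Dy).
by rewrite scaleN1r.
Qed.

Lemma dissipative_le h x : 0 <= h -> D x -> rnorm x <= rnorm (x - h%:C *: A x).
Proof.
move=> h0 Dx; rewrite -(ler_pXn2r (n := 2)) ?nnegrE ?rnorm_ge0//.
rewrite -!(ip_rnorm ipP) (ipDr ipP) !(ipDl ipP) !(ipNl ipP) !(ipNr ipP).
rewrite !(ipZl ipP) !(ipZr ipP) (ipC ipP x) (ip_rnorm ipP (A x)).
have := A_dissipative Dx; have := sqr_ge0 (rnorm (A x)); nra.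
Qed.

Definition J (h : R) (x : V) : V := xget 0 [set z | D z /\ z - h%:C *: A z = x].

Lemma JP h x : 0 < h -> D (J h x) /\ J h x - h%:C *: A (J h x) = x.
Proof.
move=> h0; have [z Dz zx] := A_range x h0.
by rewrite /J; case: xgetP => [y _ //|/(_ z)]; case.
Qed.

Lemma J_D h x : 0 < h -> D (J h x). Proof. by case/(JP x). Qed.

Lemma JK h x : 0 < h -> D x -> J h (x - h%:C *: A x) = x.
Proof.
move=> h0 Dx; have [DJ JE] := JP (x - h%:C *: A x) h0.
apply/eqP; rewrite -subr_eq0; apply/eqP/rnorm0_eq0/le_anti.
rewrite rnorm_ge0 (le_trans (dissipative_le (ltW h0) (DB DJ Dx)))//.
rewrite AB// scalerBr subrACA JE subrr rnorm0//.
Qed.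

Lemma J_unique h x z : 0 < h -> D z -> z - h%:C *: A z = x -> J h x = z.
Proof. by move=> h0 Dz <-; rewrite JK. Qed.

Lemma J_linear h a x y : 0 < h -> J h (a *: x + y) = a *: J h x + J h y.
Proof.
move=> h0; have [Dx xE] := JP x h0; have [Dy yE] := JP y h0.
have [Dxy AxyE] := A_linear a Dx Dy.
apply: J_unique => //; rewrite AxyE.
transitivity (a *: (J h x - h%:C *: A (J h x)) + (J h y - h%:C *: A (J h y)));
  last by rewrite xE yE.
by rewrite scalerDr scalerBr opprD addrACA !scalerA (mulrC a).
Qed.

Lemma J_le h x : 0 < h -> rnorm (J h x) <= rnorm x.
Proof.
move=> h0; have [Dx xE] := JP x h0; rewrite -[in leRHS]xE.
exact: dissipative_le (ltW h0) Dx.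
Qed.

Lemma J_B h x y : 0 < h -> J h (x - y) = J h x - J h y.
Proof. by move=> h0; rewrite addrC -scaleN1r J_linear// scaleN1r addrC. Qed.

Lemma m_dissipative_resolvent : is_resolvent A 1 (J 1).
Proof.
have J1 : (0 : R) < 1 := ltr01.
have E x : 1 *: x - A x = x - (1 : R)%:C *: A x by rewrite !scale1r.
split=> [|x|x Dx].
- split=> [a x y|x]; first exact: J_linear.
  apply: (@cvg_rnorm_squeeze _ _ _ _ _ _ _ (fun y => rnorm (x - y))).
    by apply: nearW => y; rewrite -J_B// J_le.
  rewrite -(rnorm0 V) -(subrr x); apply: rnorm_cvg.
  by apply: cvgB; [exact: cvg_cst|exact: cvg_id].
- by have [Dx e] := JP x J1; split=> //; rewrite E.
- by rewrite E JK.
Qed.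

Lemma AJ h x : 0 < h -> D x -> D (A (J h x)) /\ A (J h x) = J h (A x).
Proof.
move=> h0 Dx; have [DJ JE] := JP x h0.
have hC0 : h%:C != 0 by rewrite eq_complex /= gt_eqF.
have AJE : A (J h x) = (h^-1)%:C *: (J h x - x).
  rewrite -{3}JE subKr scalerA -rmorphM mulVf ?gt_eqF//.
  by rewrite scale1r.
have DAJ : D (A (J h x)) by rewrite AJE; apply/DZ/DB.
split=> //; apply/esym/J_unique => //.
by rewrite -AZ// -AB// ?JE//; exact: DZ.
Qed.

Lemma J_sub_le h x : 0 < h -> D x -> rnorm (J h x - x) <= h * rnorm (A x).
Proof.
move=> h0 Dx; have [_ JE] := JP x h0; rewrite -{2}JE subKr rnormZr gtr0_norm//.
by rewrite ler_pM2l// (AJ h0 Dx).2 J_le.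
Qed.

Section iterates.
Variables (h : R) (h0 : 0 < h).
Local Notation Jn n := (iter n (J h)).

Lemma iterJ_linear n a x y : Jn n (a *: x + y) = a *: Jn n x + Jn n y.
Proof. by elim: n => //= n ->; rewrite J_linear. Qed.

Lemma iterJ_B n x y : Jn n (x - y) = Jn n x - Jn n y.
Proof. by elim: n => //= n ->; rewrite J_B. Qed.

Lemma iterJ_le n x : rnorm (Jn n x) <= rnorm x.
Proof. by elim: n => //= n; apply: le_trans; exact: J_le. Qed.

Lemma iterJ_A n x : D x -> D (Jn n x) /\ A (Jn n x) = Jn n (A x).
Proof.
move=> Dx; elim: n => //= n [Dn An]; split; first exact: J_D.
by rewrite (AJ h0 Dn).2 An.
Qed.

Lemma iterJ_sub_le n x : D x -> rnorm (Jn n x - x) <= n%:R * h * rnorm (A x).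
Proof.
move=> Dx; elim: n => [|n IH]; first by rewrite subrr rnorm0 !mul0r.
rewrite /= (le_trans (rnormB_trans (J h x) _ _))// -J_B//.
rewrite (le_trans (lerD (le_trans (J_le _ h0) IH) (J_sub_le h0 Dx)))//.
by rewrite -natr1; lra.
Qed.

Lemma iterJ_increment_le n x : D x ->
  rnorm (Jn n x - x - (n%:R * h)%:C *: A x) <=
  \sum_(j < n) h * rnorm (Jn j.+1 (A x) - A x).
Proof.
move=> Dx; elim: n => [|n IH].
  by rewrite big_ord0 /= mul0r subrr scale0r subr0 rnorm0.
rewrite big_ord_recr /= (_ : _ - _ - _ =
  (Jn n x - x - (n%:R * h)%:C *: A x) + (Jn n.+1 x - Jn n x - h%:C *: A x)).
  rewrite (le_trans (rnormD _ _))// lerD//.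
  have [Dn An] := iterJ_A n Dx; have [_ JE] := JP (Jn n x) h0.
  rewrite /= -[X in _ - X - _]JE subKr (AJ h0 Dn).2 An.
  by rewrite -scalerBr rnormZr gtr0_norm.
rewrite -natr1 mulrDl mul1r raddfD /= scalerDl.
rewrite [RHS]addrACA -opprD; congr (_ - _).
by rewrite [RHS]addrC addrA subrK.
Qed.

End iterates.

Lemma halving h x : 0 < h -> D x -> D (A x) ->
  rnorm (J h x - J (h / 2) (J (h / 2) x)) <= h ^+ 2 / 4 * rnorm (A (A x)).
Proof.
move=> h0 Dx DAx; have k0 : 0 < h / 2 by rewrite divr_gt0.
set k := h / 2; rewrite -/k in k0.
have [DJ JE] := JP x h0.
have [D1 A1] := iterJ_A k0 2 Dx; have [D2 A2] := iterJ_A k0 2 DAx.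
have eqx : iter 2 (J k) x - (2 * k)%:C *: A (iter 2 (J k) x) +
    (k ^+ 2)%:C *: iter 2 (J k) (A (A x)) = x.
  have [DJx JxE] := JP x k0; have [DAJx AJx] := AJ k0 Dx.
  have [DJJx JJxE] := JP (J k x) k0; have [DAJJx AJJx] := AJ k0 DJx.
  rewrite -A2 -A1 /= -[RHS]JxE -[in RHS]JJxE AB ?AZ//; last exact: DZ.
  rewrite scalerBr scalerA -rmorphM -expr2 opprB addrA.
  rewrite [RHS]addrAC; congr (_ + _); rewrite -addrA -opprD -scalerDl -raddfD.
  by congr (_ - _%:C *: _); lra.
rewrite (le_trans (dissipative_le (ltW h0) (DB DJ D1)))//.
rewrite AB// scalerBr subrACA JE -{1}eqx.
have -> : 2 * k = h by rewrite /k; lra.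
rewrite addrAC subrr add0r rnormZr ger0_norm ?sqr_ge0//.
rewrite (_ : k ^+ 2 = h ^+ 2 / 4); last by rewrite /k; field.
by rewrite ler_wpM2l ?iterJ_le// divr_ge0// sqr_ge0.
Qed.

Lemma iter_halving h n x : 0 < h -> D x -> D (A x) ->
  rnorm (iter n (J h) x - iter n.*2 (J (h / 2)) x) <=
  n%:R * (h ^+ 2 / 4) * rnorm (A (A x)).
Proof.
move=> h0; have k0 : 0 < h / 2 by rewrite divr_gt0.
elim: n x => [|n IH] x Dx DAx; first by rewrite subrr rnorm0 !mul0r.
rewrite doubleS 3!iterSr.
rewrite (le_trans (rnormB_trans (iter n (J h) (iter 2 (J (h / 2)) x)) _ _))//.
have [D1 A1] := iterJ_A k0 2 Dx; have [D2 A2] := iterJ_A k0 2 DAx.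
have := IH _ D1; rewrite A1 => /(_ D2); rewrite A2 => hn.
rewrite -iterJ_B//.
have le1 := le_trans (iterJ_le h0 n _) (halving h0 Dx DAx).
apply: (le_trans (lerD le1 hn)).
rewrite -[n.+1]addn1 natrD !mulrDl mul1r addrC lerD2r.
by rewrite ler_wpM2l ?iterJ_le// mulr_ge0// divr_ge0// sqr_ge0.
Qed.

Lemma resolvent_monotone h k x : 0 < h -> h <= k ->
  rnorm ((J h x - x) - (J k x - x)) ^+ 2 <=
  rnorm (J k x - x) ^+ 2 - rnorm (J h x - x) ^+ 2.
Proof.
move=> h0; rewrite le_eqVlt => /orP[/eqP <-|hk].
  by rewrite !subrr rnorm0 expr0n.
have k0 := lt_trans h0 hk.
have AJE l : 0 < l -> A (J l x) = (l^-1)%:C *: (J l x - x).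
  move=> l0; have [_ JE] := JP x l0.
  by rewrite -{3}JE subKr scalerA -rmorphM mulVf ?gt_eqF// scale1r.
have := A_dissipative (DB (J_D x h0) (J_D x k0)).
rewrite (AB (J_D x h0) (J_D x k0)) !AJE//.
have -> : J h x - J k x = (J h x - x) - (J k x - x).
  by rewrite subrACA subrr subr0.
move: (J h x - x) (J k x - x) => u v.
rewrite -!(ip_rnorm ipP) !(ipDr ipP) !(ipDl ipP) !(ipNl ipP) !(ipNr ipP).
rewrite !(ipZl ipP) (ipC ipP v u).
have : 0 <= rnorm (u - v) ^+ 2 by exact: sqr_ge0.
rewrite -!(ip_rnorm ipP) !(ipDr ipP) !(ipDl ipP) !(ipNl ipP) !(ipNr ipP).
rewrite (ipC ipP v u).
have k'0 : 0 < k^-1 by rewrite invr_gt0.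
have hk' : k^-1 < h^-1 by rewrite ltf_pV2 ?posrE.
move: (ip u u) (ip u v) (ip v v) h^-1 k^-1 k'0 hk' => a b c p q q0 qp h1 h2.
have e1 : (p + q) * (a - b - (b - c)) <= (p - q) * (c - a) by lra.
have ca : 0 <= c - a.
  rewrite -(pmulr_rge0 _ (_ : 0 < p - q)); last by lra.
  by apply: le_trans e1; apply: mulr_ge0; lra.
have : (p + q) * (a - b - (b - c)) <= (p + q) * (c - a).
  by apply: (le_trans e1); apply: ler_wpM2r => //; lra.
by rewrite ler_pM2l; lra.
Qed.

Local Notation hs k := ((2^-1 : R) ^+ k).

Lemma hs_gt0 k : 0 < hs k.
Proof. by rewrite exprn_gt0. Qed.

Lemma hs_le k m : (k <= m)%N -> hs m <= hs k.
Proof. by move=> km; apply: ler_wiXn2l => //; lra. Qed.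

Lemma hs_scale_cvg0 x : (hs k)%:C *: x @[k --> \oo] --> (0 : V).
Proof.
apply: (@cvg_rnorm_squeeze _ _ _ _ _ _ _ (fun k => hs k * rnorm x)).
  apply: nearW => k; by rewrite sub0r rnormN rnormZr gtr0_norm// hs_gt0.
by rewrite -(mul0r (rnorm x)); apply: cvgMl; exact: exp2V_cvg0.
Qed.

Lemma resolvent_cvg x : J (hs k) x @[k --> \oo] --> x.
Proof.
pose u k := J (hs k) x - x.
have [l ul] : exists l : V, u n @[n --> \oo] --> l.
  apply: V_complete => e e0.
  pose E := range (fun n => rnorm (u n) ^+ 2).
  have infE : has_inf E.
    split; first by exists (rnorm (u 0%N) ^+ 2), 0%N.
    by exists 0 => _ [n _ <-]; exact: sqr_ge0.
  have [_ [n _ <-] hn] := inf_adherent (exprn_gt0 2 e0) infE.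
  exists n => m nm; rewrite -(ltr_pXn2r (n := 2)) ?nnegrE ?rnorm_ge0 ?ltW//.
  rewrite rnorm_distC (le_lt_trans (resolvent_monotone _ (hs_gt0 m) (hs_le nm)))//.
  have : inf E <= rnorm (u m) ^+ 2 by apply: ge_inf; [case: infE|exists m].
  by rewrite /u in hn *; lra.
have Jl : J (hs k) x @[k --> \oo] --> l + x.
  rewrite (_ : (fun k => _) = (fun k => u k + x)).
    by apply: cvgD => //; exact: cvg_cst.
  by apply/funext => k; rewrite subrK.
have orth z : D z -> ip l z = 0.
  have le1 z' : D z' -> ip l (l + x) <= ip l z'.
    move=> Dz; rewrite -subr_le0 -(ipNr ipP) -(ipDr ipP).
    apply: (ip_cvg_le ipP (f := fun k => u k - (hs k)%:C *: A z')
      (g := fun k => J (hs k) x - z') (F := \oo)).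
    - by rewrite -[l]subr0; apply: cvgB => //; exact: hs_scale_cvg0.
    - by apply: cvgB => //; exact: cvg_cst.
    - apply: nearW => k; have [DJ JE] := JP x (hs_gt0 k).
      rewrite /u -{2}JE subKr -scalerBr -AB// (ipZl ipP) pmulr_rle0 ?hs_gt0//.
      by apply: A_dissipative; exact: DB.
  move=> Dz; apply/eqP/negP => /negP lz0.
  have := le1 _ (DZ (((ip l (l + x) - 1) / ip l z)%:C) Dz).
  by rewrite (ipZr ipP) divfK//; lra.
have l0 : l = 0.
  have [v Dv vl] := A_range l ltr01.
  have := orth v Dv; rewrite -{1}vl scale1r (ipDl ipP) (ipNl ipP) (ip_rnorm ipP).
  move=> h; have v0 : v = 0.
    apply/rnorm0_eq0/eqP; rewrite -sqrf_eq0; apply/eqP/le_anti.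
    by rewrite sqr_ge0 andbT; have := A_dissipative Dv; lra.
  by rewrite -vl v0 A0 scaler0 subr0.
by move: Jl; rewrite l0 add0r.
Qed.

Lemma domain_dense x e : 0 < e -> exists2 z, D z & rnorm (x - z) < e.
Proof.
move=> e0; have /cvg_rnorm/(_ _ e0)[n _ /(_ n (leqnn n))] := @resolvent_cvg x.
by move=> h; exists (J (hs n) x) => //; exact/J_D/hs_gt0.
Qed.

Lemma domain2_dense x e : 0 < e ->
  exists z, [/\ D z, D (A z) & rnorm (x - z) < e].
Proof.
move=> e0; have e2 : 0 < e / 2 by rewrite divr_gt0.
have [z Dz xz] := domain_dense x e2.
have /cvg_rnorm/(_ _ e2)[n _ /(_ n (leqnn n))] := @resolvent_cvg z.
move=> h; exists (J (hs n) z); split; first exact/J_D/hs_gt0.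
  by have [] := AJ (hs_gt0 n) Dz.
by rewrite (le_lt_trans (rnormB_trans z _ _))// (splitr e) ltrD.
Qed.

Definition nsteps k (t : R) : nat := Num.truncn (2 ^+ k * t).

Definition euler k (t : R) : V -> V := iter (nsteps k t) (J (hs k)).

Lemma nsteps_itv k t : 0 <= t ->
  (nsteps k t)%:R * hs k <= t < (nsteps k t)%:R * hs k + hs k.
Proof.
move=> t0; have p0 : 0 < (2 : R) ^+ k by rewrite exprn_gt0.
have /truncn_itv/andP[h1 h2] : 0 <= 2 ^+ k * t by rewrite mulr_ge0// ltW.
rewrite exprVn ler_pdivrMr// mulrC h1 /=.
rewrite -(ltr_pM2l p0) mulrDr mulrCA divff ?gt_eqF// mulr1.
by rewrite natr1.
Qed.

Lemma nstepsS k t : 0 <= t ->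
  nsteps k.+1 t = (nsteps k t).*2 \/ nsteps k.+1 t = (nsteps k t).*2.+1.
Proof.
move=> t0; have /andP[a1 a2] := nsteps_itv k t0.
have /andP[b1 b2] := nsteps_itv k.+1 t0.
have p0 := hs_gt0 k.
have c1 : (nsteps k.+1 t < (nsteps k t).*2.+2)%N.
  rewrite -(ltr_nat R) -(ltr_pM2r p0).
  have -> : (nsteps k t).*2.+2%:R = 2 * (nsteps k t)%:R + 2 :> R.
    by rewrite -addn2 natrD -mul2n natrM.
  by move: b1; rewrite exprS; lra.
have c2 : ((nsteps k t).*2 < (nsteps k.+1 t).+1)%N.
  rewrite -(ltr_nat R) -(ltr_pM2r p0).
  rewrite -natr1 -mul2n natrM.
  by move: b2; rewrite exprS; lra.
by lia.
Qed.

Lemma nstepsD k s t : 0 <= s -> 0 <= t ->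
  nsteps k (s + t) = (nsteps k s + nsteps k t)%N \/
  nsteps k (s + t) = (nsteps k s + nsteps k t).+1.
Proof.
move=> s0 t0; have /andP[a1 a2] := nsteps_itv k s0.
have /andP[b1 b2] := nsteps_itv k t0.
have /andP[c1 c2] := nsteps_itv k (addr_ge0 s0 t0).
have p0 := hs_gt0 k.
have e1 : (nsteps k (s + t) < (nsteps k s + nsteps k t).+2)%N.
  rewrite -(ltr_nat R) -(ltr_pM2r p0).
  have -> : (nsteps k s + nsteps k t).+2%:R =
      (nsteps k s)%:R + (nsteps k t)%:R + 2 :> R by rewrite -addn2 !natrD.
  by lra.
have e2 : (nsteps k s + nsteps k t < (nsteps k (s + t)).+1)%N.
  rewrite -(ltr_nat R) -(ltr_pM2r p0).
  by rewrite -natr1 natrD; lra.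
by lia.
Qed.

Lemma euler_le k t x : rnorm (euler k t x) <= rnorm x.
Proof. exact/iterJ_le/hs_gt0. Qed.

Lemma euler_B k t x y : euler k t (x - y) = euler k t x - euler k t y.
Proof. exact/iterJ_B/hs_gt0. Qed.

Lemma euler_step_le k t x : 0 <= t -> D x -> D (A x) ->
  rnorm (euler k t x - euler k.+1 t x) <=
  (t * rnorm (A (A x)) + rnorm (A x)) * hs k.
Proof.
move=> t0 Dx DAx; have p0 := hs_gt0 k; have /andP[a1 _] := nsteps_itv k t0.
have le1 := iter_halving (nsteps k t) p0 Dx DAx.
have hsS : hs k / 2 = hs k.+1 by rewrite exprS mulrC.
have {}le1 : rnorm (euler k t x - iter (nsteps k t).*2 (J (hs k.+1)) x) <=
    t * rnorm (A (A x)) * hs k.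
  rewrite -hsS; apply: (le_trans le1).
  have ha0 : 0 <= hs k * rnorm (A (A x)) by rewrite mulr_ge0 ?rnorm_ge0 ?ltW.
  have := ler_wpM2r ha0 a1; have := mulr_ge0 t0 ha0.
  move: (rnorm _) (_%:R) (hs k) => a n h; lra.
have le2 : rnorm (J (hs k.+1) x - x) <= rnorm (A x) * hs k.
  rewrite (le_trans (J_sub_le (hs_gt0 _) Dx))// mulrC ler_wpM2l ?rnorm_ge0//.
  exact: hs_le.
rewrite mulrDl; case: (nstepsS k t0) => eqn.
  by rewrite /euler eqn (le_trans le1)// lerDl mulr_ge0 ?rnorm_ge0 ?ltW.
apply: (le_trans (rnormB_trans (iter (nsteps k t).*2 (J (hs k.+1)) x) _ _)).
apply: lerD => //; rewrite /euler eqn iterSr -iterJ_B ?hs_gt0//.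
rewrite (le_trans (iterJ_le (hs_gt0 _) _ _))// rnorm_distC.
exact: le2.
Qed.

Lemma euler_cvg t x : 0 <= t -> exists l : V, euler k t x @[k --> \oo] --> l.
Proof.
move=> t0; apply: V_complete => e e0; have e4 : 0 < e / 4 by rewrite divr_gt0.
have [z [Dz DAz xz]] := domain2_dense x e4.
have st := geometric_step_le (fun k => euler_step_le k t0 Dz DAz).
set C := t * _ + _ in st.
have : 2 * C * hs k @[k --> \oo] --> 2 * C * 0.
  by apply: cvgMr; exact: exp2V_cvg0.
rewrite mulr0 => /cvgrPdist_lt/(_ _ e4)[n _ /(_ n (leqnn n))].
rewrite /= sub0r normrN => hn; exists n => m nm.
have {}st := st n (m - n)%N; rewrite subnKC// in st.
have le1 : rnorm (euler n t x - euler n t z) <= rnorm (x - z).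
  by rewrite -euler_B euler_le.
have le2 : rnorm (euler m t z - euler m t x) <= rnorm (x - z).
  by rewrite -euler_B (le_trans (euler_le _ _ _))// rnorm_distC.
rewrite (le_lt_trans (rnormB_trans (euler n t z) _ _))//.
have := rnormB_trans (euler m t z) (euler n t z) (euler m t x).
have := le_lt_trans (le_trans st (ler_norm _)) hn.
lra.
Qed.

Definition generated t x : V := xget 0 [set l : V | euler k t x @[k --> \oo] --> l].

Lemma generatedP t x : 0 <= t -> euler k t x @[k --> \oo] --> generated t x.
Proof.
by move=> /euler_cvg-/(_ x)[l hl]; rewrite /generated; case: xgetP => // /(_ l).
Qed.

Lemma generated_unique t x l : 0 <= t ->
  euler k t x @[k --> \oo] --> l -> generated t x = l.
Proof. by move=> t0; apply: cvg_unique => //; exact: generatedP. Qed.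

Lemma generated_linear t : 0 <= t -> linear (generated t).
Proof.
move=> t0 a x y; apply: generated_unique => //.
rewrite (_ : (fun k => _) = (fun k => a *: euler k t x + euler k t y)).
  by apply: cvgD; [apply: cvgZr|]; exact: generatedP.
by apply/funext => k; rewrite /euler iterJ_linear// hs_gt0.
Qed.

Lemma generated_B t x y : 0 <= t ->
  generated t (x - y) = generated t x - generated t y.
Proof.
by move=> t0; rewrite addrC -scaleN1r generated_linear// scaleN1r addrC.
Qed.

Lemma generated_le t x : 0 <= t -> rnorm (generated t x) <= rnorm x.
Proof.
move=> t0; apply: (@rnorm_lim_le _ _ _ \oo _ (fun k => euler k t x)).
  exact: generatedP.
by apply: nearW => k; exact: euler_le.
Qed.

Lemma generated0 x : generated 0 x = x.
Proof.
apply: generated_unique => //; rewrite (_ : (fun k => _) = cst x).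
  exact: cvg_cst.
by apply/funext => k; rewrite /euler /nsteps mulr0 truncn0.
Qed.

Lemma generatedD s t x : 0 <= s -> 0 <= t ->
  generated (s + t) x = generated s (generated t x).
Proof.
move=> s0 t0; apply: generated_unique; first exact: addr_ge0.
have h1 : euler k s (euler k t x) @[k --> \oo] --> generated s (generated t x).
  rewrite -[generated s _]addr0.
  rewrite (_ : (fun k => _) = (fun k => euler k s (generated t x) +
      (euler k s (euler k t x) - euler k s (generated t x)))).
    apply: cvgD; first exact: generatedP.
    apply: (@cvg_rnorm_squeeze _ _ _ _ _ _ _
      (fun k => rnorm (euler k t x - generated t x))).
      by apply: nearW => k; rewrite sub0r rnormN -euler_B euler_le.
    rewrite -(@rnorm0 _ V); apply: rnorm_cvg; rewrite -(subrr (generated t x)).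
    by apply: cvgB; [exact: generatedP | exact: cvg_cst].
  by apply/funext => k; rewrite [RHS]addrC subrK.
rewrite -[generated s _]addr0.
rewrite (_ : (fun k => _) = (fun k => euler k s (euler k t x) +
    (euler k (s + t) x - euler k s (euler k t x)))).
  apply: cvgD => //.
  apply: (@cvg_rnorm_squeeze _ _ _ _ _ _ _ (fun k => rnorm (J (hs k) x - x))).
    apply: nearW => k; rewrite sub0r rnormN /euler -iterD.
    case: (nstepsD k s0 t0) => ->; first by rewrite subrr rnorm0 rnorm_ge0.
    by rewrite iterSr -iterJ_B ?hs_gt0// iterJ_le// hs_gt0.
  rewrite -(@rnorm0 _ V); apply: rnorm_cvg; rewrite -(subrr x).
  by apply: cvgB; [exact: resolvent_cvg | exact: cvg_cst].
by apply/funext => k; rewrite [RHS]addrC subrK.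
Qed.

Lemma euler_sub_le k t y z : 0 <= t -> D z ->
  rnorm (euler k t y - y) <= 2 * rnorm (y - z) + t * rnorm (A z).
Proof.
move=> t0 Dz; have /andP[a1 _] := nsteps_itv k t0.
have le1 : rnorm (euler k t y - euler k t z) <= rnorm (y - z).
  by rewrite -euler_B euler_le.
have le2 : rnorm (euler k t z - z) <= t * rnorm (A z).
  apply: (le_trans (iterJ_sub_le (hs_gt0 k) _ Dz)).
  by rewrite ler_wpM2r ?rnorm_ge0.
have := rnormB_trans (euler k t z) (euler k t y) y.
have := rnormB_trans z (euler k t z) y; rewrite (rnorm_distC z y).
lra.
Qed.

Lemma generated_sub_le t y z : 0 <= t -> D z ->
  rnorm (generated t y - y) <= 2 * rnorm (y - z) + t * rnorm (A z).
Proof.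
move=> t0 Dz; apply: (@rnorm_lim_le _ _ _ \oo _ (fun k => euler k t y - y)).
  by apply: cvgB; [exact: generatedP | exact: cvg_cst].
by apply: nearW => k; exact: euler_sub_le.
Qed.

Lemma generated_increment_le t x z : 0 <= t -> D x -> D z ->
  rnorm (generated t x - x - t%:C *: A x) <=
  t * (2 * rnorm (A x - z) + t * rnorm (A z)).
Proof.
move=> t0 Dx Dz; apply: (@rnorm_lim_le _ _ _ \oo _ (fun k => euler k t x - x -
    ((nsteps k t)%:R * hs k)%:C *: A x)).
  apply: cvgB; first by apply: cvgB; [exact: generatedP | exact: cvg_cst].
  apply: (@cvg_rnorm_squeeze _ _ _ _ _ _ _ (fun k => hs k * rnorm (A x))).
    apply: nearW => k; rewrite -scalerBl -rmorphB rnormZr ler_wpM2r ?rnorm_ge0//.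
    have /andP[a1 a2] := nsteps_itv k t0.
    by rewrite ger0_norm; lra.
  by rewrite -(mul0r (rnorm (A x))); apply: cvgMl; exact: exp2V_cvg0.
apply: nearW => k; have p0 := hs_gt0 k; have /andP[a1 _] := nsteps_itv k t0.
rewrite (le_trans (iterJ_increment_le p0 _ Dx))//.
set c := 2 * _ + _.
have c0 : 0 <= c by rewrite addr_ge0// mulr_ge0// rnorm_ge0.
apply: (@le_trans _ _ (\sum_(j < nsteps k t) hs k * c)).
  apply: ler_sum => j _; rewrite ler_pM2l//.
  have le1 := iterJ_le p0 j.+1 (A x - z); rewrite iterJ_B// in le1.
  have le2 := iterJ_sub_le p0 j.+1 Dz.
  have le3 : j.+1%:R * hs k * rnorm (A z) <= t * rnorm (A z).
    rewrite ler_wpM2r ?rnorm_ge0// (le_trans _ a1)//.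
    by apply: ler_wpM2r; [exact: ltW | rewrite ler_nat].
  have := rnormB_trans (iter j.+1 (J (hs k)) z) (iter j.+1 (J (hs k)) (A x)) (A x).
  have := rnormB_trans z (iter j.+1 (J (hs k)) z) (A x).
  by rewrite (rnorm_distC z (A x)) /c; lra.
by rewrite sumr_const card_ord -[leLHS]mulr_natl mulrA ler_wpM2r.
Qed.

Lemma generated_C0_semigroup : C0_semigroup generated.
Proof.
split.
- move=> t t0; split; first exact: generated_linear.
  move=> x; apply: (@cvg_rnorm_squeeze _ _ _ _ _ _ _ (fun y => rnorm (x - y))).
    by apply: nearW => y; rewrite -generated_B// generated_le.
  rewrite -(@rnorm0 _ V); apply: rnorm_cvg; rewrite -(subrr x).
  by apply: cvgB; [exact: cvg_cst|exact: cvg_id].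
- by apply/funext => x; rewrite generated0.
- by move=> s t s0 t0; apply/funext => x /=; rewrite generatedD.
- move=> x; apply/cvg_rnorm => e e0; have e4 : 0 < e / 4 by rewrite divr_gt0.
  have [z Dz xz] := domain_dense x e4.
  have h0 : 0 < e / 2 / (rnorm (A z) + 1).
    by rewrite !divr_gt0// ltr_wpDl// rnorm_ge0.
  near=> t; have t0 : 0 < t by near: t; exact: nbhs_right_gt.
  rewrite rnorm_distC (le_lt_trans (generated_sub_le x (ltW t0) Dz))//.
  have : t < e / 2 / (rnorm (A z) + 1) by near: t; exact: nbhs_right_lt.
  rewrite ltr_pdivlMr; last by rewrite ltr_wpDl// rnorm_ge0.
  by lra.
Unshelve. all: end_near. Qed.

Lemma generated_contractive : contractive generated.
Proof. by move=> t x t0; rewrite !rnormE lecR generated_le. Qed.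

Lemma generated_derivative x : D x ->
  (t^-1)%:C *: (generated t x - x) @[t --> 0^'+] --> A x.
Proof.
move=> Dx; apply/cvg_rnorm => e e0; have e4 : 0 < e / 4 by rewrite divr_gt0.
have [z Dz xz] := domain_dense (A x) e4.
have h0 : 0 < e / 2 / (rnorm (A z) + 1).
  by rewrite !divr_gt0// ltr_wpDl// rnorm_ge0.
near=> t; have t0 : 0 < t by near: t; exact: nbhs_right_gt.
rewrite rnorm_distC.
rewrite (_ : _ - _ = (t^-1)%:C *: (generated t x - x - t%:C *: A x)).
  rewrite rnormZr gtr0_norm ?invr_gt0// ltr_pdivrMl//.
  rewrite (le_lt_trans (generated_increment_le (ltW t0) Dx Dz))// ltr_pM2l//.
  have : t < e / 2 / (rnorm (A z) + 1) by near: t; exact: nbhs_right_lt.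
  rewrite ltr_pdivlMr; last by rewrite ltr_wpDl// rnorm_ge0.
  by lra.
by rewrite [RHS]scalerBr scalerA -rmorphM mulVf ?gt_eqF// scale1r.
Unshelve. all: end_near. Qed.

Lemma generated_generator : is_generator A generated.
Proof.
move=> x y; split=> [[Dx <-]|xy]; first exact: generated_derivative.
have [z Dz] := A_range (x - y) ltr01; rewrite scale1r => zE.
have xzE : x - z = y - A z.
  rewrite -{1}(subrK y x) -zE addrAC [z - _ - z]addrAC subrr sub0r.
  by rewrite addrC.
have wv : (t^-1)%:C *: (generated t (x - z) - (x - z)) @[t --> 0^'+] -->
    y - A z.
  apply: cvg_trans (cvgB xy (generated_derivative Dz)).
  apply: near_eq_cvg; near=> t.
  have t0 : 0 < t by near: t; exact: nbhs_right_gt.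
  by rewrite !fctE generated_B ?ltW// -scalerBr subrACA.
have := contraction_derivative_dissipative ipP generated_contractive wv.
rewrite -xzE (ip_rnorm ipP) => h.
have /eqP : rnorm (x - z) ^+ 2 = 0 by apply/le_anti; rewrite h sqr_ge0.
rewrite sqrf_eq0 => /eqP/rnorm0_eq0/subr0_eq xz; rewrite xz; split => //.
by rewrite -[A z](subKr z) zE -xz subKr.
Unshelve. all: end_near. Qed.

Theorem m_dissipative_generates : generates_contraction_semigroup A.
Proof.
exists generated; split; [exact: generated_C0_semigroup|
  exact: generated_contractive|exact: generated_generator].
Qed.

End m_dissipative.

Section totally_bounded.
Variables (R : realType) (V : normedModType R[i]).
Hypothesis V_complete : seq_complete V.

Local Notation hs k := ((2^-1 : R) ^+ k).

Lemma closure_rnorm (E : set V) x e : closure E x -> 0 < e ->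
  exists2 y, E y & rnorm (x - y) < e.
Proof.
move=> /(_ [set y | rnorm (x - y) < e]) h e0.
have [|y [Ey ye]] := h; last by exists y.
by have /cvg_rnorm/(_ _ e0) := @cvg_id _ (nbhs x).
Qed.

Lemma closure_finite_cover (K : finType) (E : set V) (C : K -> set V) :
  E `<=` \bigcup_k C k -> closure E `<=` \bigcup_k closure (C k).
Proof.
move=> EC x xE; apply: contrapT => /= nx.
have {}nx k : exists2 B, nbhs x B & C k `&` B = set0.
  apply: contrapT => nB; apply: nx; exists k => // B xB.
  by apply/set0P/negP => /eqP CB; apply: nB; exists B.
have : nbhs x [set y | forall k, ~ C k y].
  apply: filter_forall => k; have [B xB CB] := nx k.
  apply: filterS xB => y By Cy.
  by have : (C k `&` B) y by []; rewrite CB.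
by move=> /xE [y [/EC [k _ Cky] /(_ k)]].
Qed.

Lemma ultra_finite_cover (K : finType) (F : set_system V) (C : K -> set V) :
  UltraFilter F -> F (\bigcup_k C k) -> exists k, F (C k).
Proof.
move=> FU FC; apply: contrapT => nF.
have : F [set y | forall k, ~ C k y].
  apply: filter_forall => k; case: (in_ultra_setVsetC (C k) FU) => // FCk.
  by exfalso; apply: nF; exists k.
by move=> /(filterI FC)/filter_ex [y [[k _ Cky] /(_ k)]].
Qed.

Lemma small_cells_compact (S : V -> V) :
  (forall e : R, 0 < e -> exists (K : finType) (cell : V -> K),
    forall x y, rnorm x <= 1 -> rnorm y <= 1 -> cell x = cell y ->
      rnorm (S x - S y) <= e) ->
  compact_operator S.
Proof.
move=> hS; rewrite /compact_operator; set E := S @` _.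
rewrite compact_ultra => F FU FE.
have small e : 0 < e -> exists2 C, F C & forall x y, C x -> C y -> rnorm (x - y) <= e.
  move=> e0; have [K [cell hcell]] := hS e e0.
  pose C k := S @` [set x | `|x| <= 1 /\ cell x = k].
  have EC : E `<=` \bigcup_k C k.
    by move=> _ [x x1 <-]; exists (cell x) => //; exists x.
  have [k FCk] := ultra_finite_cover FU (filterS (closure_finite_cover EC) FE).
  exists (closure (C k)) => // x y xC yC; apply/ler_addgt0Pr => d d0.
  have d2 : 0 < d / 2 by rewrite divr_gt0.
  have [_ [x' [x'1 x'k] <-] xx'] := closure_rnorm xC d2.
  have [_ [y' [y'1 y'k] <-] yy'] := closure_rnorm yC d2.
  have le1 : rnorm (S x' - S y') <= e.
    by apply: hcell; rewrite ?x'k ?y'k// -lecR -rnormE.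
  have := rnormB_trans (S x') x y; have := rnormB_trans (S y') (S x') y.
  rewrite (rnorm_distC (S y') y); lra.
have {}small k : exists C : set V, F C /\ forall x y, C x -> C y -> rnorm (x - y) <= hs k.
  by have [C] := small (hs k) (hs_gt0 _ k); exists C.
have {small} [C hC] := choice small.
have pick k : exists x, forall j : 'I_k.+1, C j x.
  have : F [set x | forall j : 'I_k.+1, C j x].
    by apply: filter_forall => j; case: (hC j).
  by move=> /filter_ex [x]; exists x.
have {pick} [p hp] := choice pick.
have pC k n : (k <= n)%N -> C k (p n).
  by move=> kn; exact: (hp n (Ordinal (kn : k < n.+1)%N)).
have [l pl] : exists l : V, p n @[n --> \oo] --> l.
  apply: V_complete => e e0.
  have /cvgrPdist_lt/(_ _ e0)[n _ /(_ n (leqnn n))] := @exp2V_cvg0 R.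
  rewrite /= sub0r normrN => hn; exists n => m nm.
  apply: le_lt_trans hn; apply: le_trans (ler_norm _).
  by case: (hC n) => _; apply; apply: pC.
have Fl : F --> l.
  suff : id @ F --> l by [].
  apply/cvg_rnorm => e e0; have e2 : 0 < e / 2 by rewrite divr_gt0.
  have /cvgrPdist_lt/(_ _ e2)[n _ hn] := @exp2V_cvg0 R.
  move: pl => /cvg_rnorm/(_ _ e2)[m _ hm].
  have [FC Cd] := hC n; apply: filterS FC => x Cx.
  apply: (le_lt_trans (rnormB_trans (p (maxn n m)) _ _)).
  rewrite (splitr e); apply: ltr_leD; first by apply: hm; rewrite /= leq_maxr.
  apply: (le_trans (Cd _ _ (pC _ _ (leq_maxl _ _)) Cx)).
  have := hn n (leqnn n); rewrite /= sub0r normrN => /ltW.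
  exact: le_trans (ler_norm _).
exists l; split=> //; apply: closed_closure => B /Fl FB.
exact: filter_ex (filterI FE FB).
Qed.

End totally_bounded.

Section real_integrals.
Variable R : realType.
Notation mu := (@lebesgue_measure R).
Notation I := (@I01 R).
Implicit Types f g : R -> R.

Definition L1 (f : R -> R) := mu.-integrable I (EFin \o f).
Definition rint (f : R -> R) : R := (\int[mu]_(z in I) f z)%R.

Let mI : measurable I := @measurable_I01 R.

Lemma mu_I01 : mu I = 1%E.
Proof. by rewrite lebesgue_measure_itv/= lte_fin ltr01 oppr0 adde0. Qed.

Lemma L1_measurable f : L1 f -> measurable_fun I f.
Proof. by case/integrableP => /measurable_EFinP. Qed.

Lemma L1_cst c : L1 (fun=> c).
Proof.
apply/integrableP; split; first exact: measurable_cst.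
rewrite (_ : (fun z => `|(EFin \o (fun=> c)) z|%E) = cst `|c|%:E)//.
by rewrite integral_cst//= [X in (_ * X)%E](mu_I01 : _ = _) mule1 ltry.
Qed.

Lemma L1D f g : L1 f -> L1 g -> L1 (fun z => f z + g z).
Proof.
move=> fi gi; rewrite /L1 (_ : _ \o _ = (fun z => (f z)%:E + (g z)%:E)%E) //.
exact: integrableD.
Qed.

Lemma L1Z c f : L1 f -> L1 (fun z => c * f z).
Proof.
move=> fi; rewrite /L1 (_ : _ \o _ = (fun z => c%:E * (f z)%:E)%E) //.
exact: integrableZl.
Qed.

Lemma eq_L1 f g : f =1 g -> L1 f -> L1 g.
Proof. by move=> /funext ->. Qed.

Lemma L1N f : L1 f -> L1 (fun z => - f z).
Proof. by move=> /(L1Z (-1)); apply: eq_L1 => z; rewrite mulN1r. Qed.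

Lemma L1B f g : L1 f -> L1 g -> L1 (fun z => f z - g z).
Proof. by move=> fi gi; exact: (L1D fi (L1N gi)). Qed.

Lemma L1_sum (J : Type) (s : seq J) (F : J -> R -> R) :
  (forall j, L1 (F j)) -> L1 (fun z => \sum_(j <- s) F j z).
Proof.
move=> FJ; elim: s => [|j s IH].
  by apply: (@eq_L1 (fun=> 0)); [move=> z; rewrite big_nil | exact: L1_cst].
apply: (@eq_L1 (fun z => F j z + \sum_(j <- s) F j z)).
  by move=> z; rewrite big_cons.
exact: L1D.
Qed.

Lemma L1_ae_le f g : measurable_fun I f -> L1 g ->
  {ae mu, forall z, I z -> `|f z| <= g z} -> L1 f.
Proof. exact: ae_le_integrable. Qed.

Lemma L1_le f g : measurable_fun I f -> L1 g -> (forall z, `|f z| <= g z) -> L1 f.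
Proof. by move=> mf gi fg; apply: (L1_ae_le mf gi); apply: nearW => z _. Qed.

Lemma L1_ae f g : measurable_fun I f -> L1 g ->
  {ae mu, forall z, I z -> f z = g z} -> L1 f.
Proof.
move=> mf gi fg; apply: (L1_ae_le mf (g := fun z => `|g z| : R)); last first.
  by apply: filterS fg => z /[swap] zI /(_ zI) ->.
exact: integrable_norm gi.
Qed.

Lemma rintD f g : L1 f -> L1 g -> rint (fun z => f z + g z) = rint f + rint g.
Proof. by move=> fi gi; exact: RintegralD. Qed.

Lemma rintZ c f : L1 f -> rint (fun z => c * f z) = c * rint f.
Proof. by move=> fi; exact: RintegralZl. Qed.

Lemma rintN f : L1 f -> rint (fun z => - f z) = - rint f.
Proof.
move=> fi; rewrite -mulN1r -rintZ//; congr rint.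
by apply/funext => z; rewrite mulN1r.
Qed.

Lemma rintB f g : L1 f -> L1 g -> rint (fun z => f z - g z) = rint f - rint g.
Proof. by move=> fi gi; exact: RintegralB. Qed.

Lemma rint_cst c : rint (fun=> c) = c.
Proof.
rewrite /rint Rintegral_cst// [X in fine X](mu_I01 : _ = _).
by rewrite mulr1.
Qed.

Lemma rint_sum (J : Type) (s : seq J) (F : J -> R -> R) :
  (forall j, L1 (F j)) ->
  rint (fun z => \sum_(j <- s) F j z) = \sum_(j <- s) rint (F j).
Proof.
move=> FJ; elim: s => [|j s IH].
  rewrite big_nil -[RHS](rint_cst 0); congr rint.
  by apply/funext => z; rewrite big_nil.
rewrite big_cons -IH -rintD//; last exact: L1_sum.
by congr rint; apply/funext => z; rewrite big_cons.
Qed.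

Lemma rint_ae f g : measurable_fun I f -> measurable_fun I g ->
  {ae mu, forall z, I z -> f z = g z} -> rint f = rint g.
Proof. exact: ae_eq_Rintegral. Qed.

Lemma rint_ae_le f g : L1 f -> L1 g ->
  {ae mu, forall z, I z -> f z <= g z} -> rint f <= rint g.
Proof. exact: ae_le_Rintegral. Qed.

Lemma rint_le f g : L1 f -> L1 g -> (forall z, I z -> f z <= g z) -> rint f <= rint g.
Proof. by move=> fi gi fg; apply: rint_ae_le => //; apply: nearW. Qed.

Lemma rint_ge0 f : (forall z, I z -> 0 <= f z) -> 0 <= rint f.
Proof. by move=> f0; rewrite /rint; apply: Rintegral_ge0. Qed.

Lemma rint_eq f g : (forall z, I z -> f z = g z) -> rint f = rint g.
Proof. by move=> fg; apply: eq_Rintegral => z; rewrite inE => /fg. Qed.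

Lemma rint_eq0_ae f : L1 f -> (forall z, 0 <= f z) -> rint f = 0 ->
  {ae mu, forall z, I z -> f z = 0}.
Proof.
move=> fi f0 If.
have mf : measurable_fun I (EFin \o f) by case/integrableP: fi.
have I0 : (\int[mu]_(z in I) `|(EFin \o f) z| = 0)%E.
  have -> : (\int[mu]_(z in I) `|(EFin \o f) z| = \int[mu]_(z in I) (f z)%:E)%E.
    by apply: eq_integral => z _; rewrite gee0_abs// lee_fin f0.
  by rewrite -[LHS]fineK; [rewrite -[fine _]/(rint f) If|exact: integrable_fin_num].
have /(ae_eq_integral_abs mu mI mf) h := I0.
by apply: filterS h => z hz zI; move: (hz zI) => -[].
Qed.

End real_integrals.

Section complex_integrals.
Variable R : realType.
Notation mu := (@lebesgue_measure R).
Notation I := (@I01 R).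
Notation C := R[i].
Implicit Types (f g : R -> C) (c : C).

Local Notation Re := (@complex.Re R).
Local Notation Im := (@complex.Im R).

Definition csq (c : C) : R := Re c ^+ 2 + Im c ^+ 2.

Lemma csq_ge0 c : 0 <= csq c. Proof. by rewrite addr_ge0 ?sqr_ge0. Qed.

Lemma csqM a b : csq (a * b) = csq a * csq b.
Proof. by case: a b => [a b] [c e]; rewrite /csq /=; ring. Qed.

Lemma csqD a b : csq (a + b) <= 2 * csq a + 2 * csq b.
Proof.
case: a b => [a b] [c e]; rewrite /csq /=.
by have := sqr_ge0 (a - c); have := sqr_ge0 (b - e); nra.
Qed.

Lemma csqN a : csq (- a) = csq a.
Proof. by case: a => a b; rewrite /csq /= !sqrrN. Qed.

Lemma csqJ (a : C) : csq a^* = csq a.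
Proof. by case: a => a b; rewrite /csq /= sqrrN. Qed.

Lemma csq_real (a : R) : csq a%:C = a ^+ 2.
Proof. by rewrite /csq /= expr0n addr0. Qed.

Lemma csq_eq0 a : csq a = 0 -> a = 0.
Proof.
move=> /eqP; rewrite /csq paddr_eq0 ?sqr_ge0// !sqrf_eq0.
by case: a => a b /= /andP[/eqP -> /eqP ->].
Qed.

Lemma ReM (a b : C) : Re (a * b) = Re a * Re b - Im a * Im b.
Proof. by case: a b => [a b] [c e]. Qed.

Lemma ImM (a b : C) : Im (a * b) = Re a * Im b + Im a * Re b.
Proof. by case: a b => [a b] [c e]. Qed.

Lemma csqC a : (csq a)%:C = a * a^*.
Proof. by case: a => a b; rewrite /csq; simpc; congr (_ +i* _) => /=; ring. Qed.

Lemma normc_csq (a : C) : `|a| = (Num.sqrt (csq a))%:C.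
Proof. by rewrite normc_def. Qed.

Lemma cmeasurableN f : cmeasurable f -> cmeasurable (fun z => - f z).
Proof.
move=> mf; rewrite (_ : (fun _ => _) = (fun z => (-1) * f z)).
  by apply: cmeasurableM => //; exact: cmeasurable_cst.
by apply/funext => z; rewrite mulN1r.
Qed.

Lemma measurable_csq f : cmeasurable f -> measurable_fun I (fun z => csq (f z)).
Proof.
move=> [f1 f2]; apply: measurable_funD;
  by [exact: measurable_funX | exact: measurable_funX].
Qed.

Definition cintegrable f := L1 (fun z => Re (f z)) /\ L1 (fun z => Im (f z)).

Lemma cintegrable_cmeasurable f : cintegrable f -> cmeasurable f.
Proof. by case=> f1 f2; split; exact: L1_measurable. Qed.

Lemma cintegralE f : cintegral f = rint (fun z => Re (f z)) +i* rint (fun z => Im (f z)).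
Proof. by []. Qed.

Lemma eq_cintegral f g : (forall z, I z -> f z = g z) -> cintegral f = cintegral g.
Proof.
by move=> fg; rewrite !cintegralE; congr (_ +i* _); apply: rint_eq => z /fg ->.
Qed.

Lemma cintegral_ae f g : cmeasurable f -> cmeasurable g ->
  {ae mu, forall z, I z -> f z = g z} -> cintegral f = cintegral g.
Proof.
move=> [f1 f2] [g1 g2] fg; rewrite !cintegralE; congr (_ +i* _); apply: rint_ae => //;
  by apply: filterS fg => z /[swap] zI /(_ zI) ->.
Qed.

Lemma eq_cintegrable f g : f =1 g -> cintegrable f -> cintegrable g.
Proof. by move=> /funext ->. Qed.

Lemma cintegrable_cst c : cintegrable (fun=> c).
Proof. by split; exact: L1_cst. Qed.

Lemma cintegrableD f g :
  cintegrable f -> cintegrable g -> cintegrable (fun z => f z + g z).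
Proof.
move=> [f1 f2] [g1 g2]; split; [apply: eq_L1 (L1D f1 g1)|apply: eq_L1 (L1D f2 g2)];
  by move=> z; rewrite raddfD.
Qed.

Lemma cintegralD f g : cintegrable f -> cintegrable g ->
  cintegral (fun z => f z + g z) = cintegral f + cintegral g.
Proof.
move=> [f1 f2] [g1 g2]; rewrite !cintegralE; simpc.
by rewrite -!rintD//; congr (_ +i* _); apply: rint_eq => z _; rewrite raddfD.
Qed.

Lemma cintegrableZ c f : cintegrable f -> cintegrable (fun z => c * f z).
Proof.
move=> [f1 f2]; split.
  by apply: eq_L1 (L1B (L1Z (Re c) f1) (L1Z (Im c) f2)) => z; rewrite ReM.
by apply: eq_L1 (L1D (L1Z (Re c) f2) (L1Z (Im c) f1)) => z; rewrite ImM.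
Qed.

Lemma cintegralZ c f : cintegrable f ->
  cintegral (fun z => c * f z) = c * cintegral f.
Proof.
move=> [f1 f2]; rewrite !cintegralE; case: c => a b; simpc.
rewrite -!rintZ// -rintB -?rintD//; try exact: L1Z.
by congr (_ +i* _); apply: rint_eq => z _; rewrite ?ReM ?ImM.
Qed.

Lemma cintegrableN f : cintegrable f -> cintegrable (fun z => - f z).
Proof. by move=> /(cintegrableZ (-1)); apply: eq_cintegrable => z; rewrite mulN1r. Qed.

Lemma cintegralN f : cintegrable f -> cintegral (fun z => - f z) = - cintegral f.
Proof.
move=> fi; rewrite -mulN1r -cintegralZ//.
by apply: eq_cintegral => z _; rewrite mulN1r.
Qed.

Lemma cintegrableB f g :
  cintegrable f -> cintegrable g -> cintegrable (fun z => f z - g z).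
Proof. by move=> fi gi; exact: (cintegrableD fi (cintegrableN gi)). Qed.

Lemma cintegralB f g : cintegrable f -> cintegrable g ->
  cintegral (fun z => f z - g z) = cintegral f - cintegral g.
Proof. by move=> fi gi; rewrite cintegralD ?cintegralN//; exact: cintegrableN. Qed.

Lemma cintegrable_sum (J : Type) (s : seq J) (F : J -> R -> C) :
  (forall j, cintegrable (F j)) -> cintegrable (fun z => \sum_(j <- s) F j z).
Proof.
move=> FJ; elim: s => [|j s IH].
  by apply: (@eq_cintegrable (fun=> 0)); [move=> z; rewrite big_nil | exact: cintegrable_cst].
apply: (@eq_cintegrable (fun z => F j z + \sum_(j <- s) F j z)).
  by move=> z; rewrite big_cons.
exact: cintegrableD.
Qed.

Lemma cintegral_cst c : cintegral (fun=> c) = c.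
Proof. by rewrite cintegralE !rint_cst; case: c. Qed.

Lemma cintegral_sum (J : Type) (s : seq J) (F : J -> R -> C) :
  (forall j, cintegrable (F j)) ->
  cintegral (fun z => \sum_(j <- s) F j z) = \sum_(j <- s) cintegral (F j).
Proof.
move=> FJ; elim: s => [|j s IH].
  rewrite big_nil -[RHS](cintegral_cst 0).
  by apply: eq_cintegral => z _; rewrite big_nil.
rewrite big_cons -IH -cintegralD//; last exact: cintegrable_sum.
by apply: eq_cintegral => z _; rewrite big_cons.
Qed.

Lemma cintegralJ f : cintegrable f -> cintegral (fun z => (f z)^*) = (cintegral f)^*.
Proof.
move=> [f1 f2]; rewrite !cintegralE; simpc; rewrite -rintN//.
by congr (_ +i* _); apply: rint_eq => z _; case: (f z).
Qed.

Definition L2s f := cmeasurable f /\ L1 (fun z => csq (f z)).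

Lemma eq_L2s f g : f =1 g -> L2s f -> L2s g.
Proof. by move=> /funext ->. Qed.

Lemma L2s_ae f g : cmeasurable f -> L2s g ->
  {ae mu, forall z, I z -> f z = g z} -> L2s f.
Proof.
move=> mf [mg gi] fg; split=> //; apply: (L1_ae (measurable_csq mf) gi).
by apply: filterS fg => z /[swap] zI /(_ zI) ->.
Qed.

Lemma L2s_cst c : L2s (fun=> c).
Proof. by split; [exact: cmeasurable_cst | exact: L1_cst]. Qed.

Lemma L2sD f g : L2s f -> L2s g -> L2s (fun z => f z + g z).
Proof.
move=> [mf fi] [mg gi]; split; first exact: cmeasurableD.
apply: L1_le (L1D (L1Z 2 fi) (L1Z 2 gi)) _.
  by apply: measurable_csq; exact: cmeasurableD.
by move=> z; rewrite ger0_norm ?csq_ge0 ?csqD.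
Qed.

Lemma L2sM_bounded f g K : cmeasurable f ->
  {ae mu, forall z, I z -> csq (f z) <= K} -> L2s g -> L2s (fun z => f z * g z).
Proof.
move=> mf fK [mg gi]; split; first exact: cmeasurableM.
apply: (L1_ae_le _ (L1Z K gi)).
  by apply: measurable_csq; exact: cmeasurableM.
apply: filterS fK => z /[swap] zI /(_ zI) h.
by rewrite ger0_norm ?csq_ge0// csqM ler_wpM2r ?csq_ge0.
Qed.

Lemma L2sZ c f : L2s f -> L2s (fun z => c * f z).
Proof.
apply: L2sM_bounded (csq c) _ _; first exact: cmeasurable_cst.
by apply: nearW.
Qed.

Lemma L2sN f : L2s f -> L2s (fun z => - f z).
Proof. by move=> /(L2sZ (-1)); apply: eq_L2s => z; rewrite mulN1r. Qed.

Lemma L2sB f g : L2s f -> L2s g -> L2s (fun z => f z - g z).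
Proof. by move=> fi gi; exact: (L2sD fi (L2sN gi)). Qed.

Lemma L2sJ f : L2s f -> L2s (fun z => (f z)^*).
Proof.
move=> [mf fi]; split; first exact: cmeasurableJ.
by apply: eq_L1 fi => z; rewrite csqJ.
Qed.

Lemma L2s_sum (J : Type) (s : seq J) (F : J -> R -> C) :
  (forall j, L2s (F j)) -> L2s (fun z => \sum_(j <- s) F j z).
Proof.
move=> FJ; elim: s => [|j s IH].
  by apply: (@eq_L2s (fun=> 0)); [move=> z; rewrite big_nil | exact: L2s_cst].
apply: (@eq_L2s (fun z => F j z + \sum_(j <- s) F j z)).
  by move=> z; rewrite big_cons.
exact: L2sD.
Qed.

Lemma L2sM_integrable f g : L2s f -> L2s g -> cintegrable (fun z => f z * g z).
Proof.
move=> [mf fi] [mg gi]; have [m1 m2] := cmeasurableM mf mg.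
split; [apply: (L1_le m1 (L1D fi gi)) => z|apply: (L1_le m2 (L1D fi gi)) => z];
  case: (f z) (g z) => [a b] [c e]; rewrite /csq /=.
  have := sqr_ge0 (a - c); have := sqr_ge0 (a + c).
  have := sqr_ge0 (b - e); have := sqr_ge0 (b + e).
  by rewrite ler_norml; nra.
have := sqr_ge0 (a - e); have := sqr_ge0 (a + e).
have := sqr_ge0 (b - c); have := sqr_ge0 (b + c).
by rewrite ler_norml; nra.
Qed.

Lemma L2s_cintegrable f : L2s f -> cintegrable f.
Proof.
move=> fi; apply: eq_cintegrable (L2sM_integrable (L2s_cst 1) fi) => z.
by rewrite mul1r.
Qed.

Lemma cauchy_schwarz f g : L2s f -> L2s g ->
  csq (cintegral (fun z => f z * g z)) <=
  rint (fun z => csq (f z)) * rint (fun z => csq (g z)).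
Proof.
move=> fL gL; set w := @cintegral R _; set A := @rint R _; set B := @rint R _.
have fgi := L2sM_integrable fL gL.
have A0 : 0 <= A by apply: rint_ge0 => z _; exact: csq_ge0.
have B0 : 0 <= B by apply: rint_ge0 => z _; exact: csq_ge0.
have h (t : R) : 0 <= A - 2 * t * csq w + t ^+ 2 * csq w * B.
  have -> : A - 2 * t * csq w + t ^+ 2 * csq w * B =
      rint (fun z => csq (f z - t%:C * w * (g z)^*)).
    have e1 : L1 (fun z => csq (f z)) by case: fL.
    have e2 : L1 (fun z => csq (g z)) by case: gL.
    have [e3 _] := cintegrableZ (w^*) fgi.
    have -> : 2 * t * csq w = rint (fun z => 2 * t * Re (w^* * (f z * g z))).
      rewrite rintZ//; congr (_ * _); transitivity (Re (w^* * w)).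
        by rewrite mulrC -csqC.
      by rewrite {2}/w -cintegralZ.
    rewrite -(rintZ _ e2) -rintB//; last exact: L1Z.
    rewrite -rintD; [|by apply: L1B => //; exact: L1Z|exact: L1Z].
    apply: rint_eq => z _; clear e3.
    case: w (f z) (g z) => [w1 w2] [a b] [c e].
    by rewrite /csq; simpc => /=; ring.
  by apply: rint_ge0 => z _; exact: csq_ge0.
have [B1|B1] := eqVneq B 0.
  rewrite B1 mulr0; have := h ((A + 1) / 2 / csq w).
  have [->//|w0] := eqVneq (csq w) 0.
  have -> : 2 * ((A + 1) / 2 / csq w) * csq w = A + 1 by field.
  by rewrite B1; lra.
have Bp : 0 < B by rewrite lt0r B1.
have := h B^-1.
have -> : B^-1 ^+ 2 * csq w * B = B^-1 * csq w by field.
by rewrite -mulrA -ler_pdivrMr// (mulrC (csq w)); move: (B^-1 * csq w) => u; lra.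
Qed.

End complex_integrals.

Section triangle_fubini.
Variable R : realType.
Notation mu := (@lebesgue_measure R).
Notation I := (@I01 R).
Implicit Types g h : R -> R.

Lemma measurable_below h t : measurable_fun I h ->
  measurable_fun I (fun z => if z < t then h z else 0).
Proof.
move=> mh; apply: measurable_fun_if => //.
- exact: measurable_I01.
- by apply: measurable_fun_ltr => //; exact: measurable_cst.
- by apply: (measurable_funS _ _ mh); [exact: measurable_I01 | move=> z []].
Qed.

Lemma L1_below h t : L1 h -> L1 (fun z => if z < t then h z else 0).
Proof.
move=> hi; apply: (L1_le (measurable_below t (L1_measurable hi))
  (g := fun z => `|h z| : R)); first exact: integrable_norm hi.
by move=> z; case: ifP => // _; rewrite normr0.
Qed.

Lemma L1_above h t : L1 h -> L1 (fun z => if t < z then h z else 0).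
Proof.
move=> hi; apply: (@L1_le _ _ (fun z => `|h z| : R)).
- apply: measurable_fun_if => //.
  + exact: measurable_I01.
  + by apply: measurable_fun_ltr => //; exact: measurable_cst.
  + by apply: (measurable_funS _ _ (L1_measurable hi));
      [exact: measurable_I01 | move=> z []].
- exact: integrable_norm hi.
- by move=> z; case: ifP => // _; rewrite normr0.
Qed.

Lemma triangle_fubini g h :
  L1 g -> L1 h ->
  rint (fun s => g s * rint (fun t => if t < s then h t else 0)) =
  rint (fun t => h t * (rint g - rint (fun s => if s < t then g s else 0))).
Proof.
move=> gi hi; have mI : measurable I := @measurable_I01 R.
pose G := g \_ I; pose H := h \_ I.
have iG : mu.-integrable setT (EFin \o G).
  by rewrite -restrict_EFin; apply/integrable_restrict; rewrite ?setTI//; exact: measurable_I01.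
have iH : mu.-integrable setT (EFin \o H).
  by rewrite -restrict_EFin; apply/integrable_restrict; rewrite ?setTI//; exact: measurable_I01.
have mG : measurable_fun setT G by case/integrableP: iG => /measurable_EFinP.
have mH : measurable_fun setT H by case/integrableP: iH => /measurable_EFinP.
pose GR := measurableTypeR R.
pose F (p : GR * GR) : R := if (p.2 < p.1 :> R) then G p.1 * H p.2 else 0.
have mG1 : measurable_fun setT (fun p : GR * GR => G p.1).
  by apply: measurableT_comp => //; exact: measurable_fst.
have mH2 : measurable_fun setT (fun p : GR * GR => H p.2).
  by apply: measurableT_comp => //; exact: measurable_snd.
have mlt : measurable_fun setT (fun p : GR * GR => (p.2 < p.1 :> R)).
  by apply: measurable_fun_ltr.
have mF : measurable_fun setT F.
  by apply: measurable_fun_ifT => //; exact: measurable_funM.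
pose F0 (p : GR * GR) : R := G p.1 * H p.2.
have iF0 : (mu \x mu)%E.-integrable setT (EFin \o F0).
  apply/integrable12ltyP; first by apply/measurable_EFinP; exact: measurable_funM.
  have -> : (\int[mu]_x \int[mu]_y `|(EFin \o F0) (x, y)|
      = (\int[mu]_y `|(H y)%:E|) * \int[mu]_x `|(G x)%:E|)%E.
    have aG : measurable_fun setT (fun x : GR => `|(G x)%:E|%E).
      by apply: measurableT_comp => //; exact/measurable_EFinP.
    have aH : measurable_fun setT (fun x : GR => `|(H x)%:E|%E).
      by apply: measurableT_comp => //; exact/measurable_EFinP.
    have H0 : (0 <= \int[mu]_y `|(H y)%:E|)%E by exact: integral_ge0.
    rewrite -ge0_integralZl//; apply: eq_integral => x _ /=.
    rewrite muleC -ge0_integralZl//; apply: eq_integral => y _.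
    by rewrite -EFinM -normrM.
  move/integrableP: iH => [_ iH]; move/integrableP: iG => [_ iG].
  by apply: lte_mul_pinfty => //; [exact: integral_ge0|
    apply/fin_numPlt; rewrite iH (lt_le_trans _ (integral_ge0 _ _))].
have iF : (mu \x mu)%E.-integrable setT (EFin \o F).
  apply: le_integrable iF0 => //; first exact/measurable_EFinP.
  move=> p _; rewrite /= lee_fin /F; case: ifP => // _.
  by rewrite normr0.
have restrict (f : R -> R) : (\int[mu]_(z in I) (f z)%:E = \int[mu]_z ((f \_ I) z)%:E)%E.
  by rewrite integral_mkcond; apply: eq_integral => z _; rewrite !patchE; case: ifP.
have E1 : rint (fun s => g s * rint (fun t => if t < s then h t else 0)) =
   fine (\int[mu]_s \int[mu]_t (EFin \o F) (s, t))%E.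
  rewrite /rint /Rintegral restrict; congr fine; apply: eq_integral => s _.
  rewrite patchE; case: ifPn => [sI|sI]; last first.
    rewrite integral0_eq// => t _.
    by rewrite /F /= /G patchE (negbTE sI) mul0r; case: ifP.
  have fs := L1_below s hi.
  rewrite EFinM fineK; last exact: integrable_fin_num.
  rewrite -integralZl// restrict; apply: eq_integral => t _.
  by rewrite /F /= /G /H !patchE sI; case: ifP => _; case: ifP => _ //=; rewrite mulr0.
have E2 : rint (fun t => h t * (rint g - rint (fun s => if s < t then g s else 0))) =
   fine (\int[mu]_t \int[mu]_s (EFin \o F) (s, t))%E.
  rewrite /rint /Rintegral restrict; congr fine; apply: eq_integral => t _.
  rewrite patchE; case: ifPn => [tI|tI]; last first.
    rewrite integral0_eq// => s _.
    by rewrite /F /= /H [X in _ * X]patchE (negbTE tI) mulr0; case: ifP.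
  have fs := L1_below t gi.
  rewrite -[fine _ - fine _]/(rint g - rint _) -rintB//.
  have fs' := L1B gi fs.
  rewrite (_ : rint _ = rint (fun s => if t < s then g s else 0)); last first.
    apply: rint_ae; [exact: L1_measurable|exact: L1_measurable (L1_above t gi)|].
    exists [set t]; split => //; first exact: lebesgue_measure_set1.
    move=> s /=; apply: contra_notP => st sI.
    by case: (ltgtP s t) => [_|_|/st//]; rewrite ?subrr ?subr0.
  have fa := L1_above t gi; rewrite EFinM fineK; last exact: integrable_fin_num.
  rewrite -integralZl// restrict; apply: eq_integral => s _.
  by rewrite /F /= /G /H !patchE tI; case: ifP => _; case: ifP => _ //=;
    rewrite ?mulr0 ?mul0r// mulrC.
by rewrite E1 E2 (Fubini iF).
Qed.

End triangle_fubini.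

Section volterra.
Variable R : realType.
Notation mu := (@lebesgue_measure R).
Notation I := (@I01 R).
Notation C := R[i].
Implicit Types (f g h : R -> C) (c : C).

Local Notation Re := (@complex.Re R).
Local Notation Im := (@complex.Im R).

Definition vol h (t : R) : C := cintegral (fun z => if z < t then h z else 0).

Lemma volE h t : vol h t =
  rint (fun z => if z < t then Re (h z) else 0) +i*
  rint (fun z => if z < t then Im (h z) else 0).
Proof.
by rewrite /vol cintegralE; congr (_ +i* _); apply: rint_eq => z _; case: ifP.
Qed.

Lemma cintegrable_below h t :
  cintegrable h -> cintegrable (fun z => if z < t then h z else 0).
Proof.
move=> [h1 h2]; split.
  by apply: eq_L1 (L1_below t h1) => z; case: ifP.
by apply: eq_L1 (L1_below t h2) => z; case: ifP.
Qed.

Lemma volD g h t : cintegrable g -> cintegrable h ->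
  vol (fun z => g z + h z) t = vol g t + vol h t.
Proof.
move=> gi hi; rewrite -cintegralD; try exact: cintegrable_below.
by apply: eq_cintegral => z _; case: ifP => // _; rewrite addr0.
Qed.

Lemma volZ c h t : cintegrable h -> vol (fun z => c * h z) t = c * vol h t.
Proof.
move=> hi; rewrite -cintegralZ; last exact: cintegrable_below.
by apply: eq_cintegral => z _; case: ifP => // _; rewrite mulr0.
Qed.

Lemma vol_ae g h t : cintegrable g -> cintegrable h ->
  {ae mu, forall z, I z -> g z = h z} -> vol g t = vol h t.
Proof.
move=> gi hi gh; apply: cintegral_ae;
  try by apply/cintegrable_cmeasurable/cintegrable_below.
by apply: filterS gh => z /[swap] zI /(_ zI) ->.
Qed.

Lemma vol_le0 h t : t <= 0 -> vol h t = 0.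
Proof.
move=> t0; rewrite -[RHS](cintegral_cst 0); apply: eq_cintegral => z.
rewrite /I01/= in_itv/= => /andP[z0 _].
by rewrite ltNge (le_trans t0 (ltW z0)).
Qed.

Lemma vol_ge1 h t : 1 <= t -> vol h t = cintegral h.
Proof.
move=> t1; apply: eq_cintegral => z.
rewrite /I01/= in_itv/= => /andP[_ z1].
by rewrite (lt_le_trans z1 t1).
Qed.

Lemma L2s_mask (P : R -> bool) h : measurable_fun I P -> L2s h ->
  L2s (fun z => if P z then h z else 0).
Proof.
move=> mP hL; apply: (@eq_L2s _ (fun z => (if P z then 1 else 0) * h z)).
  by move=> z; case: ifP; rewrite ?mul1r ?mul0r.
apply: L2sM_bounded 1 _ _ hL.
  split.
    rewrite (_ : (fun _ => _) = (fun z => if P z then (1:R) else 0)).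
      by apply: measurable_fun_if => //; first exact: measurable_I01.
    by apply/funext => z; case: ifP.
  rewrite (_ : (fun _ => _) = (fun z => (0:R))) //.
  by apply/funext => z; case: ifP.
by apply: nearW => z _; case: ifP => _; rewrite /csq /= !expr0n ?expr1n ?addr0.
Qed.

Lemma measurable_between s t : measurable_fun I (fun z : R => (s <= z) && (z < t)).
Proof.
apply: measurable_and; [apply: measurable_fun_ler|apply: measurable_fun_ltr] => //;
  exact: measurable_cst.
Qed.

Lemma rint_between_le s t : s <= t ->
  rint (fun z => if (s <= z) && (z < t) then 1 else 0 : R) <= t - s.
Proof.
move=> st; rewrite (_ : rint _ = (\int[mu]_(z in I `&` `[s, t[) (1 : R))%R); last first.
  rewrite Rintegral_mkcondr; apply: rint_eq => z _.
  rewrite patchE; case: ifP => zst; first by rewrite mem_set//= in_itv.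
  by rewrite memNset//= in_itv/= zst.
have mI' : measurable (I `&` `[s, t[) by apply: measurableI => //; exact: measurable_I01.
have le1 : (mu (I `&` `[s, t[) <= (t - s)%:E)%E.
  apply: (@le_trans _ _ (mu `[s, t[)).
    by apply: le_measure; rewrite ?inE//; exact: subIsetr.
  rewrite lebesgue_measure_itv/= lte_fin.
  by case: ifP => //; rewrite lee_fin subr_ge0.
rewrite Rintegral_cst// mul1r -lee_fin fineK//.
rewrite ge0_fin_numE//; exact: le_lt_trans le1 (ltry _).
Qed.

Lemma vol_sub_sq_le h s t : L2s h -> s <= t ->
  csq (vol h t - vol h s) <=
  (t - s) * rint (fun z => if (s <= z) && (z < t) then csq (h z) else 0).
Proof.
move=> hL st; have hi := L2s_cintegrable hL.
pose P z : bool := (s <= z) && (z < t).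
have mP : measurable_fun I P := measurable_between s t.
have -> : vol h t - vol h s = cintegral
    (fun z => (if P z then 1 else 0) * (if P z then h z else 0)).
  rewrite -cintegralB; try exact: cintegrable_below.
  apply: eq_cintegral => z _; rewrite /P.
  have [zs|sz] := ltP z s; first by rewrite (lt_le_trans zs st) subrr mul0r.
  by case: ifP => _ /=; rewrite ?mul1r ?mul0r subr0.
apply: (le_trans (cauchy_schwarz (L2s_mask mP (L2s_cst 1)) (L2s_mask mP hL))).
have -> : rint (fun z => csq (if P z then h z else 0)) =
    rint (fun z => if (s <= z) && (z < t) then csq (h z) else 0).
  by apply: rint_eq => z _; rewrite /P; case: ifP => // _; rewrite /csq /= !expr0n addr0.
apply: ler_wpM2r.
  by apply: rint_ge0 => z _; case: ifP => // _; exact: csq_ge0.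
apply: le_trans (rint_between_le st); rewrite le_eqVlt; apply/orP; left; apply/eqP.
by apply: rint_eq => z _; rewrite /P; case: ifP; rewrite /csq /= !expr0n ?expr1n addr0.
Qed.

Lemma vol_holder h s t : L2s h ->
  csq (vol h t - vol h s) <= `|t - s| * rint (fun z => csq (h z)).
Proof.
wlog st : s t / s <= t => [hw hL|hL].
  have [st|/ltW ts] := leP s t; first exact: hw.
  by rewrite -csqN opprB distrC; exact: hw.
rewrite ger0_norm ?subr_ge0//; apply: (le_trans (vol_sub_sq_le hL st)).
apply: ler_wpM2l; first by rewrite subr_ge0.
have [_ hi] := hL; apply: rint_le => //.
  apply: (L1_le _ hi) => [|z]; last first.
    by case: ifP => _; rewrite ?normr0 ?csq_ge0// ger0_norm ?csq_ge0.
  apply: measurable_fun_if => //; [exact: measurable_I01|exact: measurable_between|].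
  by apply: (measurable_funS _ _ (L1_measurable hi));
    [exact: measurable_I01 | move=> z []].
by move=> z _; case: ifP => // _; exact: csq_ge0.
Qed.

Lemma holder_continuous (f : R -> R) (K : R) :
  (forall s t, (f t - f s) ^+ 2 <= `|t - s| * K) -> continuous f.
Proof.
move=> fK s; apply/cvgrPdist_lt => e e0.
have K0 : 0 <= K.
  by have := le_trans (sqr_ge0 _) (fK 0 1); rewrite subr0 normr1 mul1r.
near=> t; rewrite -(ltr_pXn2r (n := 2)) ?nnegrE ?normr_ge0 ?ltW//.
rewrite real_normK ?num_real//; apply: (le_lt_trans (fK t s)).
apply: (@le_lt_trans _ _ (`|s - t| * (K + 1))).
  by rewrite ler_wpM2l// lerDl.
rewrite -ltr_pdivlMr ?ltr_wpDl//; near: t.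
have d0 : 0 < e ^+ 2 / (K + 1) by rewrite divr_gt0 ?exprn_gt0 ?ltr_wpDl.
by have /cvgrPdist_lt/(_ _ d0) := @cvg_id _ (nbhs s).
Unshelve. all: end_near. Qed.

Lemma vol_continuous h : L2s h ->
  continuous (fun t => Re (vol h t)) /\ continuous (fun t => Im (vol h t)).
Proof.
move=> hL; split; apply: (@holder_continuous _ (rint (fun z => csq (h z)))) => s t;
  rewrite -raddfB (le_trans _ (vol_holder s t hL))// /csq ?lerDl ?lerDr sqr_ge0//.
Qed.

Lemma vol_cmeasurable h : L2s h -> cmeasurable (vol h).
Proof.
move=> /vol_continuous [h1 h2]; split; apply: measurable_funTS;
  exact: continuous_measurable_fun.
Qed.

Lemma vol_sq_le h t : L2s h -> 0 <= t <= 1 ->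
  csq (vol h t) <= rint (fun z => csq (h z)).
Proof.
move=> hL /andP[t0 t1]; have := vol_holder 0 t hL.
rewrite (vol_le0 _ (lexx 0)) subr0 => /le_trans; apply.
by rewrite subr0 ger0_norm// ler_piMl//; apply: rint_ge0 => z _; exact: csq_ge0.
Qed.

Lemma vol_L2s h : L2s h -> L2s (vol h).
Proof.
move=> hL; apply: (@eq_L2s _ (fun z => vol h z * 1)).
  by move=> z; rewrite mulr1.
apply: L2sM_bounded (L2s_cst 1); first exact: vol_cmeasurable.
apply: nearW => z; rewrite /I01/= in_itv/= => /andP[z0 z1].
by apply: vol_sq_le; rewrite // !ltW.
Qed.

Let defect g h := cintegral (fun z => g z * vol h z) +
  cintegral (fun z => vol g z * h z) - cintegral g * cintegral h.

Let defectC g h : defect g h = defect h g.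
Proof.
rewrite /defect addrC [X in _ + X]addrC [X in _ = X]addrC mulrC; congr (_ + (_ + _));
  by apply: eq_cintegral => z _; rewrite mulrC.
Qed.

Let defectD g g' h c : L2s g -> L2s g' -> L2s h ->
  defect (fun z => g z + c * g' z) h = defect g h + c * defect g' h.
Proof.
move=> gL gL' hL.
have gi := L2s_cintegrable gL; have gi' := L2s_cintegrable gL'.
have e1 := L2sM_integrable gL (vol_L2s hL).
have e2 := L2sM_integrable gL' (vol_L2s hL).
have e3 := L2sM_integrable (vol_L2s gL) hL.
have e4 := L2sM_integrable (vol_L2s gL') hL.
rewrite /defect cintegralD ?cintegralZ//; last exact: cintegrableZ.
have -> : cintegral (fun z => (g z + c * g' z) * vol h z) =
    cintegral (fun z => g z * vol h z) + c * cintegral (fun z => g' z * vol h z).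
  rewrite -cintegralZ// -cintegralD//; last exact: cintegrableZ.
  by apply: eq_cintegral => z _; rewrite mulrDl mulrA.
have -> : cintegral (fun z => vol (fun z => g z + c * g' z) z * h z) =
    cintegral (fun z => vol g z * h z) + c * cintegral (fun z => vol g' z * h z).
  rewrite -cintegralZ// -cintegralD//; last exact: cintegrableZ.
  apply: eq_cintegral => z _.
  by rewrite volD ?volZ ?mulrDl ?mulrA//; exact: cintegrableZ.
move: (cintegral (fun z => g z * vol h z)) (cintegral (fun z => g' z * vol h z)).
move: (cintegral (fun z => vol g z * h z)) (cintegral (fun z => vol g' z * h z)).
move: (cintegral g) (cintegral g') (cintegral h) => a1 a2 a3 b1 b2 b3 b4; ring.
Qed.

Let L2s_real (f : R -> C) : L2s f ->
  L2s (fun z => (Re (f z))%:C) /\ L2s (fun z => (Im (f z))%:C).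
Proof.
move=> [[m1 m2] fi].
have n1 : cmeasurable (fun z => (Re (f z))%:C) by split=> //; exact: measurable_cst.
have n2 : cmeasurable (fun z => (Im (f z))%:C) by split=> //; exact: measurable_cst.
split; split=> //.
  apply: L1_le (measurable_csq n1) fi _ => z.
  by rewrite ger0_norm ?csq_ge0// csq_real lerDl sqr_ge0.
apply: L1_le (measurable_csq n2) fi _ => z.
by rewrite ger0_norm ?csq_ge0// csq_real lerDr sqr_ge0.
Qed.

Let cint_real (f : R -> R) : cintegral (fun z => (f z)%:C) = (rint f)%:C.
Proof. by rewrite cintegralE /= rint_cst. Qed.

Let vol_real (f : R -> R) t :
  vol (fun z => (f z)%:C) t = (rint (fun z => if z < t then f z else 0))%:C.
Proof.
rewrite volE /=; congr (_ +i* _); rewrite -[RHS](rint_cst 0).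
by apply: rint_eq => z _; case: ifP.
Qed.

Let defect_real (g h : R -> R) : L2s (fun z => (g z)%:C) -> L2s (fun z => (h z)%:C) ->
  defect (fun z => (g z)%:C) (fun z => (h z)%:C) = 0.
Proof.
move=> gL hL; have [gi _] := L2s_cintegrable gL; have [hi _] := L2s_cintegrable hL.
have [hvi _] := L2sM_integrable hL (vol_L2s gL).
rewrite /defect !cint_real.
have -> : cintegral (fun z => (g z)%:C * vol (fun z => (h z)%:C) z) =
    (rint (fun z => g z * rint (fun t => if t < z then h t else 0)))%:C.
  by rewrite -cint_real; apply: eq_cintegral => z _; rewrite vol_real -rmorphM.
have -> : cintegral (fun z => vol (fun z => (g z)%:C) z * (h z)%:C) =
    (rint (fun z => h z * rint (fun t => if t < z then g t else 0)))%:C.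
  by rewrite -cint_real; apply: eq_cintegral => z _; rewrite vol_real -rmorphM mulrC.
rewrite triangle_fubini// (_ : rint _ = rint (fun t => rint g * h t -
    h t * rint (fun s => if s < t then g s else 0))); last first.
  by apply: rint_eq => z _; ring.
rewrite rintB ?rintZ//.
- by rewrite -rmorphM -!rmorphD -rmorphB subrK subrr.
- exact: L1Z.
- by apply: eq_L1 hvi => z; rewrite vol_real -rmorphM.
Qed.

Lemma volterra_by_parts g h : L2s g -> L2s h ->
  cintegral (fun z => g z * vol h z) + cintegral (fun z => vol g z * h z) =
  cintegral g * cintegral h.
Proof.
move=> gL hL; apply/eqP; rewrite -subr_eq0; apply/eqP; rewrite -/(defect g h).
have split_re f : f = (fun z => (Re (f z))%:C + (0 +i* 1) * (Im (f z))%:C).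
  apply/funext => z; case: (f z) => a b; apply/eqP; rewrite eq_complex.
  by apply/andP; split; apply/eqP => /=; ring.
have [g1 g2] := L2s_real gL; have [h1 h2] := L2s_real hL.
have key f k : L2s f -> L2s k -> defect f k =
    defect (fun z => (Re (f z))%:C) k + (0 +i* 1) * defect (fun z => (Im (f z))%:C) k.
  by move=> fL kL; have [f1 f2] := L2s_real fL; rewrite {1}(split_re f) defectD.
rewrite (key g h)// 2!(defectC _ h) (key h _ hL g1) (key h _ hL g2).
by rewrite !defect_real// !(mulr0, addr0).
Qed.

End volterra.

Section bumps.
Variable R : realType.
Implicit Types (p w : {poly R}) (f q : R -> R).

Lemma is_derive_dominated0 f q (t : R) : (forall s, `|f s| <= `|q s|) ->
  is_derive t (1 : R) q 0 -> q t = 0 -> is_derive t (1 : R) f 0.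
Proof.
move=> fq dq qt; have ft : f t = 0.
  by apply/normr0_eq0/le_anti; rewrite normr_ge0 andbT (le_trans (fq t))// qt normr0.
have cq : h^-1 *: ((q \o shift t) (h *: 1) - q t) @[h --> 0^'] --> (0 : R).
  have c : derivable q t 1 by [].
  rewrite -[X in _ --> X](@derive_val _ _ _ _ _ _ _ dq); exact: c.
have cf : h^-1 *: ((f \o shift t) (h *: 1) - f t) @[h --> 0^'] --> (0 : R).
  apply/cvgrPdist_lt => e e0; move/cvgrPdist_lt : cq => /(_ e e0).
  apply: filterS => h; rewrite !sub0r !normrN ft qt !subr0.
  apply: le_lt_trans; rewrite !normrZ ler_wpM2l//; exact: fq.
by split; [apply/cvg_ex; exists 0|exact: cvg_lim].
Qed.

Definition ebump w m p (t : R) : R :=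
  if 0 < w.[t] then p.[t] * (w.[t])^-1 ^+ m * expR (- (w.[t])^-1) else 0.

Definition bump_deriv w m p : {poly R} :=
  p^`() * w ^+ 2 - m%:R *: (p * w^`() * w) + p * w^`().

Lemma pow_expRN_le (x : R) m : 0 < x ->
  x ^+ m * expR (- x) <= (m.+2)`!%:R * x^-1 ^+ 2.
Proof.
move=> x0; have := expR_ge1Dxn m.+1 (ltW x0); rewrite expRN => h.
rewrite ler_pdivrMr ?expR_gt0// exprVn mulrAC ler_pdivlMr ?exprn_gt0//.
rewrite -exprD addn2 -ler_pdivrMl ?ltr0n ?fact_gt0// mulrC.
by apply: le_trans h; rewrite lerDr.
Qed.

Lemma bump_le w m p t : `|ebump w m p t| <= `|(m.+2)`!%:R * (p * w ^+ 2).[t]|.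
Proof.
rewrite /ebump; case: ifP => wt; last by rewrite normr0.
rewrite hornerM !horner_exp -mulrA [in leRHS]mulrCA !(normrM p.[t]).
apply: ler_wpM2l => //; have u0 : 0 < (w.[t])^-1 by rewrite invr_gt0.
rewrite ger0_norm; last by rewrite mulr_ge0 ?expR_ge0 ?exprn_ge0 ?ltW.
rewrite (le_trans (pow_expRN_le m u0))// invrK ger0_norm//.
by rewrite mulr_ge0 ?sqr_ge0.
Qed.

Lemma is_derive_bump w m p t :
  is_derive t (1 : R) (ebump w m p) (ebump w m.+2 (bump_deriv w m p) t).
Proof.
have cw : {for t, continuous (horner w)} by exact: continuous_horner.
have [wt|wt|wt] := ltgtP (w.[t]) 0; last first.
- rewrite /ebump wt ltxx -/(ebump w m p).
  apply: (is_derive_dominated0 (q := horner ((m.+2)`!%:R *: (p * w ^+ 2)))).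
  + by move=> s; rewrite hornerZ bump_le.
  + set Q := _ *: _; have dQ := is_derive_poly Q t.
    rewrite (_ : 0 = Q^`().[t])//.
    rewrite /Q expr2. rewrite derivZ !derivM !(hornerZ, hornerD, hornerM) wt; ring.
  + by rewrite hornerZ hornerM horner_exp wt; ring.
- pose u (y : R) : R := (w.[y])^-1.
  have du : is_derive t (1 : R) u (- (w.[t]) ^- 2 *: w^`().[t]).
    by apply: is_deriveV; rewrite ?gt_eqF.
  apply: (@near_eq_is_derive _ _ _ ((horner p * u ^+ m) * (expR \o (- u)))).
    have : \forall s \near t, 0 < w.[s] by apply: cvgr_gt cw _ wt.
    by apply: filterS => s ws; rewrite /ebump ws !fctE.
  have d1 := is_derive_poly p t.
  have d2 := is_deriveX m du.
  have d4 : is_derive t (1 : R) (expR \o (- u)) _ :=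
    is_derive1_comp (is_derive_expR _) (is_deriveN du).
  apply: (@is_derive_eq _ _ _ _ _ _ _ _ (is_deriveM (is_deriveM d1 d2) d4)).
  rewrite /ebump wt /bump_deriv !fctE /u /=.
  rewrite !(hornerD, hornerN, hornerZ, hornerM, horner_exp).
  have w0 : w.[t] != 0 by rewrite gt_eqF.
  clear d2; rewrite /GRing.scale /=; case: m => [|m] /=; rewrite ?exprS ?expr0; field => //.
- apply: (@near_eq_is_derive _ _ _ (cst 0)).
    have : \forall s \near t, w.[s] < 0 by apply: cvgr_lt cw _ wt.
    by apply: filterS => s ws; rewrite /ebump ltNge (ltW ws).
  rewrite /ebump ltNge (ltW wt) /=; exact: is_derive_cst.
Qed.

Definition smooth f := forall n (t : R), derivable (derive1n n f) t 1.

Lemma derive1_bump w m p : derive1 (ebump w m p) = ebump w m.+2 (bump_deriv w m p).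
Proof.
by apply/funext => t; rewrite derive1E; have [_ ->] := is_derive_bump w m p t.
Qed.

Lemma smooth_bump w m p : smooth (ebump w m p).
Proof.
move=> n; elim: n m p => [|n IH] m p t.
  by rewrite derive1n0; have [] := is_derive_bump w m p t.
by rewrite derive1Sn derive1_bump.
Qed.

Lemma smooth_derive1n f n : smooth f -> smooth (derive1n n f).
Proof.
by move=> sf m t; rewrite /derive1n -iterD; exact: sf.
Qed.

Lemma smooth_continuous f : smooth f -> continuous f.
Proof.
move=> sf t; apply/differentiable_continuous/derivable1_diffP.
by have := sf 0%N t.
Qed.

End bumps.

Section unit_interval_calculus.
Variable R : realType.
Notation mu := (@lebesgue_measure R).
Notation I := (@I01 R).
Implicit Types (f g : R -> R).

Lemma rint_dominated_cvg (f_ : nat -> R -> R) f g :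
  (forall n, measurable_fun I (f_ n)) -> measurable_fun I f -> L1 g ->
  (forall z, I z -> f_ n z @[n --> \oo] --> f z) ->
  (forall n z, I z -> `|f_ n z| <= g z) ->
  rint (f_ n) @[n --> \oo] --> rint f.
Proof.
move=> mf_ mf gi f_f f_g.
have [||||||fi _ h] := @dominated_convergence _ _ _ mu I _
  (fun n z => (f_ n z)%:E) (fun z => (f z)%:E) (fun z => (g z)%:E).
- exact: measurable_I01.
- by move=> n; apply/measurable_EFinP; exact: mf_.
- exact/measurable_EFinP.
- by apply: nearW => z zI; apply: cvg_EFin; [apply: nearW | exact: f_f].
- exact: gi.
- by apply: nearW => z n zI; rewrite /= lee_fin f_g.
have ffin : (\int[mu]_(z in I) (f z)%:E)%E \is a fin_num.
  by apply: integrable_fin_num => //; exact: measurable_I01.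
apply: fine_cvg; rewrite fineK//; exact: h.
Qed.

Lemma integrable_extension f : (forall z, ~ I z -> f z = 0) -> L1 f ->
  mu.-integrable setT (EFin \o f).
Proof.
move=> f0 fi; rewrite (_ : f = f \_ I); last first.
  apply/funext => z; rewrite patchE; case: ifPn => // zI.
  by apply: f0 => Iz; move: zI; rewrite mem_set.
by rewrite -restrict_EFin; apply/integrable_restrict; rewrite ?setTI//; exact: measurable_I01.
Qed.

Lemma rint_below_lray f x : (forall z, ~ I z -> f z = 0) -> L1 f ->
  rint (fun z => if z < x then f z else 0) = (\int[mu]_(z in `]-oo, x]) f z)%R.
Proof.
move=> f0 fi.
have fT := integrable_extension f0 fi.
rewrite -Rintegral_itv_bndo_bndc; last exact: integrableS fT.
rewrite /rint [LHS]Rintegral_mkcond [RHS]Rintegral_mkcond.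
congr Rintegral; apply/funext => z; rewrite !patchE.
have -> : (z \in `]-oo, x[%classic) = (z < x) by apply/idP/idP; rewrite inE/= in_itv.
case: ifPn => // zI; case: ifPn => // zx.
by rewrite f0// => Iz; move: zI; rewrite mem_set.
Qed.

Lemma is_derive_primitive f x : continuous f -> (forall z, ~ I z -> f z = 0) ->
  L1 f ->
  is_derive x (1 : R) (fun x => rint (fun z => if z < x then f z else 0)) (f x).
Proof.
move=> cf f0 fi; have fT := integrable_extension f0 fi.
rewrite (_ : (fun _ => _) = (fun x => (\int[mu]_(z in `]-oo, x]) f z)%R)); last first.
  by apply/funext => y; exact: rint_below_lray.
have [||||d1 d2] := @continuous_FTC1 R f -oo%O x (x + 1).
- by rewrite ltrDl.
- exact: integrableS fT.
- by rewrite ltNyr.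
- exact: cf.
by split; [exact: d1 | rewrite -derive1E; exact: d2].
Qed.

Lemma unit_ftc f f' z : (forall t, is_derive t (1 : R) f (f' t)) ->
  continuous f' -> 0 <= z <= 1 ->
  f z = f 0 + rint (fun s => if s < z then f' s else 0).
Proof.
move=> df cf' /andP[z0 z1]; move: z0; rewrite le_eqVlt => /orP[/eqP <-|z0].
  rewrite (_ : rint _ = 0) ?addr0// -[RHS](rint_cst 0); apply: rint_eq => s.
  by rewrite /I01/= in_itv/= => /andP[s0 _]; rewrite ltNge ltW.
have cf t : {for t, continuous f}.
  by apply/differentiable_continuous/derivable1_diffP; case: (df t).
have h : (\int[mu]_(x in `[0%R, z]) (f' x)%:E = (f z)%:E - (f 0)%:E)%E.
  apply: continuous_FTC2 => //.
  - exact: continuous_subspaceT.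
  - by split; [move=> t _; case: (df t)|
      apply: cvg_at_right_filter; exact: cf|apply: cvg_at_left_filter; exact: cf].
  - by move=> t _; rewrite derive1E; case: (df t).
have -> : rint (fun s => if s < z then f' s else 0) = f z - f 0; last by rewrite addrC subrK.
transitivity (\int[mu]_(x in `[0, z]) f' x)%R; last by rewrite /Rintegral h.
have fi : mu.-integrable `[0, z] (EFin \o f').
  apply: continuous_compact_integrable; first exact: segment_compact.
  exact: continuous_subspaceT.
rewrite -Rintegral_itv_obnd_cbnd; last by apply: integrableS fi => //; exact: subset_itv_oc_cc.
rewrite -Rintegral_itv_bndo_bndc; last by apply: integrableS fi => //; exact: subset_itv_oo_cc.
rewrite /rint [LHS]Rintegral_mkcond [RHS]Rintegral_mkcond.
congr Rintegral; apply/funext => s; rewrite !patchE.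
have -> : (s \in I) = (0 < s < 1) by apply/idP/idP; rewrite inE /I01/= in_itv.
have -> : (s \in `]0, z[%classic) = (0 < s < z) by apply/idP/idP; rewrite inE/= in_itv.
case: (ltP 0 s) => //= s0; case: (ltP s z) => [sz|_]; last by case: ifP.
by rewrite (lt_le_trans sz z1).
Qed.

Lemma interval_integrals_eq0 f : L1 f ->
  (forall a b, 0 < a -> a < b -> b < 1 ->
    rint (fun z => if (a < z) && (z < b) then f z else 0) = 0) ->
  {ae mu, forall z, I z -> f z = 0}.
Proof.
move=> fi fab; pose g z := if 0 < z < 1 then f z else 0.
have g0 z : ~ I z -> g z = 0.
  by rewrite /g /I01/= in_itv/=; case: ifP.
have fg z : I z -> f z = g z by rewrite /g /I01/= in_itv/= => ->.
have gi : L1 g.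
  rewrite /L1; apply: eq_integrable fi; first exact: measurable_I01.
  by move=> z; rewrite inE/= => /fg ->.
have gT := integrable_extension g0 gi.
pose F x := (\int[mu]_(t in `]-oo, x]) g t)%R.
have FE x : F x = rint (fun z => if z < x then g z else 0).
  by rewrite rint_below_lray.
have Fcst x y : 0 < x -> x < y -> y < 1 -> F x = F y.
  move=> x0 xy y1; apply/eqP; rewrite eq_sym -subr_eq0 !FE -rintB; try exact: L1_below.
  apply/eqP; transitivity (rint (fun z => if (x < z) && (z < y) then f z else 0));
    last exact: fab.
  have gi' := L1B (L1_below y gi) (L1_below x gi).
  apply: rint_ae; first exact: L1_measurable gi'.
    apply: measurable_fun_if => //; first exact: measurable_I01.
      apply: measurable_and; apply: measurable_fun_ltr => //; exact: measurable_cst.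
    by apply: (measurable_funS _ _ (L1_measurable fi)); [exact: measurable_I01 | move=> z []].
  exists [set x]; split => //; first exact: lebesgue_measure_set1.
  move=> z /=; apply: contra_notP => zx zI; rewrite -(fg z zI).
  case: (ltgtP x z) => [xz|zx'|/esym/zx//] /=; last by rewrite (lt_trans zx' xy) subrr.
  by rewrite subr0.
have hi y : mu.-integrable `]-oo, y] (EFin \o g) by exact: integrableS gT.
have := @FTC1Ny R g hi (open_integrable_locally openT gT); cbv zeta.
move=> [A [mA A0 hA]]; exists A; split => // x /=; apply: contra_notP => xA.
have {hA} : derivable F x 1 /\ derive1 F x = g x.
  by apply: contrapT => nF; apply: xA; apply: hA.
move=> [_ F'x] xI; rewrite fg// -F'x.
move: (xI); rewrite /I01/= in_itv/= => /andP[x0 x1].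
rewrite derive1E (@near_eq_derive _ _ _ _ (cst (F x))) ?derive_cst//.
have h0 : \forall y \near x, 0 < y by exact: lt_nbhsr.
have h1 : \forall y \near x, y < 1 by exact: lt_nbhsl.
apply: filterS2 h0 h1 => y y0 y1.
by have [yx|xy|->//] := ltgtP y x; [exact: Fcst | rewrite [RHS](Fcst x y)].
Qed.

Definition wedge (a b : R) : {poly R} := ('X - a%:P) * (b%:P - 'X).

Lemma wedge_gt0 (a b t : R) : a < b -> (0 < (wedge a b).[t]) = (a < t < b).
Proof.
move=> ab; rewrite /wedge hornerM !hornerD !hornerN !hornerX !hornerC.
have [ta|at_|->] := ltgtP t a; last by rewrite subrr mul0r ltxx.
  by apply/negbTE; rewrite -leNgt mulr_le0_ge0 ?subr_ge0 ?subr_le0 ?ltW// (lt_trans ta).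
by rewrite pmulr_rgt0 ?subr_gt0.
Qed.

Lemma ebump1_itv (w : {poly R}) t : 0 <= ebump w 0%N 1 t <= 1.
Proof.
rewrite /ebump; case: ifP => [wt|_]; last by rewrite lexx ler01.
rewrite hornerC expr0 !mul1r expR_ge0 /=.
by rewrite expR_le1 oppr_le0 invr_ge0 ltW.
Qed.

Lemma ebump1_cvg (w : {poly R}) t :
  ebump (n.+1%:R *: w) 0 1 t @[n --> \oo] --> (if 0 < w.[t] then 1 else 0 : R).
Proof.
have wn n : (0 < (n.+1%:R *: w).[t]) = (0 < w.[t]) by rewrite hornerZ pmulr_rgt0.
rewrite /ebump; under eq_fun do rewrite wn.
case: ifP => wt; last exact: cvg_cst.
rewrite (_ : (fun n => _) = (fun n => expR (- ((w.[t])^-1 * harmonic n)))); last first.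
  by apply/funext => n; rewrite hornerC expr0 !mul1r hornerZ invfM mulrC.
rewrite -expR0; apply: (@cvg_comp _ _ _ _ expR); last exact: continuous_expR.
rewrite -oppr0 -[X in - X](mulr0 (w.[t])^-1); apply: cvgN; apply: cvgMr.
exact: cvg_harmonic.
Qed.

Lemma test_bump (k : R) m p a b : 0 < a -> a < b -> b < 1 -> 0 < k ->
  test_function (ebump (k *: wedge a b) m p).
Proof.
move=> a0 ab b1 k0; split; first exact: smooth_bump.
exists a, b; split => // t tab; rewrite /ebump hornerZ pmulr_rgt0// wedge_gt0//.
by case: ifP => // /andP[/ltW at_ /ltW tb]; exfalso; apply: tab; rewrite at_.
Qed.

Lemma measurable_bump (w : {poly R}) m p : measurable_fun I (ebump w m p).
Proof.
by apply: measurable_funTS; apply: continuous_measurable_fun;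
  apply: smooth_continuous; exact: smooth_bump.
Qed.

Lemma test_functions_separate f : L1 f ->
  (forall phi, test_function phi -> rint (fun z => phi z * f z) = 0) ->
  {ae mu, forall z, I z -> f z = 0}.
Proof.
move=> fi f0; apply: interval_integrals_eq0 => // a b a0 ab b1.
have mf := L1_measurable fi.
have : rint (fun z => ebump (n.+1%:R *: wedge a b) 0 1 z * f z) @[n --> \oo] -->
    rint (fun z => if (a < z) && (z < b) then f z else 0).
  apply: (@rint_dominated_cvg _ _ (fun z => `|f z|)).
  - by move=> n; apply: measurable_funM => //; exact: measurable_bump.
  - apply: measurable_fun_if => //; first exact: measurable_I01.
      apply: measurable_and; apply: measurable_fun_ltr => //; exact: measurable_cst.
    by apply: (measurable_funS _ _ mf); [exact: measurable_I01 | move=> z []].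
  - exact: integrable_norm fi.
  - move=> z _; rewrite (_ : (if _ then _ else _) =
      (if 0 < (wedge a b).[z] then 1 else 0) * f z).
      by apply: cvgMl; exact: ebump1_cvg.
    by rewrite wedge_gt0//; case: ifP; rewrite ?mul1r ?mul0r.
  - move=> n z _; have /andP[b0' b1'] := ebump1_itv (n.+1%:R *: wedge a b) z.
    by rewrite normrM (ger0_norm b0') ler_piMl.
rewrite (_ : (fun n => _) = cst 0); last first.
  by apply/funext => n; apply: f0; exact: test_bump.
by move=> h; apply: (cvg_unique _ h) (cvg_cst _).
Qed.

End unit_interval_calculus.

Section weak_derivatives.
Variable R : realType.
Notation mu := (@lebesgue_measure R).
Notation I := (@I01 R).
Notation C := R[i].
Local Notation Re := (@complex.Re R).
Local Notation Im := (@complex.Im R).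
Implicit Types phi psi : R -> R.

Lemma ae_exists_between (P : R -> Prop) (a b : R) : 0 <= a -> a < b -> b <= 1 ->
  {ae mu, forall z, I z -> P z} -> exists z, [/\ a < z, z < b & P z].
Proof.
move=> a0 ab b1 [A [mA A0 hA]]; apply: contrapT => nz.
have sub : `]a, b[ `<=` A.
  move=> z; rewrite /= in_itv/= => /andP[az zb]; apply: hA => /= h.
  apply: nz; exists z; split => //; apply: h.
  by rewrite /I01/= in_itv/= (le_lt_trans a0 az) (lt_le_trans zb b1).
have : (mu `]a, b[ <= 0)%E by rewrite -A0; apply: le_measure; rewrite ?inE.
by rewrite lebesgue_measure_itv/= lte_fin ab -EFinB lee_fin; lra.
Qed.

Lemma continuous_L1 (f : R -> R) : continuous f -> L1 f.
Proof.
move=> cf; have fi : mu.-integrable `[0, 1] (EFin \o f).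
  apply: continuous_compact_integrable; first exact: segment_compact.
  exact: continuous_subspaceT.
by rewrite /L1; apply: integrableS fi => //; [exact: measurable_I01|exact: subset_itv_oo_cc].
Qed.

Lemma continuous_L2s (f : R -> R) : continuous f -> L2s (fun z => (f z)%:C).
Proof.
move=> cf; split.
  split; last exact: measurable_cst.
  by apply: measurable_funTS; exact: continuous_measurable_fun.
apply: (@eq_L1 _ (fun z => f z * f z)); first by move=> z; rewrite csq_real expr2.
by apply: continuous_L1 => z; apply: cvgM; exact: cf.
Qed.

Lemma derive1n_linear phi psi (c : R) n : smooth phi -> smooth psi ->
  derive1n n (fun z => phi z + c * psi z) =
  fun z => derive1n n phi z + c * derive1n n psi z.
Proof.
move=> sphi spsi; elim: n => // n IH; rewrite 3!derive1nS IH.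
apply/funext => z; have h1 := sphi n z; have h2 := spsi n z.
rewrite 3!derive1E (_ : (fun _ => _) = derive1n n phi + c \*: derive1n n psi)//.
rewrite deriveD; [|exact: h1|by apply: derivableZ; exact: h2].
by rewrite deriveZ; last exact: h2.
Qed.

Lemma smooth_linear phi psi (c : R) : smooth phi -> smooth psi ->
  smooth (fun z => phi z + c * psi z).
Proof.
move=> sphi spsi n z; rewrite derive1n_linear//.
have h1 := sphi n z; have h2 := spsi n z.
by apply: (@derivableD _ _ _ (derive1n n phi) (c \*: derive1n n psi));
  [exact: h1|apply: derivableZ; exact: h2].
Qed.

Lemma smooth_of_derive1 phi : (forall z, derivable phi z 1) ->
  smooth (derive1 phi) -> smooth phi.
Proof. by move=> dphi s [|n] z; [exact: dphi | rewrite derive1Sn; exact: s]. Qed.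

Lemma smooth_is_derive phi z : smooth phi -> is_derive z (1 : R) phi (derive1 phi z).
Proof. by move=> s; rewrite derive1E; apply: derivableP; exact: (s 0%N). Qed.

Lemma test_smooth phi : test_function phi -> smooth phi.
Proof. by case. Qed.

Lemma test_outside phi z : test_function phi -> ~ I z -> phi z = 0.
Proof.
move=> [_ [a [b [a0 b1 h]]]] zI; apply: h => /andP[az zb]; apply: zI.
by rewrite /I01/= in_itv/= (lt_le_trans a0 az) (le_lt_trans zb b1).
Qed.

Lemma test_derive phi : test_function phi -> test_function (derive1 phi).
Proof.
move=> [s [a [b [a0 b1 h]]]]; split; first exact: (@smooth_derive1n _ phi 1).
exists a, b; split => // t tab.
have h0 : \forall y \near t, phi y = 0.
  have [ta|at_] := ltP t a.
    have : \forall y \near t, y < a by exact: lt_nbhsl.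
    by apply: filterS => y ya; apply: h; rewrite leNgt ya.
  have bt : b < t by rewrite ltNge; apply/negP => tb; apply: tab; rewrite at_.
  have : \forall y \near t, b < y by exact: lt_nbhsr.
  by apply: filterS => y ya; apply: h; rewrite [y <= b]leNgt ya andbF.
by rewrite derive1E (@near_eq_derive _ _ _ _ (cst 0)) ?derive_cst.
Qed.

Lemma test_derive1n n phi : test_function phi -> test_function (derive1n n phi).
Proof. by move=> tphi; elim: n => // n IH; rewrite derive1nS; exact: test_derive. Qed.

Lemma test_continuous phi : test_function phi -> continuous phi.
Proof. by move/test_smooth/smooth_continuous. Qed.

Lemma test_primitive phi z : test_function phi -> 0 <= z <= 1 ->
  vol (fun s => (derive1 phi s)%:C) z = (phi z)%:C.
Proof.
move=> tphi z01; rewrite volE /=; congr (_ +i* _); last first.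
  by rewrite -[RHS](rint_cst 0); apply: rint_eq => s _; case: ifP.
have := unit_ftc (fun t => smooth_is_derive t (test_smooth tphi))
  (test_continuous (test_derive tphi)) z01 => ->.
by rewrite (test_outside tphi) ?add0r// /I01/= in_itv/= ltxx.
Qed.

Lemma test_parts phi (c : C) (g : R -> C) : test_function phi -> L2s g ->
  cintegral (fun z => (derive1 phi z)%:C * (c + vol g z)) =
  - cintegral (fun z => (phi z)%:C * g z).
Proof.
move=> tphi gL; have dL := continuous_L2s (test_continuous (test_derive tphi)).
have d0 : cintegral (fun z => (derive1 phi z)%:C) = 0.
  rewrite -(vol_ge1 _ (lexx 1)) test_primitive// ?ler01 ?lexx//.
  by rewrite (test_outside tphi)// /I01/= in_itv/= ltxx andbF.
have := volterra_by_parts dL gL; rewrite d0 mul0r => /eqP.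
rewrite addr_eq0 => /eqP h.
have -> : cintegral (fun z => (phi z)%:C * g z) =
    cintegral (fun z => vol (fun s => (derive1 phi s)%:C) z * g z).
  apply: eq_cintegral => z; rewrite /I01/= in_itv/= => /andP[z0 z1].
  by rewrite test_primitive// !ltW.
rewrite -h -[RHS]add0r -(mulr0 c) -d0 -cintegralZ; last exact: L2s_cintegrable.
rewrite -cintegralD.
- by apply: eq_cintegral => z _; rewrite mulrDr (mulrC _ c).
- exact/cintegrableZ/L2s_cintegrable.
- exact/L2sM_integrable/vol_L2s.
Qed.

Lemma du_bois_reymond_real (f : R -> R) : L1 f ->
  (forall phi, test_function phi -> rint (fun z => derive1 phi z * f z) = 0) ->
  exists c, {ae mu, forall z, I z -> f z = c}.
Proof.
move=> fi f0; pose theta := ebump (1 *: wedge (4^-1) (3 / 4 : R)) 0%N 1.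
have ttheta : test_function theta by apply: test_bump; lra.
have ctheta := test_continuous ttheta; have thetai := continuous_L1 ctheta.
have theta0 z : 0 <= theta z by have /andP[] := ebump1_itv (1 *: wedge (4^-1) (3 / 4 : R)) z.
pose k := rint theta.
have k0 : k != 0.
  apply/eqP => k0; have h := rint_eq0_ae thetai theta0 k0.
  have [||| z [z1 z2]] := @ae_exists_between (fun z => theta z = 0) (4^-1) (3/4) _ _ _ h; try lra.
  rewrite /theta /ebump hornerZ mul1r wedge_gt0 ?z1 ?z2 /=; last by lra.
  rewrite hornerC expr0 !mul1r => /eqP; apply/negP.
  by rewrite gt_eqF// expR_gt0.
have mulL1 phi g : continuous phi -> (forall z, ~ I z -> phi z = 0) -> L1 g ->
    L1 (fun z => phi z * g z).
  move=> cphi phi0 gi; have [M [_ hM]] := @compact_bounded _ _ _ (continuous_compact (continuous_subspaceT cphi) (@segment_compact R 0 1)).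
  apply: (@L1_le _ _ (fun z => (M + 1) * `|g z|)).
  - apply: measurable_funM; last exact: L1_measurable.
    by apply: measurable_funTS; exact: continuous_measurable_fun.
  - by apply: L1Z; exact: integrable_norm gi.
  - move=> z; rewrite normrM ler_wpM2r//.
    have [z01|z01] := pselect (`[0, 1]%classic z).
      by apply: (hM (M + 1)); [rewrite ltrDl|exists z].
    rewrite phi0 ?normr0; last by move=> /subset_itv_oo_cc.
    rewrite (le_trans (normr_ge0 (phi 0)))//; apply: (hM (M + 1)); first by rewrite ltrDl.
    by exists 0 => //; rewrite /= in_itv/= lexx ler01.
pose c := rint (fun z => theta z * f z) / k; exists c.
suff : {ae mu, forall z, I z -> f z - c = 0}.
  by apply: filterS => z /[swap] zI /(_ zI)/eqP; rewrite subr_eq0 => /eqP.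
apply: test_functions_separate; first exact: L1B fi (L1_cst c).
move=> psi tpsi; have cpsi := test_continuous tpsi; have psii := continuous_L1 cpsi.
pose s := rint psi / k.
pose eta z := psi z + (- s) * theta z.
have seta : smooth eta by apply: smooth_linear; exact: test_smooth.
have ceta := smooth_continuous seta; have etai := continuous_L1 ceta.
have eta0 z : ~ I z -> eta z = 0.
  by move=> zI; rewrite /eta (test_outside tpsi zI) (test_outside ttheta zI) mulr0 addr0.
pose phi x := rint (fun z => if z < x then eta z else 0).
have dphi x : is_derive x (1 : R) phi (eta x) by exact: is_derive_primitive.
have phi' : derive1 phi = eta.
  by apply/funext => x; rewrite derive1E; case: (dphi x).
have inteta : rint eta = 0.
  rewrite /eta rintD//; last exact: L1Z.
  by rewrite rintZ// /s -/k mulNr divfK// subrr.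
have tphi : test_function phi.
  split; first by apply: smooth_of_derive1; rewrite ?phi'// => z; case: (dphi z).
  have [_ [a1 [b1 [a10 b11 h1]]]] := tpsi; have [_ [a2 [b2 [a20 b21 h2]]]] := ttheta.
  exists (Num.min a1 a2), (Num.max b1 b2); split.
  - by rewrite lt_min a10.
  - by rewrite gt_max b11.
  have etaab z : ~ (Num.min a1 a2 <= z <= Num.max b1 b2) -> eta z = 0.
    move=> h; rewrite /eta h1 ?h2 ?mulr0 ?addr0//.
      by move=> /andP[u v]; apply: h; rewrite ge_min u orbT le_max v orbT.
    by move=> /andP[u v]; apply: h; rewrite ge_min u le_max v.
  move=> t tab; have [tm|mt] := ltP t (Num.min a1 a2).
    rewrite /phi -[RHS](rint_cst 0); apply: rint_eq => z _; case: ifP => // zt.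
    by apply: etaab; rewrite leNgt (lt_trans zt tm).
  rewrite /phi -inteta; apply: rint_eq => z _; case: ifP => // /negbT.
  rewrite -leNgt => tz; rewrite etaab// => /andP[_ zb]; apply: tab.
  by rewrite mt (le_trans tz zb).
have := f0 phi tphi; rewrite phi' /eta.
rewrite (_ : rint _ = rint (fun z => psi z * f z + (- s) * (theta z * f z))); last first.
  by apply: rint_eq => z _; ring.
have e1 : L1 (fun z => psi z * f z) by apply: mulL1 => // z; exact: test_outside.
have e2 : L1 (fun z => theta z * f z) by apply: mulL1 => // z; exact: test_outside.
rewrite rintD//; last exact: L1Z.
rewrite rintZ// => h.
rewrite (_ : rint _ = rint (fun z => psi z * f z + (- c) * psi z)); last first.
  by apply: rint_eq => z _; ring.
rewrite rintD ?rintZ//; last exact: L1Z.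
by rewrite -h /s /c; ring.
Qed.

Lemma du_bois_reymond (f : R -> C) : cintegrable f ->
  (forall phi, test_function phi -> cintegral (fun z => (derive1 phi z)%:C * f z) = 0) ->
  exists c, {ae mu, forall z, I z -> f z = c}.
Proof.
move=> [f1 f2] f0.
have [phi tphi|c1 h1] := @du_bois_reymond_real (fun z => Re (f z)) f1.
  have := congr1 Re (f0 phi tphi); rewrite cintegralE /= => <-.
  by apply: rint_eq => z _; case: (f z) => a b /=; ring.
have [phi tphi|c2 h2] := @du_bois_reymond_real (fun z => Im (f z)) f2.
  have := congr1 Im (f0 phi tphi); rewrite cintegralE /= => <-.
  by apply: rint_eq => z _; case: (f z) => a b /=; ring.
exists (c1 +i* c2); apply: filterS2 h1 h2 => z h1 h2 zI.
by rewrite -(h1 zI) -(h2 zI); case: (f z).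
Qed.

Lemma weak_primitive (f g : R -> C) : L2s f -> L2s g ->
  (forall phi, test_function phi ->
    cintegral (fun z => (derive1 phi z)%:C * f z) =
    - cintegral (fun z => (phi z)%:C * g z)) ->
  exists c, {ae mu, forall z, I z -> f z = c + vol g z}.
Proof.
move=> fL gL fg; have vL := vol_L2s gL.
have [|phi tphi|c h] := @du_bois_reymond (fun z => f z - vol g z).
- exact/L2s_cintegrable/L2sB.
- have dL := continuous_L2s (test_continuous (test_derive tphi)).
  have e0 : cintegral (fun z => (derive1 phi z)%:C * vol g z) =
      cintegral (fun z => (derive1 phi z)%:C * (0 + vol g z)).
    by apply: eq_cintegral => z _; rewrite add0r.
  rewrite (_ : cintegral _ = cintegral (fun z => (derive1 phi z)%:C * f z -
      (derive1 phi z)%:C * vol g z)); last first.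
    by apply: eq_cintegral => z _; rewrite mulrBr.
  rewrite cintegralB; [|exact: L2sM_integrable|exact: L2sM_integrable].
  by rewrite e0 test_parts// fg// subrr.
- by exists c; apply: filterS h => z /[swap] zI /(_ zI) <-; rewrite subrK.
Qed.

Lemma continuous_ae_eq (u v : R -> R) x :
  {within `[0, 1], continuous u} -> {within `[0, 1], continuous v} ->
  {ae mu, forall z, I z -> u z = v z} -> 0 <= x <= 1 -> u x = v x.
Proof.
move=> /subspace_continuousP cu /subspace_continuousP cv uv /andP[x0 x1].
have xI : `[0, 1]%classic x by rewrite /= in_itv/= x0.
apply/eqP; rewrite -subr_eq0 -normr_eq0; apply/eqP/le_anti; rewrite normr_ge0 andbT.
apply/ler_addgt0Pl => e e0; rewrite addr0.
have cuv : (u z - v z) @[z --> within `[0, 1]%classic (nbhs x)] --> u x - v x.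
  by apply: cvgB; [exact: cu | exact: cv].
move/cvgrPdist_le : cuv => /(_ e e0) [r /= r0 hr].
have [a [b [a0 ab b1 habx]]] : exists a b, [/\ 0 <= a, a < b, b <= 1 &
    forall z, a < z -> z < b -> `|x - z| < r].
  have [x1'|x1'] := ltP x 1.
    exists x, (Num.min (x + r) 1); split => //.
    - by rewrite lt_min x1' ltrDl r0.
    - by rewrite ge_min lexx orbT.
    - move=> z xz; rewrite lt_min => /andP[zr _].
      by rewrite ltr0_norm ?subr_lt0// opprB ltrBlDl.
  exists (Num.max (x - r) 0), x; split => //.
  - by rewrite le_max lexx orbT.
  - by rewrite gt_max ltrBlDl ltrDr r0 (lt_le_trans ltr01 x1').
  - move=> z; rewrite gt_max => /andP[zr _] zx.
    by rewrite gtr0_norm ?subr_gt0// ltrBlDl -ltrBlDr.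
have [z [az zb uvz]] := ae_exists_between a0 ab b1 uv.
have := hr z (habx z az zb); rewrite uvz subrr subr0; apply.
by rewrite /= in_itv/= (le_trans a0 (ltW az)) (le_trans (ltW zb) b1).
Qed.

End weak_derivatives.

Section sobolev_chains.
Variables (R : realType) (d : nat).
Notation mu := (@lebesgue_measure R).
Notation I := (@I01 R).
Notation C := R[i].
Local Notation Re := (@complex.Re R).
Local Notation Im := (@complex.Im R).
Implicit Types (f g : R -> 'cV[C]_d) (Y : nat -> R -> 'cV[C]_d).

Lemma sqnormE (u : 'cV[C]_d) : sqnorm u = \sum_i csq (u i 0).
Proof. by []. Qed.

Lemma csq_le_sqnorm (u : 'cV[C]_d) i : csq (u i 0) <= sqnorm u.
Proof.
by rewrite sqnormE (bigD1 i)//= lerDl; apply: sumr_ge0 => j _; exact: csq_ge0.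
Qed.

Lemma square_integrableP f :
  f \in @square_integrable R d <-> forall i, L2s (fun z => f z i 0).
Proof.
rewrite inE; split=> [[mf fi] i|fL].
  split=> //; apply: L1_le fi _ => [|z]; first exact: measurable_csq.
  by rewrite ger0_norm ?csq_ge0 ?csq_le_sqnorm.
split=> [i|]; first by case: (fL i).
by apply: L1_sum => i; case: (fL i).
Qed.

Lemma ae_cV f g : (forall i, {ae mu, forall z, I z -> f z i 0 = g z i 0}) ->
  {ae mu, forall z, I z -> f z = g z}.
Proof.
move=> fg; have : {ae mu, forall z, forall i, I z -> f z i 0 = g z i 0}.
  exact: (filter_forall (F := almost_everywhere mu)).
by apply: filterS => z h zI; apply/colP => i; exact: h.
Qed.

Lemma square_integrable_ae f g : (forall i, cmeasurable (fun z => f z i 0)) ->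
  g \in @square_integrable R d -> {ae mu, forall z, I z -> f z = g z} ->
  f \in @square_integrable R d.
Proof.
move=> mf /square_integrableP gL fg; apply/square_integrableP => i.
by apply: L2s_ae (gL i) _ => //; apply: filterS fg => z /[swap] zI /(_ zI) ->.
Qed.

Definition sobolev_chain N Y :=
  (forall k, (k <= N)%N -> Y k \in @square_integrable R d) /\
  (forall k, (k < N)%N -> forall i z,
     Y k z i 0 = Y k 0 i 0 + vol (fun s => Y k.+1 s i 0) z).

Lemma chain_weak_derivative N Y f k : sobolev_chain N Y -> (k <= N)%N ->
  f \in @square_integrable R d -> {ae mu, forall z, I z -> f z = Y 0%N z} ->
  is_weak_derivative k f (Y k).
Proof.
move=> [YL YV] + fL f0; elim: k => [_|k IH kN] phi tphi j.
  rewrite expr0 mul1r; apply: cintegral_ae.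
  - apply: cmeasurableM; first by case: (continuous_L2s (test_continuous tphi)).
    by have /square_integrableP/(_ j)[] := fL.
  - apply: cmeasurableM; first by case: (continuous_L2s (test_continuous tphi)).
    by have /square_integrableP/(_ j)[] := YL _ (leq0n N).
  - by apply: filterS f0 => z /[swap] zI /(_ zI) ->.
rewrite derive1Sn (IH (ltnW kN) _ (test_derive tphi)).
under eq_cintegral do rewrite (YV k kN).
rewrite test_parts//; last by have /square_integrableP/(_ j) := YL _ kN.
by rewrite exprS mulrN mulN1r mulNr.
Qed.

Lemma weak_derivative_unique k f g g' :
  g \in @square_integrable R d -> g' \in @square_integrable R d ->
  is_weak_derivative k f g -> is_weak_derivative k f g' ->
  {ae mu, forall z, I z -> g z = g' z}.
Proof.
move=> /square_integrableP gL /square_integrableP gL' fg fg'; apply: ae_cV => i.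
have h phi : test_function phi ->
    cintegral (fun z => (phi z)%:C * (g z i 0 - g' z i 0)) = 0.
  move=> tphi; have pL := continuous_L2s (test_continuous tphi).
  have := fg phi tphi i; rewrite (fg' phi tphi i) => /(can_inj (signrMK k)) e.
  rewrite (_ : cintegral _ = cintegral (fun z => (phi z)%:C * g z i 0 -
      (phi z)%:C * g' z i 0)); last by apply: eq_cintegral => z _; rewrite mulrBr.
  by rewrite cintegralB ?e ?subrr//; exact: L2sM_integrable.
have [h1 h2] := L2s_cintegrable (L2sB (gL i) (gL' i)).
have a1 : {ae mu, forall z, I z -> Re (g z i 0 - g' z i 0) = 0}.
  apply: test_functions_separate h1 _ => phi tphi.
  have := congr1 Re (h phi tphi); rewrite cintegralE /= => <-.
  by apply: rint_eq => z _; case: (g z i 0 - _) => a b /=; ring.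
have a2 : {ae mu, forall z, I z -> Im (g z i 0 - g' z i 0) = 0}.
  apply: test_functions_separate h2 _ => phi tphi.
  have := congr1 Im (h phi tphi); rewrite cintegralE /= => <-.
  by apply: rint_eq => z _; case: (g z i 0 - _) => a b /=; ring.
apply: filterS2 a1 a2 => z a1 a2 zI; apply/eqP; rewrite -subr_eq0.
by rewrite eq_complex (a1 zI) (a2 zI) !eqxx.
Qed.

Lemma weak_derivative_step k f g g' :
  g \in @square_integrable R d -> g' \in @square_integrable R d ->
  is_weak_derivative k f g -> is_weak_derivative k.+1 f g' ->
  exists c : 'cV[C]_d, {ae mu, forall z, I z ->
    g z = c + \col_i vol (fun s => g' s i 0) z}.
Proof.
move=> /square_integrableP gL /square_integrableP gL' fg fg'.
have step i : exists c, {ae mu, forall z, I z ->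
    g z i 0 = c + vol (fun s => g' s i 0) z}.
  apply: weak_primitive => // phi tphi; apply: (can_inj (signrMK k)).
  rewrite -(fg _ (test_derive tphi)) -derive1Sn (fg' _ tphi).
  by rewrite exprS mulrN mulN1r mulNr.
have [c hc] := choice step; exists (\col_i c i); apply: ae_cV => i.
by apply: filterS (hc i) => z /[swap] zI /(_ zI) ->; rewrite !mxE.
Qed.

Lemma sobolev_chainP N f : sobolev N f <->
  f \in @square_integrable R d /\
  exists Y, sobolev_chain N Y /\ {ae mu, forall z, I z -> f z = Y 0%N z}.
Proof.
split=> [[fL hf]|[fL [Y [YN fY]]]]; last first.
  split=> // k kN; exists (Y k); first by case: YN => + _; apply.
  exact: chain_weak_derivative YN kN fL fY.
split=> //.
have hf' k : exists g : R -> 'cV[C]_d, (k <= N)%N ->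
    g \in @square_integrable R d /\ is_weak_derivative k f g.
  have [/hf [g gL fg]|kN] := leqP k N; first by exists g.
  by exists 0.
have [g hg] := choice hf'.
have hc k : exists c : 'cV[C]_d, (k < N)%N -> {ae mu, forall z, I z ->
    g k z = c + \col_i vol (fun s => g k.+1 s i 0) z}.
  have [kN|kN] := ltnP k N; last by exists 0.
  have [gL fg] := hg k (ltnW kN); have [gL' fg'] := hg k.+1 kN.
  by have [c h] := weak_derivative_step gL gL' fg fg'; exists c.
have [c {}hc] := choice hc.
pose Y k := if (k < N)%N then (fun z => c k + \col_i vol (fun s => g k.+1 s i 0) z)
  else g k.
have gY k : (k <= N)%N -> {ae mu, forall z, I z -> g k z = Y k z}.
  move=> kN; rewrite /Y; case: ifP => kN'; last exact: nearW.
  exact: hc.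
have volL k i : (k <= N)%N -> L2s (fun s => g k s i 0).
  by move=> /hg [/square_integrableP gL _].
have YL k : (k <= N)%N -> Y k \in @square_integrable R d.
  move=> kN; rewrite /Y; case: ifP => kN'; last by case: (hg k kN).
  apply/square_integrableP => i.
  apply: (@eq_L2s _ (fun z => c k i 0 + vol (fun s => g k.+1 s i 0) z)).
    by move=> z; rewrite !mxE.
  by apply: L2sD; [exact: L2s_cst | exact/vol_L2s/volL].
exists Y; split; first split=> // k kN i z.
  rewrite [in LHS]/Y kN !mxE; congr (_ + _).
    by rewrite /Y kN !mxE vol_le0// addr0.
  apply: vol_ae.
  - exact/L2s_cintegrable/volL.
  - by apply/L2s_cintegrable; move: i; apply/square_integrableP/YL.
  - by apply: filterS (gY k.+1 kN) => s /[swap] sI /(_ sI) ->.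
have [gL fg] := hg 0%N (leq0n N).
have f0 : is_weak_derivative 0 f f by move=> phi tphi j; rewrite expr0 mul1r.
have := weak_derivative_unique fL gL f0 fg.
by move=> h; apply: filterS2 h (gY 0%N (leq0n N)) => z h1 h2 zI; rewrite h1 ?h2.
Qed.

Section traces.
Variables (N : nat) (Y : nat -> R -> 'cV[C]_d) (f : R -> 'cV[C]_d).
Hypotheses (YN : sobolev_chain N Y) (fL : f \in @square_integrable R d).
Hypothesis fY : {ae mu, forall z, I z -> f z = Y 0%N z}.

Lemma weak_derivative_chain k : (k <= N)%N ->
  weak_derivative k f \in @square_integrable R d /\
  {ae mu, forall z, I z -> weak_derivative k f z = Y k z}.
Proof.
move=> kN; have Yk := chain_weak_derivative YN kN fL fY.
have YkL : Y k \in @square_integrable R d by case: YN => + _; apply.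
rewrite /weak_derivative; case: xgetP => [g _ [gL fg]|/(_ (Y k))]; last by case.
by split=> //; exact: weak_derivative_unique fg Yk.
Qed.

Lemma chain_continuous k i : (k < N)%N ->
  continuous (fun z => Re (Y k z i 0)) /\ continuous (fun z => Im (Y k z i 0)).
Proof.
move=> kN; have [YL YV] := YN.
have /square_integrableP/(_ i)/vol_continuous [h1 h2] := YL _ kN.
split.
  rewrite (_ : (fun z => _) = (fun z => Re (Y k 0 i 0) +
    Re (vol (fun s => Y k.+1 s i 0) z))).
    by move=> z; apply: cvgD; [exact: cvg_cst|exact: h1].
  by apply/funext => z; rewrite (YV k kN) raddfD.
rewrite (_ : (fun z => _) = (fun z => Im (Y k 0 i 0) +
    Im (vol (fun s => Y k.+1 s i 0) z))).
  by move=> z; apply: cvgD; [exact: cvg_cst|exact: h2].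
by apply/funext => z; rewrite (YV k kN) raddfD.
Qed.

Lemma trace_chain k x : (k < N)%N -> 0 <= x <= 1 ->
  continuous_representative (weak_derivative k f) x = Y k x.
Proof.
move=> kN x01; have [_ wY] := weak_derivative_chain (ltnW kN).
rewrite /continuous_representative; case: xgetP => [g _ [cg gw]|/(_ (Y k)) h]; last first.
  exfalso; apply: h; split.
    by move=> j; have [c1 c2] := chain_continuous j kN; split; exact: continuous_subspaceT.
  by apply: filterS wY => z /[swap] zI /(_ zI) ->.
apply/colP => i; have [c1 c2] := chain_continuous i kN; have [d1 d2] := cg i.
apply/eqP; rewrite eq_complex; apply/andP; split; apply/eqP.
  apply: (continuous_ae_eq d1 (continuous_subspaceT c1)) x01.
  by apply: filterS2 gw wY => z h1 h2 zI; rewrite h1 ?h2.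
apply: (continuous_ae_eq d2 (continuous_subspaceT c2)) x01.
by apply: filterS2 gw wY => z h1 h2 zI; rewrite h1 ?h2.
Qed.

End traces.

End sobolev_chains.

Section riesz_fischer.
Variable R : realType.
Notation mu := (@lebesgue_measure R).
Notation I := (@I01 R).
Notation C := R[i].
Local Notation Re := (@complex.Re R).
Local Notation Im := (@complex.Im R).

Lemma rapid_cvg (r : nat -> R) (K : R) : 
  (forall k, `|r k - r k.+1| <= K * 2^-1 ^+ k) ->
  exists l, r n @[n --> \oo] --> l /\ forall k, `|r k - l| <= 2 * K * 2^-1 ^+ k.
Proof.
move=> hr; have K0 : 0 <= K by have := le_trans (normr_ge0 _) (hr 0%N); rewrite expr0 mulr1.
pose s k := r k + 2 * K * 2^-1 ^+ k; pose t k := r k - 2 * K * 2^-1 ^+ k.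
have sdec : {homo s : n m / (n <= m)%N >-> n >= m}.
  apply/nonincreasing_seqP => k; have := hr k; rewrite /s exprS ler_norml => /andP[].
  lra.
have tinc : {homo t : n m / (n <= m)%N >-> n <= m}.
  apply/nondecreasing_seqP => k; have := hr k; rewrite /t exprS ler_norml => /andP[].
  lra.
have p0 k : 0 <= 2 * K * 2^-1 ^+ k by rewrite mulr_ge0 ?exprn_ge0 ?mulr_ge0.
have ts k m : t k <= s m.
  have [km|/ltnW mk] := leqP k m.
    by apply: (le_trans (tinc _ _ km)); rewrite /t /s; have := p0 m; lra.
  by apply: le_trans (sdec _ _ mk); rewrite /t /s; have := p0 k; lra.
have cs : cvgn s.
  by apply: nonincreasing_is_cvgn => //; exists (t 0%N) => _ [m _ <-].
have rl : r n @[n --> \oo] --> limn s.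
  rewrite -[limn s]subr0 (_ : r = fun n => s n - 2 * K * 2^-1 ^+ n).
    apply: cvgB => //; rewrite -[X in _ --> X](mulr0 (2 * K)).
    by apply: cvgMr; exact: exp2V_cvg0.
  by apply/funext => n; rewrite /s addrK.
exists (limn s); split => // k.
have h1 : limn s <= s k by exact: nonincreasing_cvgn_ge.
have h2 : t k <= limn s.
  by apply: limr_ge => //; apply: nearW => m.
rewrite ler_norml; apply/andP; move: h1 h2; rewrite /s /t => h1 h2; split; lra.
Qed.

Lemma riesz_fischer_scalar (f : nat -> R -> C) (K : R) :
  (forall k, L2s (f k)) ->
  (forall k, rint (fun z => csq (f k.+1 z - f k z)) <= K * (8^-1) ^+ k) ->
  exists g, L2s g /\ exists K', forall n,
    rint (fun z => csq (f n z - g z)) <= K' * (4^-1) ^+ n.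
Proof.
move=> fL hf; pose a k z := csq (f k.+1 z - f k z).
have aL k : L1 (a k) by case: (L2sB (fL k.+1) (fL k)).
have a0 k z : 0 <= a k z by exact: csq_ge0.
pose h k z := (4 ^+ k * a k z)%:E.
have hL k : L1 (fun z => 4 ^+ k * a k z) by exact: L1Z.
have h0 k z : (0 <= h k z)%E by rewrite lee_fin mulr_ge0 ?exprn_ge0.
have mh k : measurable_fun I (h k) by apply/measurable_EFinP; exact: L1_measurable.
pose G z := (\sum_(k <oo) h k z)%E.
have mG : measurable_fun I G by exact: ge0_emeasurable_sum.
have G0 z : (0 <= G z)%E by apply: nneseries_ge0 => k _ _.
have hfin k : (\int[mu]_(z in I) h k z = (4 ^+ k * rint (a k))%:E)%E.
  rewrite -rintZ// /rint /Rintegral fineK//.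
  by apply: integrable_fin_num; [exact: measurable_I01|exact: hL].
have K0 : 0 <= K.
  have := hf 0%N; rewrite expr0 mulr1; apply: le_trans; apply: rint_ge0 => z _.
  exact: csq_ge0.
have intG : (\int[mu]_(z in I) G z <= (2 * K)%:E)%E.
  rewrite integral_nneseries//; last exact: measurable_I01.
  apply: lime_le; first by apply: is_cvg_nneseries => k _ _; exact: integral_ge0.
  apply: nearW => n; under eq_bigr do rewrite hfin.
  rewrite sumEFin lee_fin.
  suff : \sum_(0 <= k < n) 4 ^+ k * rint (a k) <= 2 * K * (1 - 2^-1 ^+ n).
    by move=> /le_trans; apply; rewrite ler_piMr ?mulr_ge0// lerBlDr lerDl exprn_ge0.
  elim: n => [|n IH]; first by rewrite big_geq// expr0 subrr mulr0.
  have hn : 4 ^+ n * rint (a n) <= K * 2^-1 ^+ n.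
    have p4 : 0 < (4 : R) ^+ n by rewrite exprn_gt0.
    have := hf n; rewrite -(ler_pM2l p4) => /le_trans; apply.
    by rewrite mulrCA -exprMn (_ : 4 * 8^-1 = 2^-1 :> R)//; field.
  rewrite big_nat_recr//=; apply: (le_trans (lerD IH hn)).
  by rewrite exprS; lra.
have iG : mu.-integrable I G.
  apply/integrableP; split=> //; under eq_integral do rewrite gee0_abs//.
  exact: le_lt_trans intG (ltry _).
have Gfin : {ae mu, forall z, I z -> G z \is a fin_num}.
  by apply: integrable_ae iG; exact: measurable_I01.
pose g z := limn_esup (fun k => (Re (f k z))%:E).
pose g' z := limn_esup (fun k => (Im (f k z))%:E).
pose F z := (fine (g z)) +i* (fine (g' z)).
have mF : cmeasurable F.
  split; apply: measurableT_comp => //; apply: measurable_fun_limn_esup => n;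
    by apply/measurable_EFinP; have [[]] := fL n.
have close n : {ae mu, forall z, I z -> csq (f n z - F z) <= 8 * fine (G z) * 4^-1 ^+ n}.
  apply: filterS Gfin => z Gz zI; have {}Gz := Gz zI.
  pose K1 := Num.sqrt (fine (G z)).
  have Gz0 : 0 <= fine (G z) by exact: fine_ge0.
  have step k : a k z <= (K1 * 2^-1 ^+ k) ^+ 2.
    rewrite exprMn sqr_sqrtr// -exprM mulnC exprM (_ : 2^-1 ^+ 2 = 4^-1 :> R); last by field.
    have p4 : 0 < (4 : R) ^+ k by rewrite exprn_gt0.
    rewrite -(ler_pM2l p4) mulrCA -exprMn mulfV// expr1n mulr1.
    rewrite -lee_fin fineK//; apply: le_trans (nneseries_lim_ge k.+1 _); last by move=> m _ _.
    by rewrite big_nat_recr//= leeDr// sume_ge0.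
  have stepRe k : `|Re (f k z) - Re (f k.+1 z)| <= K1 * 2^-1 ^+ k.
    rewrite -(ler_pXn2r (n := 2)) ?nnegrE ?mulr_ge0 ?sqrtr_ge0 ?exprn_ge0//.
    rewrite real_normK ?num_real//; apply: le_trans (step k).
    by rewrite /a -csqN opprB /csq !raddfB /= lerDl sqr_ge0.
  have stepIm k : `|Im (f k z) - Im (f k.+1 z)| <= K1 * 2^-1 ^+ k.
    rewrite -(ler_pXn2r (n := 2)) ?nnegrE ?mulr_ge0 ?sqrtr_ge0 ?exprn_ge0//.
    rewrite real_normK ?num_real//; apply: le_trans (step k).
    by rewrite /a -csqN opprB /csq !raddfB /= lerDr sqr_ge0.
  have [l1 [c1 b1]] := rapid_cvg stepRe; have [l2 [c2 b2]] := rapid_cvg stepIm.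
  have e1 : g z = l1%:E.
    have : (Re (f k z))%:E @[k --> \oo] --> l1%:E by apply: cvg_EFin => //; apply: nearW.
    by move=> /cvg_limn_einf_sup [].
  have e2 : g' z = l2%:E.
    have : (Im (f k z))%:E @[k --> \oo] --> l2%:E by apply: cvg_EFin => //; apply: nearW.
    by move=> /cvg_limn_einf_sup [].
  have := b1 n; have := b2 n; rewrite /csq /F e1 e2 !raddfB /=.
  have sq (u v : R) : `|u| <= v -> u ^+ 2 <= v ^+ 2.
    move=> uv; rewrite -real_normK ?num_real// ler_pXn2r ?nnegrE//.
    exact: le_trans uv.
  move=> /sq h2 /sq h1; apply: (le_trans (lerD h1 h2)).
  rewrite !exprMn sqr_sqrtr// -exprM mulnC exprM (_ : 2^-1 ^+ 2 = 4^-1 :> R); last by field.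
  lra.
have gL : L1 (fun z => fine (G z)).
  apply: le_integrable iG; first exact: measurable_I01.
    by apply/measurable_EFinP; apply: measurableT_comp.
  by move=> z _ /=; case: (G z) => [r| |] //=; rewrite normr0 leey.
have diffL n : L2s (fun z => f n z - F z).
  have mD : cmeasurable (fun z => f n z - F z).
    by apply: cmeasurableD; [case: (fL n)|exact: cmeasurableN].
  split=> //; apply: (L1_ae_le (measurable_csq mD) (L1Z (8 * 4^-1 ^+ n) gL)).
  apply: filterS (close n) => z /[swap] zI /(_ zI); rewrite ger0_norm ?csq_ge0//.
  by rewrite mulrAC.
exists F; split.
  apply: eq_L2s (L2sB (fL 0%N) (diffL 0%N)) => z.
  by rewrite opprB addrC subrK.
exists (8 * rint (fun z => fine (G z))) => n.
rewrite mulrAC -rintZ//; apply: rint_ae_le; [by case: (diffL n)|exact: L1Z|].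
by apply: filterS (close n) => z /[swap] zI /(_ zI); rewrite mulrAC.
Qed.

End riesz_fischer.

Section bounded_multipliers.
Variable R : realType.
Notation mu := (@lebesgue_measure R).
Notation I := (@I01 R).
Notation C := R[i].
Local Notation Re := (@complex.Re R).

Definition bounded_multiplier m n (B : R -> 'M[C]_(m, n)) : Prop :=
  (forall i j, cmeasurable (fun z => B z i j)) /\
  exists K, {ae mu, forall z, I z -> forall i j, csq (B z i j) <= K}.

Lemma mulmx_L2 m n (B : R -> 'M[C]_(m, n)) (f : R -> 'cV[C]_n) :
  bounded_multiplier B -> f \in @square_integrable R n ->
  (fun z => B z *m f z) \in @square_integrable R m.
Proof.
move=> [mB [K BK]] /square_integrableP fL; apply/square_integrableP => i.
apply: (@eq_L2s _ (fun z => \sum_j B z i j * f z j 0)).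
  by move=> z; rewrite mxE.
apply: L2s_sum => j; apply: (L2sM_bounded (mB i j) _ (fL j)) => //.
by apply: filterS BK => z /[swap] zI /(_ zI).
Qed.

Lemma multiplier_cst m n (B : 'M[C]_(m, n)) : bounded_multiplier (fun=> B).
Proof.
split=> [i j|]; first exact: cmeasurable_cst.
exists (\sum_i \sum_j csq (B i j)); apply: nearW => z _ i j.
rewrite (bigD1 i)//= (bigD1 j)//= -addrA lerDl addr_ge0//.
  by apply: sumr_ge0 => k _; exact: csq_ge0.
by apply: sumr_ge0 => k _; apply: sumr_ge0 => l _; exact: csq_ge0.
Qed.

Lemma sesq_dot n (A : 'M[C]_n) (u v : 'cV[C]_n) :
  sesq A u v = \sum_i (u i 0)^* * (A *m v) i 0.
Proof.
rewrite sesqE; apply: eq_bigr => i _; rewrite mxE mulr_sumr.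
by apply: eq_bigr => j _; rewrite mulrA.
Qed.

Lemma sesq_integrable n (B : R -> 'M[C]_n) (f g : R -> 'cV[C]_n) :
  bounded_multiplier B -> f \in @square_integrable R n ->
  g \in @square_integrable R n -> cintegrable (fun z => sesq (B z) (f z) (g z)).
Proof.
move=> hB fL gL; apply: (@eq_cintegrable _ (fun z =>
    \sum_i (f z i 0)^* * (B z *m g z) i 0)); first by move=> z; rewrite sesq_dot.
apply: cintegrable_sum => i; apply: L2sM_integrable.
  by apply: L2sJ; move: i; apply/square_integrableP.
by move: i; apply/square_integrableP; exact: mulmx_L2.
Qed.

Lemma sqr_sum_le (J : finType) (a : J -> R) :
  (\sum_j a j) ^+ 2 <= #|J|%:R * \sum_j a j ^+ 2.
Proof.
have -> : #|J|%:R * \sum_j a j ^+ 2 =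
    \sum_i \sum_j (2^-1 * a i ^+ 2 + 2^-1 * a j ^+ 2).
  rewrite [RHS](eq_bigr (fun i => #|J|%:R * (2^-1 * a i ^+ 2) +
      2^-1 * \sum_j a j ^+ 2)); last first.
    by move=> i _; rewrite big_split /= sumr_const -[X in X + _ = _]mulr_natl -mulr_sumr.
  by rewrite big_split /= sumr_const -[X in _ = _ + X]mulr_natl -!mulr_sumr; field.
have -> : (\sum_j a j) ^+ 2 = \sum_i \sum_j a i * a j.
  by rewrite expr2 mulr_suml; apply: eq_bigr => i _; rewrite mulr_sumr.
apply: ler_sum => i _; apply: ler_sum => j _.
by have := sqr_ge0 (a i - a j); nra.
Qed.

Lemma csq_sum_le (J : finType) (F : J -> C) :
  csq (\sum_j F j) <= #|J|%:R * \sum_j csq (F j).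
Proof.
rewrite [leLHS](_ : _ = (\sum_j Re (F j)) ^+ 2 + (\sum_j complex.Im (F j)) ^+ 2).
  have -> : \sum_j csq (F j) = \sum_j Re (F j) ^+ 2 + \sum_j complex.Im (F j) ^+ 2.
    by rewrite -big_split.
  by rewrite mulrDr lerD// sqr_sum_le.
by rewrite /csq !raddf_sum.
Qed.

Lemma sqnorm_mulmx m n (B : 'M[C]_(m, n)) (u : 'cV[C]_n) (K : R) :
  (forall i j, csq (B i j) <= K) -> sqnorm (B *m u) <= (m * n)%:R * K * sqnorm u.
Proof.
move=> BK; rewrite sqnormE.
have -> : (m * n)%:R * K * sqnorm u = \sum_(i < m) n%:R * (K * sqnorm u).
  by rewrite sumr_const card_ord -mulr_natl natrM; ring.
apply: ler_sum => i _; rewrite mxE (le_trans (csq_sum_le _))// card_ord ler_wpM2l//.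
rewrite sqnormE mulr_sumr; apply: ler_sum => j _.
by rewrite csqM ler_wpM2r ?csq_ge0.
Qed.

End bounded_multipliers.

Section sesquilinear_forms.
Variables (R : realType) (d : nat).
Notation C := R[i].
Local Notation Re := (@complex.Re R).
Implicit Types (A : 'M[C]_d) (u v w : 'cV[C]_d) (c : C).

Lemma sesqDl A u v w : sesq A (u + v) w = sesq A u w + sesq A v w.
Proof. by rewrite /sesq linearD map_mxD !mulmxDl mxE. Qed.

Lemma sesqDr A u v w : sesq A w (u + v) = sesq A w u + sesq A w v.
Proof. by rewrite /sesq !mulmxDr mxE. Qed.

Lemma sesqZl A c u w : sesq A (c *: u) w = c^* * sesq A u w.
Proof. by rewrite /sesq linearZ map_mxZ -!scalemxAl mxE. Qed.

Lemma sesqZr A c u w : sesq A w (c *: u) = c * sesq A w u.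
Proof. by rewrite /sesq -!scalemxAr mxE. Qed.

Lemma sesqNl A u w : sesq A (- u) w = - sesq A u w.
Proof. by rewrite -scaleN1r sesqZl rmorphN1 mulN1r. Qed.

Lemma sesqNr A u w : sesq A w (- u) = - sesq A w u.
Proof. by rewrite -scaleN1r sesqZr mulN1r. Qed.

Lemma sesqJ A u v : (sesq A u v)^* = sesq (A ^t*) v u.
Proof.
rewrite !sesqE rmorph_sum exchange_big /=; apply: eq_bigr => i _.
rewrite rmorph_sum /=; apply: eq_bigr => j _; rewrite !mxE.
case: (u i 0) (A i j) (v j 0) => [a b] [a1 b1] [a2 b2].
by apply/eqP; rewrite eq_complex /=; apply/andP; split; apply/eqP; ring.
Qed.

Lemma sesqDA A B u v : sesq (A + B) u v = sesq A u v + sesq B u v.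
Proof. by rewrite /sesq mulmxDr mulmxDl mxE. Qed.

Lemma sesqZA c A u v : sesq (c *: A) u v = c * sesq A u v.
Proof. by rewrite /sesq -scalemxAr -scalemxAl mxE. Qed.

Lemma sesqNA A u v : sesq (- A) u v = - sesq A u v.
Proof. by rewrite -scaleN1r sesqZA mulN1r. Qed.

Lemma sesq_sqnorm u : sesq 1%:M u u = (sqnorm u)%:C.
Proof.
rewrite /sesq mulmx1 mxE sqnormE rmorph_sum; apply: eq_bigr => i _.
rewrite !mxE; case: (u i 0) => a b; apply/eqP; rewrite eq_complex /csq /=.
by apply/andP; split; apply/eqP; ring.
Qed.

Lemma hermitian_entry_le A (M : R) i j : 0 < M ->
  (forall u : 'cV[C]_d, 0 <= Re (sesq A u u) <= M * sqnorm u) -> A ^t* = A ->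
  csq (A i j) <= 4 * M ^+ 2.
Proof.
move=> M0 hA Asym.
have Aji : A j i = (A i j)^* by rewrite -{1}Asym !mxE.
have sq1 k : sqnorm (delta_mx k 0 : 'cV[C]_d) = 1.
  rewrite sqnormE (bigD1 k)//= big1 ?addr0 => [|l lk]; rewrite mxE ?eqxx ?(negbTE lk) /csq /=.
    by rewrite expr1n expr0n addr0.
  by rewrite expr0n addr0.
have sd k l : sesq A (delta_mx k 0) (delta_mx l 0) = A k l.
  rewrite sesqE (bigD1 k)//= (bigD1 l)//= !mxE !eqxx big1 => [|m ml].
    rewrite big1 => [|m mk]; first by rewrite rmorph1 mul1r mulr1 !addr0.
    by apply: big1 => m' _; rewrite !mxE (negbTE mk) rmorph0 !mul0r.
  by rewrite !mxE (negbTE ml) mulr0.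
pose s := (2 * M)^-1; pose c : C := s%:C * (A i j)^*.
have cq : csq c = s ^+ 2 * csq (A i j) by rewrite /c csqM csq_real csqJ.
have := hA (delta_mx i 0 + c *: delta_mx j 0); rewrite !(sesqDl, sesqDr, sesqZl, sesqZr, sd).
move=> /andP[_]; have := sqnormD (delta_mx i 0) (c *: delta_mx j 0 : 'cV[C]_d).
rewrite sqnormZ -/(csq c) !sq1 !mulr1 cq => h1 h2.
have hi : 0 <= Re (A i i) by rewrite -sd; have /andP[] := hA (delta_mx i 0).
have hj : 0 <= Re (A j j) by rewrite -sd; have /andP[] := hA (delta_mx j 0).
have e : Re (A i i + c * A i j + c^* * (A j i + c * A j j)) =
    Re (A i i) + 2 * s * csq (A i j) + s ^+ 2 * csq (A i j) * Re (A j j).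
  rewrite Aji /c; case: (A i i) (A i j) (A j j) => [a b] [a1 b1] [a2 b2].
  by rewrite /csq; simpc => /=; ring.
rewrite {}e in h2.
have q0 := csq_ge0 (A i j); have s0 : 0 < s by rewrite invr_gt0 mulr_gt0.
have q2 : 0 <= s ^+ 2 * csq (A i j) * Re (A j j).
  by apply: mulr_ge0 => //; apply: mulr_ge0 => //; exact: sqr_ge0.
have {}h1 := ler_wpM2l (ltW M0) h1.
have sM : s * M = 2^-1 by rewrite /s; field; rewrite gt_eqF.
have h3 : 2 * s * csq (A i j) <= 2 * M + 2 * (s * M) * s * csq (A i j).
  by move: h1 h2; rewrite -/c; nra.
rewrite sM in h3.
have h4 : s * csq (A i j) <= 2 * M by lra.
have {}h4 : 2 * M * (s * csq (A i j)) <= 2 * M * (2 * M).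
  by apply: ler_wpM2l => //; rewrite mulr_ge0// ltW.
have e4 : 2 * M * (s * csq (A i j)) = csq (A i j).
  by rewrite mulrA -[2 * M * s]mulrA (mulrC M) sM mulfV// mul1r.
by move: h4; rewrite e4 (_ : 2 * M * (2 * M) = 4 * M ^+ 2)//; ring.
Qed.

End sesquilinear_forms.

Section energy_spaces.
Variables (R : realType) (d : nat).
Notation mu := (@lebesgue_measure R).
Notation I := (@I01 R).
Notation C := R[i].
Local Notation Re := (@complex.Re R).
Variables (H : R -> 'M[C]_d) (hH : energy_density H).
Local Notation X := (energy_space hH).
Local Notation L2f := (@square_integrable R d).

Definition nsq (f : R -> 'cV[C]_d) : R := rint (fun z => sqnorm (f z)).

Lemma density_multiplier : bounded_multiplier H.
Proof.
have [mH [m0 [M0 [m0_gt0 mM hM]]]] := hH; split=> //.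
exists (4 * M0 ^+ 2); apply: filterS hM => z /[swap] zI /(_ zI) [Hsym Hb] i j.
have M00 := lt_le_trans m0_gt0 mM.
apply: hermitian_entry_le => // u; have /andP[h1 ->] := Hb u; rewrite andbT.
by apply: le_trans h1; rewrite mulr_ge0 ?sqnorm_ge0 ?ltW.
Qed.

Lemma density_mul_L2 f : f \in L2f -> (fun z => H z *m f z) \in L2f.
Proof. exact: mulmx_L2 density_multiplier. Qed.

Lemma L2_class_repr f : f \in L2f ->
  {ae mu, forall z, I z -> L2_repr (L2_class f) z = f z}.
Proof.
move=> fL; have := repr_pi_L2 (insubd (0 : L2fun R d) f).
by rewrite /L2_repr /L2_class; apply: filterS => z /[swap] zI /(_ zI) ->; rewrite insubdK.
Qed.

Lemma weighted_ip_ae f f' g g' : f \in L2f -> f' \in L2f -> g \in L2f -> g' \in L2f ->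
  {ae mu, forall z, I z -> f z = f' z} -> {ae mu, forall z, I z -> g z = g' z} ->
  weighted_ip H f g = weighted_ip H f' g'.
Proof.
move=> fL fL' gL gL' ff gg; apply: cintegral_ae.
- exact/cintegrable_cmeasurable/sesq_integrable/gL/fL/density_multiplier.
- exact/cintegrable_cmeasurable/sesq_integrable/gL'/fL'/density_multiplier.
- by apply: filterS2 ff gg => z f1 g1 zI; rewrite f1 ?g1.
Qed.

End energy_spaces.

Section energy_inner_product.
Variables (R : realType) (d : nat).
Notation mu := (@lebesgue_measure R).
Notation I := (@I01 R).
Notation C := R[i].
Local Notation Re := (@complex.Re R).
Variables (H : R -> 'M[C]_d) (hH : energy_density H).
Local Notation X := (energy_space hH).
Local Notation L2f := (@square_integrable R d).
Local Notation ip := (energy_ip hH).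
Implicit Types x y w : X.

Lemma L2_repr_L2 x : L2_repr x \in L2f. Proof. exact: L2_reprP. Qed.

Lemma ip_integrable x y : cintegrable (fun z => sesq (H z) (L2_repr x z) (L2_repr y z)).
Proof. by apply: sesq_integrable; rewrite ?L2_repr_L2//; exact: density_multiplier hH. Qed.

Lemma energy_ip_class f g : f \in L2f -> g \in L2f ->
  ip (L2_class f) (L2_class g) = weighted_ip H f g.
Proof.
move=> fL gL; apply: weighted_ip_ae; rewrite ?L2_repr_L2//; exact: L2_class_repr.
Qed.

Lemma energy_ipDl x y w : ip (x + y) w = ip x w + ip y w.
Proof.
rewrite /energy_ip (@weighted_ip_ae _ _ _ hH _ (fun z => L2_repr x z + L2_repr y z)
  _ (L2_repr w)) ?L2_repr_L2//.
- rewrite /weighted_ip -cintegralD; try exact: ip_integrable.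
  by apply: eq_cintegral => z _; rewrite sesqDl.
- by apply: rpredD; exact: L2_repr_L2.
- exact: L2_reprD.
- exact: nearW.
Qed.

Lemma energy_ipZl (c : C) x w : ip (c *: x) w = c^* * ip x w.
Proof.
rewrite /energy_ip (@weighted_ip_ae _ _ _ hH _ (fun z => c *: L2_repr x z)
  _ (L2_repr w)) ?L2_repr_L2//.
- rewrite /weighted_ip -cintegralZ; last exact: ip_integrable.
  by apply: eq_cintegral => z _; rewrite sesqZl.
- by apply: rpredZ; exact: L2_repr_L2.
- exact: L2_reprZ.
- exact: nearW.
Qed.

Lemma energy_ipC x y : (ip x y)^* = ip y x.
Proof.
have [_ [m0 [M0 [_ _ hM]]]] := hH.
rewrite /energy_ip /weighted_ip -cintegralJ; last exact: ip_integrable.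
apply: cintegral_ae.
- by apply: cmeasurableJ; apply: cintegrable_cmeasurable; exact: ip_integrable.
- by apply: cintegrable_cmeasurable; exact: ip_integrable.
- by apply: filterS hM => z /[swap] zI /(_ zI)[Hs _]; rewrite sesqJ Hs.
Qed.

Lemma Re_ip x y : Re (ip x y) = rint (fun z => Re (sesq (H z) (L2_repr x z) (L2_repr y z))).
Proof. by []. Qed.

Lemma nsq_L1 f : f \in L2f -> L1 (fun z => sqnorm (f z)).
Proof. by move=> /square_integrableP fL; apply: L1_sum => i; case: (fL i). Qed.

Lemma nsq_ge0 (f : R -> 'cV[C]_d) : 0 <= nsq f.
Proof. by apply: rint_ge0 => z _; exact: sqnorm_ge0. Qed.

Lemma energy_nsq_bounds : exists m0 M0 : R, [/\ 0 < m0, 0 < M0 &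
  forall x, m0 * nsq (L2_repr x) <= Re (ip x x) <= M0 * nsq (L2_repr x)].
Proof.
have [_ [m0 [M0 [m0_gt0 mM hM]]]] := hH; exists m0, M0; split=> //.
  exact: lt_le_trans mM.
move=> x; have xL := nsq_L1 (L2_repr_L2 x); have [iL _] := ip_integrable x x.
rewrite Re_ip -!rintZ//; apply/andP; split; apply: rint_ae_le; try exact: L1Z; try exact: iL.
  by apply: filterS hM => z /[swap] zI /(_ zI)[_ /(_ (L2_repr x z))/andP[]].
by apply: filterS hM => z /[swap] zI /(_ zI)[_ /(_ (L2_repr x z))/andP[]].
Qed.

Lemma Re_ip_ge0 x : 0 <= Re (ip x x).
Proof.
have [m0 [M0 [m00 _ /(_ x)/andP[+ _]]]] := energy_nsq_bounds.
by apply: le_trans; rewrite mulr_ge0 ?nsq_ge0 ?ltW.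
Qed.

Lemma energy_real_ip : real_ip (fun x y => Re (ip x y) : R).
Proof.
split=> [x y|x y w|a x y|x].
- by rewrite -energy_ipC; case: (ip x y).
- by rewrite energy_ipDl raddfD.
- by rewrite energy_ipZl; case: (ip x y) => u v /=; ring.
- by rewrite /rnorm /= sqr_sqrtr// Re_ip_ge0.
Qed.

Lemma nsq_sum (f : R -> 'cV[C]_d) : f \in L2f ->
  nsq f = \sum_i rint (fun z => csq (f z i 0)).
Proof. by move=> /square_integrableP fL; rewrite -rint_sum// => i; case: (fL i). Qed.

Lemma nsq_ae f g : f \in L2f -> g \in L2f ->
  {ae mu, forall z, I z -> f z = g z} -> nsq f = nsq g.
Proof.
move=> fL gL fg; apply: rint_ae (L1_measurable (nsq_L1 fL)) (L1_measurable (nsq_L1 gL)) _.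
by apply: filterS fg => z /[swap] zI /(_ zI) ->.
Qed.

Lemma L2_reprB x y : {ae mu, forall z, I z -> L2_repr (x - y) z = L2_repr x z - L2_repr y z}.
Proof.
have h1 := L2_reprD x (- y); have h2 := L2_reprZ (-1) y.
apply: filterS2 h1 h2 => z h1 h2 zI; rewrite (h1 zI) -[- y]scaleN1r.
by rewrite (h2 zI) scaleN1r.
Qed.

Lemma energy_complete : seq_complete X.
Proof.
move=> u hu; have [m0 [M0 [m00 M00 hmM]]] := energy_nsq_bounds.
have rnsq x : rnorm x ^+ 2 = Re (ip x x) by rewrite -(ip_rnorm energy_real_ip).
have hN k : exists n, forall m, (n <= m)%N -> rnorm (u n - u m) < (4^-1) ^+ k.
  by apply: hu; rewrite exprn_gt0.
have [N {}hN] := choice hN.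
pose s k := (\max_(j < k.+1) N j)%N.
have Ns k : (N k <= s k)%N by exact: (leq_bigmax (Ordinal (ltnSn k))).
have sS k : (s k <= s k.+1)%N.
  apply/bigmax_leqP => j _.
  exact: (leq_bigmax (widen_ord (leqnSn _) j) (F := fun j : 'I_k.+2 => N j)).
have step k m : (s k <= m)%N -> rnorm (u (s k) - u m) <= 2 * (4^-1) ^+ k.
  move=> km; have := rnormB_trans (u (N k)) (u (s k)) (u m).
  rewrite (rnorm_distC (u (s k)) (u (N k))).
  move: (hN k _ (Ns k)) (hN k _ (leq_trans (Ns k) km)).
  move: (rnorm (u (s k) - u m)) (rnorm (u (N k) - u (s k))) (rnorm (u (N k) - u m)).
  by move: ((4^-1 : R) ^+ k) => t a b c; lra.
pose f k := L2_repr (u (s k)).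
have fL k i : L2s (fun z => f k z i 0).
  by move: i; apply/square_integrableP; exact: L2_repr_L2.
have fstep k i : rint (fun z => csq (f k.+1 z i 0 - f k z i 0)) <= 4 / m0 * (8^-1) ^+ k.
  have dL : (fun z => f k.+1 z - f k z) \in L2f.
    apply/square_integrableP => j.
    by apply: eq_L2s (L2sB (fL k.+1 j) (fL k j)) => z; rewrite !mxE.
  have le1 : rint (fun z => csq (f k.+1 z i 0 - f k z i 0)) <= nsq (fun z => f k.+1 z - f k z).
    apply: rint_le; [by case: (L2sB (fL k.+1 i) (fL k i))|exact: nsq_L1|].
    by move=> z _; have := csq_le_sqnorm (f k.+1 z - f k z) i; rewrite !mxE.
  apply: (le_trans le1).
  rewrite -(nsq_ae (L2_repr_L2 (u (s k.+1) - u (s k))) dL (L2_reprB _ _)).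
  rewrite -(ler_pM2l m00); have /andP[h _] := hmM (u (s k.+1) - u (s k)).
  apply: (le_trans h); rewrite -rnsq rnorm_distC.
  apply: (@le_trans _ _ ((2 * (4^-1) ^+ k) ^+ 2)).
    by rewrite ler_pXn2r ?nnegrE ?rnorm_ge0 ?mulr_ge0 ?exprn_ge0// step.
  rewrite !mulrA [m0 * 4]mulrC mulfK ?gt_eqF// exprMn -exprM mulnC exprM.
  have -> : (2 : R) ^+ 2 = 4 by ring.
  rewrite ler_pM2l//; apply: lerXn2r; rewrite ?nnegrE ?exprn_ge0//; lra.
have [g hg] := choice (fun i => riesz_fischer_scalar (fL^~ i) (fstep^~ i)).
pose G z : 'cV[C]_d := \col_i g i z.
have GL : G \in L2f.
  by apply/square_integrableP => i; have [gL _] := hg i; apply: eq_L2s gL => z; rewrite mxE.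
have [K hK] := choice (fun i => (hg i).2).
have close k : nsq (fun z => f k z - G z) <= (\sum_i K i) * (4^-1) ^+ k.
  have dL : (fun z => f k z - G z) \in L2f.
    apply/square_integrableP => i; have [gL _] := hg i.
    by apply: eq_L2s (L2sB (fL k i) gL) => z; rewrite !mxE.
  rewrite nsq_sum// mulr_suml; apply: ler_sum => i _.
  by rewrite (_ : rint _ = rint (fun z => csq (f k z i 0 - g i z)))//;
    apply: rint_eq => z _; rewrite !mxE.
pose l : X := L2_class G.
have dist k : rnorm (u (s k) - l) ^+ 2 <= M0 * ((\sum_i K i) * (4^-1) ^+ k).
  rewrite rnsq; have /andP[_ h] := hmM (u (s k) - l); apply: (le_trans h).
  rewrite ler_pM2l// (le_trans _ (close k))//.
  have dL : (fun z => f k z - G z) \in L2f.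
    apply/square_integrableP => i; have [gL _] := hg i.
    by apply: eq_L2s (L2sB (fL k i) gL) => z; rewrite !mxE.
  rewrite (@nsq_ae _ (fun z => f k z - G z)) ?L2_repr_L2//.
  apply: filterS2 (L2_reprB (u (s k)) l) (L2_class_repr GL) => z h1 h2 zI.
  by rewrite h1// h2.
exists l; apply/cvg_rnorm => e e0.
have e2 : 0 < e / 2 by rewrite divr_gt0.
have cv4 : (4^-1 : R) ^+ k @[k --> \oo] --> 0 by apply: cvg_expr; rewrite ger0_norm; lra.
have c1 : M0 * ((\sum_i K i) * (4^-1) ^+ k) @[k --> \oo] -->
    M0 * ((\sum_i K i) * 0) by do 2 apply: cvgMr.
have c2 : 2 * (4^-1 : R) ^+ k @[k --> \oo] --> 2 * (0 : R) by apply: cvgMr.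
rewrite !mulr0 in c1 c2.
move/cvgrPdist_lt : c1 => /(_ _ (exprn_gt0 2 e2)) [k1 _ h1].
move/cvgrPdist_lt : c2 => /(_ _ e2) [k2 _ h2].
pose k := maxn k1 k2; exists (s k) => // m /= km.
have a1 : rnorm (u (s k) - l) < e / 2.
  rewrite -(ltr_pXn2r (n := 2)) ?nnegrE ?rnorm_ge0 ?ltW//.
  apply: (le_lt_trans (dist k)); have := h1 k (leq_maxl _ _).
  by rewrite /= sub0r normrN; apply: le_lt_trans; exact: ler_norm.
have a2 : rnorm (u (s k) - u m) < e / 2.
  apply: (le_lt_trans (step k m km)); have := h2 k (leq_maxr _ _).
  by rewrite /= sub0r normrN; apply: le_lt_trans; exact: ler_norm.
apply: (le_lt_trans (rnormB_trans (u (s k)) _ _)).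
rewrite (rnorm_distC l (u (s k))) [ltRHS]splitr; exact: ltrD a1 a2.
Qed.

End energy_inner_product.

Section maximal_nonpositive.
Variables (R : realType).
Notation C := R[i].
Local Notation Re := (@complex.Re R).

Definition rdot n (u v : 'cV[C]_n) : R := Re (sesq 1%:M u v).

Lemma rdotE n (u v : 'cV[C]_n) : rdot u v = \sum_i Re ((u i 0)^* * v i 0).
Proof.
by rewrite /rdot sesq_dot mul1mx raddf_sum.
Qed.

Lemma rdotC n (u v : 'cV[C]_n) : rdot u v = rdot v u.
Proof.
rewrite !rdotE; apply: eq_bigr => i _.
by case: (u i 0) (v i 0) => [a b] [a' b'] /=; ring.
Qed.

Lemma rdotDl n (u v w : 'cV[C]_n) : rdot (u + v) w = rdot u w + rdot v w.
Proof. by rewrite /rdot sesqDl raddfD. Qed.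

Lemma rdotNl n (u w : 'cV[C]_n) : rdot (- u) w = - rdot u w.
Proof. by rewrite /rdot sesqNl raddfN. Qed.

Lemma rdotDr n (u v w : 'cV[C]_n) : rdot w (u + v) = rdot w u + rdot w v.
Proof. by rewrite !(rdotC w) rdotDl. Qed.

Lemma rdotNr n (u w : 'cV[C]_n) : rdot w (- u) = - rdot w u.
Proof. by rewrite !(rdotC w) rdotNl. Qed.

Lemma rdot_sqnorm n (u : 'cV[C]_n) : rdot u u = sqnorm u.
Proof. by rewrite /rdot sesq_sqnorm. Qed.

Lemma trmxCK m n (A : 'M[C]_(m, n)) : A ^t* ^t* = A.
Proof. by apply/matrixP => i j; rewrite !mxE conjCK. Qed.

Lemma trmxC_mul m n p (A : 'M[C]_(m, n)) (B : 'M[C]_(n, p)) :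
  (A *m B) ^t* = B ^t* *m A ^t*.
Proof. by rewrite trmx_mul map_mxM. Qed.

Lemma trmxCD m n (A B : 'M[C]_(m, n)) : (A + B) ^t* = A ^t* + B ^t*.
Proof. by rewrite linearD map_mxD. Qed.

Lemma trmxCN m n (A : 'M[C]_(m, n)) : (- A) ^t* = - A ^t*.
Proof. by apply/matrixP => i j; rewrite !mxE rmorphN. Qed.

Lemma sesq_mull m n (B : 'M[C]_n) (A : 'M[C]_(n, m)) u v :
  sesq B (A *m u) v = (u ^t* *m (A ^t* *m (B *m v))) 0 0.
Proof. by rewrite /sesq trmxC_mul !mulmxA. Qed.

Lemma rdot_adj m n (A : 'M[C]_(m, n)) u v : rdot (A *m u) v = rdot u (A ^t* *m v).
Proof. by rewrite /rdot sesq_mull mul1mx /sesq mulmx1. Qed.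

Lemma adjoint_contraction m n (A : 'M[C]_(m, n)) :
  (forall u, sqnorm (A *m u) <= sqnorm u) -> forall v, sqnorm (A ^t* *m v) <= sqnorm v.
Proof.
move=> hA v; set y := A ^t* *m v.
have e : sqnorm y = rdot (A *m y) v by rewrite rdot_adj -rdot_sqnorm.
have : 0 <= sqnorm (A *m y - v) by exact: sqnorm_ge0.
rewrite -rdot_sqnorm rdotDl !rdotDr !rdotNl !rdotNr (rdotC v) -e !rdot_sqnorm.
by have := hA y; lra.
Qed.

Lemma swap_form n (f e : 'cV[C]_n) :
  Re (sesq (swap_mx R n) (col_mx f e) (col_mx f e)) = 2 * rdot f e.
Proof.
rewrite /sesq /swap_mx tr_col_mx map_row_mx mul_row_block mul_row_col.
rewrite !mulmx0 !mulmx1 addr0 add0r mxE raddfD /=.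
have -> : Re ((e ^t* *m f) 0 0) = rdot e f by rewrite /rdot /sesq mulmx1.
have -> : Re ((f ^t* *m e) 0 0) = rdot f e by rewrite /rdot /sesq mulmx1.
by rewrite rdotC; ring.
Qed.

Lemma rdot_polar n (p q : 'cV[C]_n) :
  2 * rdot p q = 2^-1 * (sqnorm (p + q) - sqnorm (p - q)).
Proof.
rewrite -!rdot_sqnorm !rdotDl !rdotDr !rdotNl !rdotNr (rdotC q p).
move: (rdot p p) (rdot p q) (rdot q q) => a b c; lra.
Qed.

Lemma gram_split n (W1 W2 : 'M[C]_n) u :
  Re (sesq (W1 *m W2 ^t* + W2 *m W1 ^t*) u u) =
  2^-1 * (sqnorm ((W1 + W2) ^t* *m u) - sqnorm ((W1 - W2) ^t* *m u)).
Proof.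
have e (A B : 'M[C]_n) : Re (sesq (A *m B ^t*) u u) = rdot (A ^t* *m u) (B ^t* *m u).
  by rewrite rdot_adj trmxCK /rdot /sesq mulmx1 !mulmxA.
rewrite sesqDA raddfD /= !e (trmxCD W1 W2) (trmxCD W1 (- W2)) (trmxCN W2).
rewrite (mulmxDl (W1 ^t*) (W2 ^t*) u) (mulmxDl (W1 ^t*) (- W2 ^t*) u) mulNmx.
by rewrite -rdot_polar (rdotC (W2 ^t* *m u)); move: (rdot _ _) => a; ring.
Qed.

Variables (n : nat) (W : 'M[C]_(n, n + n)).
Hypothesis W_rank : \rank W = n.

Let W1 := lsubmx W.
Let W2 := rsubmx W.
Let U := W1 + W2.
Let Z := W1 - W2.

Let W_mul (f e : 'cV[C]_n) : W *m col_mx f e = W1 *m f + W2 *m e.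
Proof. by rewrite -(hsubmxK W) mul_row_col. Qed.

Let UZ a b : W1 *m (a + b) + W2 *m (a - b) = U *m a + Z *m b :> 'cV[C]_n.
Proof.
by rewrite /U /Z !mulmxDl !mulmxDr mulmxN mulNmx addrACA.
Qed.

Let form_ab (a b : 'cV[C]_n) : rdot (a + b) (a - b) = sqnorm a - sqnorm b.
Proof.
rewrite !rdotDl !rdotDr !rdotNr !rdot_sqnorm (rdotC b a); ring.
Qed.

Let W_gram : W *m swap_mx R n *m W ^t* = W1 *m W2 ^t* + W2 *m W1 ^t*.
Proof.
rewrite -{1 2}(hsubmxK W) /swap_mx mul_row_block !mulmx0 !mulmx1 addr0 add0r.
by rewrite tr_row_mx map_col_mx mul_row_col addrC.
Qed.

Let gram_form u : Re (sesq (W *m swap_mx R n *m W ^t*) u u) =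
  2^-1 * (sqnorm (U ^t* *m u) - sqnorm (Z ^t* *m u)).
Proof.
by rewrite W_gram gram_split.
Qed.

Let gram_sym : (W *m swap_mx R n *m W ^t*) ^t* = W *m swap_mx R n *m W ^t*.
Proof. by rewrite W_gram trmxCD !trmxC_mul !trmxCK addrC. Qed.

Lemma unitmx_of_inj m (A : 'M[C]_m) : (forall u : 'cV[C]_m, A *m u = 0 -> u = 0) -> A \in unitmx.
Proof.
move=> hA; rewrite -unitmx_tr -row_free_unit -kermx_eq0; apply/eqP/row_matrixP => i.
rewrite row0; apply/(can_inj (@trmxK _ _ _)); rewrite trmx0; apply: hA.
apply: (can_inj (@trmxK _ _ _)); rewrite trmx_mul trmxK trmx0.
by rewrite -row_mul mulmx_ker row0.
Qed.

Lemma sqnorm_le0 m (u : 'cV[C]_m) : sqnorm u <= 0 -> u = 0.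
Proof. by move=> h; apply: sqnorm_eq0; apply/le_anti; rewrite h sqnorm_ge0. Qed.

Lemma kernel_nonpositiveP :
  (forall v : 'cV[C]_(n + n), W *m v = 0 -> Re (sesq (swap_mx R n) v v) <= 0) <->
  psdmx (W *m swap_mx R n *m W ^t*).
Proof.
have real_form u : 0 <= Re (sesq (W *m swap_mx R n *m W ^t*) u u) <->
    0 <= sesq (W *m swap_mx R n *m W ^t*) u u.
  have := sesqJ (W *m swap_mx R n *m W ^t*) u u; rewrite gram_sym.
  case: (sesq _ u u) => a b [] h; have {}h : b = 0 by lra.
  by rewrite lecE /= h eqxx.
split=> [hW|[_ hW] v].
  split=> // u; apply/real_form; rewrite gram_form mulr_ge0 ?invr_ge0// subr_ge0.
  have hab a b : U *m a + Z *m b = 0 -> sqnorm a <= sqnorm b.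
    move=> ab; have := hW (col_mx (a + b) (a - b)); rewrite W_mul UZ => /(_ ab).
    by rewrite swap_form form_ab; lra.
  have Uu : U \in unitmx.
    apply: unitmx_of_inj => a Ua; apply: sqnorm_le0; rewrite -(sqnorm0 R n).
    by apply: hab; rewrite Ua mulmx0 addr0.
  pose K := - (invmx U *m Z).
  have hK b : sqnorm (K *m b) <= sqnorm b.
    apply: hab; rewrite /K mulNmx mulmxN -mulmxA mulKVmx// addrC subrr//.
  have := adjoint_contraction hK (U ^t* *m u).
  rewrite /K trmxCN trmxC_mul mulNmx -mulmxA.
  have -> : (invmx U) ^t* *m (U ^t* *m u) = u.
    by rewrite mulmxA -trmxC_mul mulmxV// trmx1 map_mx1 mul1mx.
  by rewrite -scaleN1r sqnormZ /= sqrrN expr1n oppr0 expr0n addr0 mul1r.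
have hUZ u : sqnorm (Z ^t* *m u) <= sqnorm (U ^t* *m u).
  have /real_form := hW u; rewrite gram_form pmulr_rge0 ?invr_gt0// subr_ge0//.
have Uu : U ^t* \in unitmx.
  apply: unitmx_of_inj => u Uu0.
  have Zu0 : Z ^t* *m u = 0 by apply: sqnorm_le0; rewrite (le_trans (hUZ u))// Uu0 sqnorm0.
  have w1 : W1 ^t* *m u = 0.
    have : (2 : C) *: (W1 ^t* *m u) = 0.
      rewrite scaler_nat mulr2n -[in RHS](addr0 0) -{1}Uu0 -{1}Zu0 /U /Z !trmxCD trmxCN.
      by rewrite !mulmxDl mulNmx addrACA subrr addr0.
    by move=> /eqP; rewrite scaler_eq0 pnatr_eq0 /= => /eqP.
  have w2 : W2 ^t* *m u = 0.
    by move: Uu0; rewrite /U trmxCD mulmxDl w1 add0r.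
  have uW : u ^t* *m W = 0.
    rewrite -(hsubmxK W) mul_mx_row -/W1 -/W2.
    have -> : u ^t* *m W1 = 0 by rewrite -[LHS]trmxCK trmxC_mul trmxCK w1 trmx0 map_mx0.
    have -> : u ^t* *m W2 = 0 by rewrite -[LHS]trmxCK trmxC_mul trmxCK w2 trmx0 map_mx0.
    by rewrite row_mx0.
  have /row_free_inj Winj : row_free W by rewrite /row_free W_rank.
  have u0 : u ^t* = 0 by apply: Winj; rewrite uW mul0mx.
  by rewrite -[u]trmxCK u0 trmx0 map_mx0.
pose K' := - (Z ^t* *m invmx (U ^t*)).
have hK' x : sqnorm (K' *m x) <= sqnorm x.
  rewrite /K' mulNmx -scaleN1r sqnormZ /= sqrrN expr1n oppr0 expr0n addr0 mul1r -mulmxA.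
  by rewrite (le_trans (hUZ _))// mulKVmx.
have hK b : sqnorm (K' ^t* *m b) <= sqnorm b by exact: adjoint_contraction.
rewrite -(vsubmxK v); set f := usubmx v; set e := dsubmx v.
rewrite W_mul swap_form => fe0.
have ab : U *m (f + e) + Z *m (f - e) = 0.
  rewrite -UZ (_ : f + e + (f - e) = 2 *: f); last first.
    by rewrite addrACA subrr addr0 scaler_nat.
  rewrite (_ : f + e - (f - e) = 2 *: e); last first.
    by rewrite opprB addrC addrA subrK scaler_nat.
  by rewrite -!scalemxAr -scalerDr fe0 scaler0.
have Ua : f + e = K' ^t* *m (f - e).
  rewrite /K' trmxCN trmxC_mul trmxCK mulNmx.
  have Ui : (invmx (U ^t*)) ^t* *m U = 1%:M.
    by rewrite -[X in _ *m X = _](trmxCK U) -trmxC_mul mulmxV// trmx1 map_mx1.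
  rewrite -[LHS]mul1mx -Ui -!mulmxA -mulmxN; congr (_ *m _).
  by apply/eqP; rewrite -addr_eq0; apply/eqP.
have := hK (f - e); rewrite -Ua => h.
rewrite rdot_polar; move: h; move: (sqnorm (f + e)) (sqnorm (f - e)) => p q; lra.
Qed.

End maximal_nonpositive.

Section port_algebra.
Variables (R : realType) (N d : nat).
Notation C := R[i].
Local Notation Re := (@complex.Re R).
Variable P : nat -> 'M[C]_d.
Hypothesis P_sym : forall k : nat, (1 <= k <= N)%N ->
  (P k) ^t* = (-1) ^+ k.-1 *: P k.
Hypothesis PN_unit : P N \in unitmx.

Local Notation n := (blockdim N d).
Local Notation Q := (port_matrix N P).

Definition port_block (i j : nat) : 'M[C]_d :=
  if (i + j < N)%N then (-1) ^+ i *: P (i + j).+1 else 0.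

Lemma trmxCZ m p (c : C) (A : 'M[C]_(m, p)) : (c *: A) ^t* = Num.conj c *: A ^t*.
Proof. by rewrite linearZ map_mxZ. Qed.

Lemma conj_sign k : Num.conj ((-1) ^+ k : C) = (-1) ^+ k.
Proof. by rewrite rmorphXn rmorphN1. Qed.

Lemma port_block_sym i j : (port_block j i) ^t* = port_block i j.
Proof.
rewrite /port_block addnC; case: ifP => ij; last by rewrite trmx0 map_mx0.
rewrite trmxCZ P_sym ?ij// scalerA conj_sign /= -exprD.
rewrite addnCA exprD addnn -mul2n exprM sqrrN expr1n expr1n mulr1.
by [].
Qed.

Lemma port_matrix_sym : Q ^t* = Q.
Proof.
apply/matrixP => a b; rewrite !mxE.
have := congr1 (fun M : 'M[C]_d => M (tagnat.sig2 a) (tagnat.sig2 b)) (port_block_sym (tagnat.sig1 a) (tagnat.sig1 b)).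
by rewrite !mxE.
Qed.

Lemma mxcol_adj p (y : 'I_N -> 'cV[C]_d) (Z : 'M[C]_(n, p)) :
  (\mxcol_k y k) ^t* *m Z = \sum_i (y i) ^t* *m submxcol Z i.
Proof.
rewrite -{1}[Z]submxcolK -mul_mxrow_mxcol; congr (_ *m _).
by apply/matrixP => i j; rewrite !mxE.
Qed.

Lemma submxcol_port (y : 'I_N -> 'cV[C]_d) i :
  submxcol (Q *m \mxcol_k y k) i = \sum_(j < N) port_block i j *m y j.
Proof.
rewrite /port_matrix mxblockEh mul_mxrow_mxcol submxcol_sum.
by apply: eq_bigr => j _; rewrite -submxcol_mul mxcolK.
Qed.

Lemma sesq_port (y y' : 'I_N -> 'cV[C]_d) :
  sesq Q (\mxcol_k y k) (\mxcol_k y' k) =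
  \sum_(i < N) \sum_(j < N) sesq (port_block i j) (y i) (y' j).
Proof.
rewrite /sesq -mulmxA mxcol_adj summxE; apply: eq_bigr => i _.
rewrite submxcol_port mulmx_sumr summxE; apply: eq_bigr => j _.
by rewrite mulmxA.
Qed.

Lemma port_matrix_unit : Q \in unitmx.
Proof.
apply: unitmx_of_inj => Y QY0; rewrite -[Y]submxcolK.
set y := submxcol Y.
have rowE (i : 'I_N) : \sum_(j < N) port_block i j *m y j = 0.
  have := submxcol_port y i; rewrite submxcolK QY0 submxcol0 => <-//.
suff y0 (j : 'I_N) : y j = 0.
  by apply/mxcolP => i; rewrite mxcolK y0 submxcol0.
case: j => j; elim/ltn_ind: j => j IH jN.
have iN : (N - j.+1 < N)%N by lia.
have := rowE (Ordinal iN); rewrite (bigD1 (Ordinal jN))//= big1 ?addr0.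
  rewrite /port_block /= (_ : (N - j.+1 + j < N)%N = true); last by lia.
  rewrite (_ : (N - j.+1 + j).+1 = N); last by lia.
  rewrite -scalemxAl => /eqP; rewrite scaler_eq0 signr_eq0 /= => /eqP h.
  by rewrite -[LHS](mulKmx PN_unit) h mulmx0.
move=> k /eqP kj; have [kj'|jk] := ltnP k j.
  by have := IH _ kj' (ltn_ord k); rewrite (_ : Ordinal (ltn_ord k) = k) ?[RHS]mulmx0; [move=> ->; rewrite mulmx0|exact: val_inj].
have {}jk : (j < k)%N.
  by rewrite ltn_neqAle jk andbT; apply/eqP => e; apply: kj; apply: val_inj.
rewrite /port_block /= (_ : (N - j.+1 + k < N)%N = false) ?mul0mx//.
by apply/negbTE; rewrite -leqNgt; have := ltn_ord k; lia.
Qed.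

Definition port_map : 'M[C]_(n + n) := block_mx Q (- Q) 1%:M 1%:M.

Lemma port_map_unit : port_map \in unitmx.
Proof.
apply: unitmx_of_inj => v; rewrite -[v]vsubmxK /port_map mul_block_col.
move: (usubmx v) (dsubmx v) => f e.
rewrite -[RHS]col_mx0 => /eq_col_mx []; rewrite !mul1mx mulNmx -mulmxBr => h1 h2.
have h3 : f - e = 0 by rewrite -[LHS](mulKmx port_matrix_unit) h1 mulmx0.
have fe : f = e by apply/eqP; rewrite -subr_eq0 h3.
have e0 : e = 0.
  by apply/eqP; move/eqP: h2; rewrite fe -mulr2n -scaler_nat scaler_eq0 pnatr_eq0.
by rewrite fe e0 col_mx0.
Qed.

Definition port_vector (v : 'cV[C]_(n + n)) : 'cV[C]_(n + n) :=
  (sqrtC 2)^-1 *: (port_map *m v).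

Lemma port_vector_surj w : exists v, port_vector v = w.
Proof.
exists (sqrtC 2 *: (invmx port_map *m w)).
rewrite /port_vector -scalemxAr mulKVmx ?port_map_unit// scalerA mulVf ?scale1r//.
by rewrite sqrtC_eq0 pnatr_eq0.
Qed.

Lemma csq_sqrt2V : csq ((sqrtC (2 : C))^-1) = 2^-1.
Proof.
have h2 : csq (sqrtC (2 : C)) * csq (sqrtC (2 : C)) = 4.
  rewrite -csqM -expr2 sqrtCK (_ : 2 = (2 : R)%:C); last by rewrite rmorph_nat.
  by rewrite csq_real; ring.
have h0 : 0 <= csq (sqrtC (2 : C)) := csq_ge0 _.
have h : csq (sqrtC (2 : C)) = 2 by nra.
have : csq (sqrtC (2 : C) * (sqrtC (2 : C))^-1) = 1.
  by rewrite mulfV ?sqrtC_eq0 ?pnatr_eq0// /csq /= expr1n expr0n addr0.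
by rewrite csqM h; lra.
Qed.

Lemma port_form (Y1 Y0 : 'cV[C]_n) :
  Re (sesq (swap_mx R n) (port_vector (col_mx Y1 Y0)) (port_vector (col_mx Y1 Y0))) =
  Re (sesq Q Y1 Y1) - Re (sesq Q Y0 Y0).
Proof.
rewrite /port_vector sesqZ -/(csq _) csq_sqrt2V /port_map mul_block_col !mul1mx mulNmx.
rewrite -mulmxBr swap_form rdot_adj port_matrix_sym /rdot /sesq mulmx1.
have -> : ((Y1 - Y0) ^t* *m (Q *m (Y1 + Y0))) 0 0 = sesq Q (Y1 - Y0) (Y1 + Y0).
  by rewrite /sesq mulmxA.
rewrite -!/(sesq _ _ _) !(sesqDl, sesqDr) !(sesqNl, sesqNr).
have -> : sesq Q Y0 Y1 = (sesq Q Y1 Y0)^* by rewrite sesqJ port_matrix_sym.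
case: (sesq Q Y1 Y1) (sesq Q Y1 Y0) (sesq Q Y0 Y0) => [a b] [a1 b1] [a2 b2] /=.
lra.
Qed.

End port_algebra.

Section green.
Variables (R : realType) (d : nat).
Notation mu := (@lebesgue_measure R).
Notation I := (@I01 R).
Notation C := R[i].
Local Notation Re := (@complex.Re R).
Local Notation L2f := (@square_integrable R d).
Implicit Types u v : R -> 'cV[C]_d.

Lemma cintegrableJ (h : R -> C) : cintegrable h -> cintegrable (fun z => (h z)^*).
Proof.
move=> [h1 h2]; split; [apply: eq_L1 h1|apply: eq_L1 (L1N h2)] => z; by case: (h z).
Qed.

Lemma volJ (h : R -> C) t : cintegrable h -> vol (fun z => (h z)^*) t = (vol h t)^*.
Proof.
move=> hi; rewrite -cintegralJ; last exact: cintegrable_below.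
by apply: eq_cintegral => z _; case: ifP => // _; rewrite conjc0.
Qed.

Lemma scalar_parts (p p' q q' : R -> C) : L2s p' -> L2s q' ->
  (forall z, p z = p 0 + vol p' z) -> (forall z, q z = q 0 + vol q' z) ->
  cintegral (fun z => p z * q' z) + cintegral (fun z => p' z * q z) =
  p 1 * q 1 - p 0 * q 0.
Proof.
move=> p'L q'L pE qE.
have i1 := L2s_cintegrable p'L; have i2 := L2s_cintegrable q'L.
rewrite (eq_cintegral (g := fun z => p 0 * q' z + vol p' z * q' z)); last first.
  by move=> z _; rewrite [p z]pE mulrDl.
rewrite (eq_cintegral (f := fun z => p' z * q z)
  (g := fun z => q 0 * p' z + p' z * vol q' z)); last first.
  by move=> z _; rewrite [q z]qE mulrDr mulrC.
rewrite !cintegralD ?cintegralZ //; try exact: cintegrableZ.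
- rewrite [p 1]pE [q 1]qE !vol_ge1//.
  have := volterra_by_parts p'L q'L.
  move: (cintegral (fun z => p' z * vol q' z)) (cintegral (fun z => vol p' z * q' z)).
  move: (p 0) (q 0) (cintegral p') (cintegral q') => a b c e x y h.
  transitivity (a * e + b * c + (x + y)); first by ring.
  by rewrite h; ring.
- by apply: L2sM_integrable => //; exact: vol_L2s.
- by apply: L2sM_integrable => //; exact: vol_L2s.
Qed.

Definition primitive u u' := [/\ u \in L2f, u' \in L2f &
  forall i z, u z i 0 = u 0 i 0 + vol (fun s => u' s i 0) z].

Lemma sesq_cst_integrable (M : 'M[C]_d) u v : u \in L2f -> v \in L2f ->
  cintegrable (fun z => sesq M (u z) (v z)).
Proof. by move=> uL vL; exact: (@sesq_integrable _ _ (fun=> M) _ _ (multiplier_cst M) uL vL). Qed.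

Lemma sesq_parts (M : 'M[C]_d) u u' v v' : primitive u u' -> primitive v v' ->
  cintegral (fun z => sesq M (u z) (v' z)) + cintegral (fun z => sesq M (u' z) (v z)) =
  sesq M (u 1) (v 1) - sesq M (u 0) (v 0).
Proof.
move=> [/square_integrableP uL /square_integrableP uL' uE].
move=> [/square_integrableP vL /square_integrableP vL' vE].
have E (w w' : R -> 'cV[C]_d) : (forall i, L2s (fun z => w z i 0)) ->
    (forall i, L2s (fun z => w' z i 0)) ->
    cintegral (fun z => sesq M (w z) (w' z)) =
    \sum_i \sum_j cintegral (fun z => (w z i 0)^* * (M i j * w' z j 0)).
  move=> wL wL'; rewrite (eq_cintegral (g := fun z =>
    \sum_i \sum_j (w z i 0)^* * (M i j * w' z j 0))); last first.
    move=> z _; rewrite sesqE; apply: eq_bigr => i _; apply: eq_bigr => j _.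
    by rewrite mulrA.
  have h i j : cintegrable (fun z => (w z i 0)^* * (M i j * w' z j 0)).
    by apply: L2sM_integrable; [exact: L2sJ|exact: L2sZ].
  rewrite cintegral_sum; last by move=> i; apply: cintegrable_sum.
  by apply: eq_bigr => i _; rewrite cintegral_sum.
rewrite !E// !sesqE -sumrB -big_split; apply: eq_bigr => i _.
rewrite -sumrB -big_split; apply: eq_bigr => j _.
rewrite -!mulrA -(@scalar_parts (fun z => (u z i 0)^*) (fun z => (u' z i 0)^*)
  (fun z => M i j * v z j 0) (fun z => M i j * v' z j 0)) //.
- exact: L2sJ.
- exact: L2sZ.
- move=> z /=; rewrite volJ; last exact: L2s_cintegrable.
  by rewrite -rmorphD -uE.
- move=> z /=; rewrite volZ; last exact: L2s_cintegrable.
  by rewrite -mulrDr -vE.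
Qed.

Lemma chain_primitive N (Y : nat -> R -> 'cV[C]_d) k : sobolev_chain N Y -> (k < N)%N ->
  primitive (Y k) (Y k.+1).
Proof. by move=> [YL YV] kN; split; [exact: YL (ltnW kN)|exact: YL|exact: YV]. Qed.

Variables (N : nat) (Y : nat -> R -> 'cV[C]_d).
Hypothesis YN : sobolev_chain N Y.

Let jump M a b := sesq M (Y a 1) (Y b 1) - sesq M (Y a 0) (Y b 0) : C.
Let form M a b := cintegral (fun z => sesq M (Y a z) (Y b z)).

Let form_step M a b : (a < N)%N -> (b < N)%N ->
  form M a b.+1 = jump M a b - form M a.+1 b.
Proof.
move=> aN bN; apply/eqP; rewrite -subr_eq opprK; apply/eqP.
exact: sesq_parts (chain_primitive YN aN) (chain_primitive YN bN).
Qed.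

Let form_iter M k l : (k <= N)%N -> (l <= k)%N -> form M 0 k =
  \sum_(j < l) (-1) ^+ j * jump M j (k - j.+1)%N + (-1) ^+ l * form M l (k - l)%N.
Proof.
move=> kN; elim: l => [_|l IH lk]; first by rewrite big_ord0 add0r expr0 mul1r subn0.
rewrite (IH (ltnW lk)) big_ord_recr /= -addrA; congr (_ + _).
rewrite (_ : (k - l)%N = (k - l.+1).+1); last by lia.
rewrite form_step ?mulrBr ?exprS ?mulN1r ?mulNr//; lia.
Qed.

Lemma chain_in k : (k <= N)%N -> Y k \in L2f.
Proof. by case: YN => + _; apply. Qed.

Lemma symmetric_form k (M : 'M[C]_d) : (1 <= k <= N)%N -> M ^t* = (-1) ^+ k.-1 *: M ->
  2 * Re (form M 0 k) = Re (\sum_(j < k) (-1) ^+ j * jump M j (k - j.+1)%N).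
Proof.
move=> /andP[k1 kN] Msym.
have h : (-1) ^+ k * form M k 0 = - conjc (form M 0 k).
  rewrite /form -cintegralJ; last by apply: sesq_cst_integrable; rewrite chain_in.
  have iL a b : (a <= N)%N -> (b <= N)%N -> cintegrable (fun z => sesq M (Y a z) (Y b z)).
    by move=> aN bN; apply: sesq_cst_integrable; rewrite chain_in.
  rewrite -cintegralZ; last exact: iL.
  rewrite -cintegralN; last by apply: cintegrableJ; exact: iL.
  apply: eq_cintegral => z _; rewrite sesqJ Msym sesqZA -mulNr; congr (_ * _).
  by case: k k1 {kN Msym} => // k _; rewrite exprS mulN1r.
have := @form_iter M k k kN (leqnn k); rewrite subnn h => /(congr1 Re).
rewrite raddfD /= => e.
have : Re (- conjc (form M 0 k)) = - Re (form M 0 k) by case: (form M 0 k).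
by move: e; move: (Re (\sum_(j < k) _)) (Re (- _)) (Re (form M 0 k)) => a b c; lra.
Qed.

Lemma triangular_sum (F : nat -> nat -> C) n :
  \sum_(k < n) \sum_(j < k.+1) F j (k - j)%N =
  \sum_(i < n) \sum_(j < n) if (i + j < n)%N then F i j else 0.
Proof.
transitivity (\sum_(k < n) \sum_(j < n | (j <= k)%N) F j (k - j)%N).
  apply: eq_bigr => k _.
  by rewrite (big_ord_widen n (fun j => F j (k - j)%N) (ltn_ord k)).
rewrite (exchange_big_dep predT)//=; apply: eq_bigr => i _.
rewrite -big_mkcond /=.
have -> : \sum_(j < n | (i + j < n)%N) F i j = \sum_(j < n - i) F i j.
  by rewrite (big_ord_widen n (F i) (leq_subr _ _)); apply: eq_bigl => j; lia.
rewrite -(big_mkord (fun k => (i <= k)%N) (fun k => F i (k - i)%N)).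
rewrite (big_cat_nat (n := i))//=; last exact: ltnW.
rewrite [X in X + _]big_nat_cond [X in X + _]big1 ?add0r; last first.
  by move=> k; lia.
rewrite -{1}[nat_of_ord i]add0n big_addn big_mkord; apply: eq_big => k.
  by rewrite leq_addl.
by rewrite addnK.
Qed.

Variable P : nat -> 'M[C]_d.
Hypothesis P_sym : forall k : nat, (1 <= k <= N)%N ->
  (P k) ^t* = (-1) ^+ k.-1 *: P k.
Local Notation Q := (port_matrix N P).

Lemma green_identity :
  2 * Re (\sum_(k < N.+1) cintegral (fun z => sesq (P k) (Y 0%N z) (Y k z))) =
  Re (sesq Q (\mxcol_(k < N) Y k 1) (\mxcol_(k < N) Y k 1)) -
  Re (sesq Q (\mxcol_(k < N) Y k 0) (\mxcol_(k < N) Y k 0)) +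
  2 * Re (cintegral (fun z => sesq (P 0%N) (Y 0%N z) (Y 0%N z))).
Proof.
rewrite big_ord_recl raddfD mulrDr /= addrC; congr (_ + _).
rewrite !sesq_port // raddf_sum mulr_sumr /=.
pose F x i j := (-1) ^+ i * sesq (P (i + j).+1) (Y i x) (Y j x) : C.
have FE x : \sum_(i < N) \sum_(j < N) sesq (port_block N P i j) (Y i x) (Y j x) =
    \sum_(k < N) \sum_(j < k.+1) F x j (k - j)%N.
  rewrite triangular_sum; apply: eq_bigr => i _; apply: eq_bigr => j _.
  rewrite /port_block; case: ifP => _; first by rewrite sesqZA.
  by rewrite /sesq mulmx0 mul0mx mxE.
rewrite !FE -raddfB -sumrB raddf_sum; apply: eq_bigr => k _.
have kN : (1 <= k.+1 <= N)%N by rewrite ltn_ord.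
rewrite (symmetric_form kN (P_sym kN)).
congr Re; rewrite -sumrB; apply: eq_bigr => j _.
by rewrite subSS /F /jump mulrBr subnKC// -ltnS.
Qed.

End green.

Section density_inverse.
Variables (R : realType) (d : nat).
Notation mu := (@lebesgue_measure R).
Notation I := (@I01 R).
Notation C := R[i].
Local Notation Re := (@complex.Re R).
Local Notation Im := (@complex.Im R).

Lemma cmeasurable_bigsum (J : Type) (s : seq J) (F : J -> R -> C) :
  (forall j, cmeasurable (F j)) -> cmeasurable (fun z => \sum_(j <- s) F j z).
Proof.
move=> mF; elim: s => [|j s IH].
  rewrite (_ : (fun _ => _) = (fun=> 0)); first exact: cmeasurable_cst.
  by apply/funext => z; rewrite big_nil.
rewrite (_ : (fun _ => _) = (fun z => F j z + \sum_(j <- s) F j z)).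
  exact: cmeasurableD.
by apply/funext => z; rewrite big_cons.
Qed.

Lemma cmeasurable_bigprod (J : Type) (s : seq J) (F : J -> R -> C) :
  (forall j, cmeasurable (F j)) -> cmeasurable (fun z => \prod_(j <- s) F j z).
Proof.
move=> mF; elim: s => [|j s IH].
  rewrite (_ : (fun _ => _) = (fun=> 1)); first exact: cmeasurable_cst.
  by apply/funext => z; rewrite big_nil.
rewrite (_ : (fun _ => _) = (fun z => F j z * \prod_(j <- s) F j z)).
  exact: cmeasurableM.
by apply/funext => z; rewrite big_cons.
Qed.

Lemma cmeasurable_det n (A : R -> 'M[C]_n) :
  (forall i j, cmeasurable (fun z => A z i j)) -> cmeasurable (fun z => \det (A z)).
Proof.
move=> mA; rewrite /determinant; apply: cmeasurable_bigsum => s.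
by apply: cmeasurableM; [exact: cmeasurable_cst | apply: cmeasurable_bigprod].
Qed.

Lemma cmeasurableV (f : R -> C) : cmeasurable f -> cmeasurable (fun z => (f z)^-1).
Proof.
move=> mf; have mq := measurable_csq mf.
have mi : cmeasurable (fun z => ((csq (f z))^-1)%:C).
  split; last exact: measurable_cst.
  rewrite (_ : (fun _ => _) = (fun z => csq (f z) `^ (-1))).
    exact: (measurableT_comp (measurable_powR (-1)) mq).
  by apply/funext => z; rewrite powR_inv1// csq_ge0.
rewrite (_ : (fun _ => _) = (fun z => conjc (f z) * ((csq (f z))^-1)%:C)).
  by apply: cmeasurableM => //; exact: cmeasurableJ.
apply/funext => z; case: (f z) => a b.
rewrite {1}/GRing.inv /= /csq /=; simpc; apply/eqP; rewrite eq_complex /=.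
by apply/andP; split; apply/eqP; ring.
Qed.

Definition cramer_inverse (A : 'M[C]_d) : 'M[C]_d := (\det A)^-1 *: \adj A.

Lemma cramer_inverseE A : A \in unitmx -> cramer_inverse A = invmx A.
Proof. by rewrite /invmx => ->. Qed.

Variables (H : R -> 'M[C]_d) (hH : energy_density H).

Lemma coercive_entry (A : 'M[C]_d) (m : R) : 0 < m ->
  (forall u : 'cV[C]_d, m * sqnorm u <= Re (sesq A u u)) ->
  A \in unitmx /\ forall i j, csq (invmx A i j) <= (m ^+ 2)^-1.
Proof.
move=> m0 hA; have Au : A \in unitmx.
  apply: unitmx_of_inj => u Au0; apply: sqnorm_le0.
  rewrite -(pmulr_rle0 _ m0); apply: le_trans (hA u) _.
  by rewrite /sesq -mulmxA Au0 mulmx0 mxE.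
split=> // i j; set u := col j (invmx A).
have -> : invmx A i j = u i 0 by rewrite mxE.
have Au1 : A *m u = delta_mx j 0 by rewrite /u colE mulmxA mulmxV// mul1mx.
have e : sesq A u u = conjc (u j 0).
  rewrite sesq_dot Au1 (bigD1 j)//= big1 ?addr0 => [|k kj].
    by rewrite !mxE !eqxx mulr1.
  by rewrite [delta_mx _ _ _ _]mxE (negbTE kj) mulr0.
have ui k : csq (u k 0) <= sqnorm u by exact: csq_le_sqnorm.
apply: le_trans (ui i) _.
have := hA u; rewrite e => h.
have r : Re (conjc (u j 0)) ^+ 2 <= sqnorm u.
  by apply: le_trans (ui j); case: (u j 0) => a b; rewrite /csq /= lerDl sqr_ge0.
move: h r (sqnorm_ge0 u); move: (sqnorm u) (Re _) => s t h r s0.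
have m2 : 0 < m ^+ 2 by rewrite exprn_gt0.
rewrite -(ler_pM2l m2) mulfV ?gt_eqF//.
have [->|s1] := eqVneq s 0; first by rewrite mulr0.
have s2 : 0 < s by rewrite lt_neqAle eq_sym s1.
have h2 : (m * s) ^+ 2 <= s.
  apply: le_trans r; rewrite ler_sqr// ?nnegrE; first by rewrite mulr_ge0 ?ltW.
  by apply: le_trans h; rewrite mulr_ge0 ?ltW.
by rewrite -(ler_pM2r s2) mul1r; apply: le_trans h2; rewrite exprMn (expr2 s) mulrA.
Qed.

Lemma density_inverse_multiplier : bounded_multiplier (fun z => cramer_inverse (H z)).
Proof.
have [mH [m0 [M0 [m0_gt0 mM hM]]]] := hH; split=> [i j|].
  have -> : (fun z => cramer_inverse (H z) i j) =
      (fun z => (\det (H z))^-1 * \adj (H z) i j).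
    by apply/funext => z; rewrite mxE.
  apply: cmeasurableM; first by apply: cmeasurableV; exact: cmeasurable_det.
  have -> : (fun z => \adj (H z) i j) =
      (fun z => (-1) ^+ (j + i) * \det (row' j (col' i (H z)))).
    by apply/funext => z; rewrite mxE.
  apply: cmeasurableM; first exact: cmeasurable_cst.
  apply: cmeasurable_det => a b.
  by rewrite (_ : (fun _ => _) = (fun z => H z (lift j a) (lift i b)))//;
    apply/funext => z; rewrite !mxE.
exists (m0 ^+ 2)^-1; apply: filterS hM => z /[swap] zI /(_ zI) [_ hz] i j.
have [|uH] := @coercive_entry (H z) m0 m0_gt0; first by move=> u; case/andP: (hz u).
by rewrite cramer_inverseE.
Qed.

Lemma density_inverseK : {ae mu, forall z, I z -> H z *m cramer_inverse (H z) = 1%:M /\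
  cramer_inverse (H z) *m H z = 1%:M}.
Proof.
have [mH [m0 [M0 [m0_gt0 mM hM]]]] := hH.
apply: filterS hM => z /[swap] zI /(_ zI) [_ hz].
have [|uH _] := @coercive_entry (H z) m0 m0_gt0; first by move=> u; case/andP: (hz u).
by rewrite cramer_inverseE// mulmxV// mulVmx.
Qed.

End density_inverse.

Section chains.
Variables (R : realType) (d : nat).
Notation mu := (@lebesgue_measure R).
Notation I := (@I01 R).
Notation C := R[i].
Local Notation Re := (@complex.Re R).
Local Notation Im := (@complex.Im R).
Local Notation L2f := (@square_integrable R d).
Variables (H : R -> 'M[C]_d) (hH : energy_density H).
Local Notation X := (energy_space hH).
Variables (N : nat) (P : nat -> 'M[C]_d).
Local Notation n := (blockdim N d).
Local Notation A0 := (maximal_operator N P hH).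
Local Notation ip := (energy_ip hH).

Lemma density_mul_in (x : X) : density_mul x \in L2f.
Proof. by apply: (density_mul_L2 hH); exact: L2_repr_L2. Qed.

Definition chain_of (x : X) (Y : nat -> R -> 'cV[C]_d) :=
  sobolev_chain N Y /\ {ae mu, forall z, I z -> density_mul x z = Y 0%N z}.

Lemma domain_chainP (x : X) : domain A0 x <-> exists Y, chain_of x Y.
Proof.
split=> [/sobolev_chainP [_ [Y [YN Yx]]]|[Y [YN Yx]]]; first by exists Y.
by apply/sobolev_chainP; split; [exact: density_mul_in|exists Y].
Qed.

Lemma L2_ext (x y : X) : {ae mu, forall z, I z -> L2_repr x z = L2_repr y z} -> x = y.
Proof.
move=> xy; apply/eqP; rewrite -subr_eq0; apply/eqP/L2_repr_eq0.
by apply: filterS2 xy (L2_reprB x y) => z xy h zI; rewrite (h zI) (xy zI) subrr.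
Qed.

Lemma L2_reprZD a (x y : X) :
  {ae mu, forall z, I z -> L2_repr (a *: x + y) z = a *: L2_repr x z + L2_repr y z}.
Proof.
apply: filterS2 (L2_reprD (a *: x) y) (L2_reprZ a x) => z h1 h2 zI.
by rewrite (h1 zI) (h2 zI).
Qed.

Lemma L2_eq_linear a (w x y : X) (f g : R -> 'cV[C]_d) :
  {ae mu, forall z, I z -> L2_repr x z = f z} ->
  {ae mu, forall z, I z -> L2_repr y z = g z} ->
  {ae mu, forall z, I z -> L2_repr w z = a *: f z + g z} -> w = a *: x + y.
Proof.
move=> xf yg wfg; apply: L2_ext.
have h : {ae mu, forall z, I z -> a *: f z + g z = a *: L2_repr x z + L2_repr y z}.
  by apply: filterS2 xf yg => z xf yg zI; rewrite (xf zI) (yg zI).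
apply: filterS3 wfg h (L2_reprZD a x y) => z wfg h e zI.
by rewrite (wfg zI) (h zI) (e zI).
Qed.

Lemma chain_linear (Y Y' : nat -> R -> 'cV[C]_d) (a : C) :
  sobolev_chain N Y -> sobolev_chain N Y' ->
  sobolev_chain N (fun k z => a *: Y k z + Y' k z).
Proof.
move=> [YL YV] [YL' YV']; split=> k kN.
  exact: (rpredD (rpredZ _ (YL _ kN)) (YL' _ kN)).
move=> i z; have /square_integrableP/(_ i)/L2s_cintegrable h := YL _ kN.
have /square_integrableP/(_ i)/L2s_cintegrable h' := YL' _ kN.
under [X in _ = _ + X]eq_cintegral do rewrite !mxE.
rewrite !mxE -/(vol _ _) volD ?volZ//; last exact: cintegrableZ.
by rewrite [in LHS]YV// [in LHS]YV'// mulrDr addrACA.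
Qed.

Lemma chain_of_linear (x x' : X) Y Y' (a : C) : chain_of x Y -> chain_of x' Y' ->
  chain_of (a *: x + x') (fun k z => a *: Y k z + Y' k z).
Proof.
move=> [YN xY] [YN' xY']; split; first exact: chain_linear.
apply: filterS3 xY xY' (L2_reprZD a x x') => z xY xY' h zI.
by rewrite /density_mul (h zI) mulmxDr -scalemxAr [_ *m _](xY zI) [X in _ + X](xY' zI).
Qed.

Section one_chain.
Variables (x : X) (Y : nat -> R -> 'cV[C]_d).
Hypothesis xY : chain_of x Y.

Let YN : sobolev_chain N Y. Proof. by case: xY. Qed.
Let hw k (kN : (k <= N)%N) := weak_derivative_chain YN (density_mul_in x) (proj2 xY) kN.

Lemma chain_action_L2 : (fun z => \sum_(k < N.+1) P k *m Y k z) \in L2f.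
Proof.
rewrite (_ : (fun _ => _) = \sum_(k < N.+1) (fun z => P k *m Y k z)); last first.
  by apply/funext => z; rewrite fct_sumE.
apply: rpred_sum => k _; apply: mulmx_L2; first exact: multiplier_cst.
by apply: (chain_in YN); rewrite -ltnS.
Qed.

Lemma action_chain : {ae mu, forall z, I z ->
  L2_repr (A0 x) z = \sum_(k < N.+1) P k *m Y k z}.
Proof.
have wL : (fun z => \sum_(k < N.+1) P k *m weak_derivative k (density_mul x) z) \in L2f.
  rewrite (_ : (fun _ => _) =
    \sum_(k < N.+1) (fun z => P k *m weak_derivative k (density_mul x) z)); last first.
    by apply/funext => z; rewrite fct_sumE.
  apply: rpred_sum => k _; apply: mulmx_L2; first exact: multiplier_cst.
  by case: (hw (ltn_ord k : (k <= N)%N)).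
have ae_w : {ae mu, forall z, I z -> forall k : 'I_N.+1,
    weak_derivative k (density_mul x) z = Y k z}.
  have h : {ae mu, forall z, forall k : 'I_N.+1, I z ->
      weak_derivative k (density_mul x) z = Y k z}.
    apply: (filter_forall (F := almost_everywhere mu)) => k.
    by case: (hw (ltn_ord k : (k <= N)%N)).
  by apply: filterS h => z h zI k; exact: h.
apply: filterS2 (L2_class_repr wL) ae_w => z h1 h2 zI.
by rewrite [LHS](h1 zI); apply: eq_bigr => k _; rewrite (h2 zI).
Qed.

Lemma boundary_port_chain : boundary_port N P (density_mul x) =
  port_vector P (col_mx (\mxcol_(k < N) Y k 1) (\mxcol_(k < N) Y k 0)).
Proof.
rewrite /boundary_port /port_vector /boundary_trace; congr (_ *: (_ *m col_mx _ _));
  apply: eq_mxcol => k; apply: (trace_chain YN (density_mul_in x) (proj2 xY)) => //.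
- by rewrite ler01 lexx.
- by rewrite ler01 lexx.
Qed.

Hypothesis P_sym : forall k : nat, (1 <= k <= N)%N ->
  (P k) ^t* = (-1) ^+ k.-1 *: P k.

Lemma dissipation_identity :
  2 * Re (ip (A0 x) x) =
  Re (sesq (swap_mx R n) (boundary_port N P (density_mul x))
    (boundary_port N P (density_mul x))) +
  2 * rint (fun z => Re (sesq (P 0%N) (Y 0%N z) (Y 0%N z))).
Proof.
rewrite boundary_port_chain port_form// -[rint _]/(Re (cintegral _)).
rewrite -(green_identity YN P_sym); congr (_ * _).
have Y0L : Y 0%N \in L2f by exact: (chain_in YN).
have sL k : (k <= N)%N -> cintegrable (fun z => sesq (P k) (Y 0%N z) (Y k z)).
  by move=> kN; apply: sesq_cst_integrable => //; exact: (chain_in YN).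
rewrite (eq_bigr (fun k : 'I_N.+1 => cintegral (fun z => sesq (P k) (Y 0%N z) (Y k z))))//.
rewrite -[RHS]/(Re _) raddf_sum /= -rint_sum; last first.
  by move=> k; case: (sL k (ltn_ord k : (k <= N)%N)).
apply: rint_ae.
- by apply: L1_measurable; case: (ip_integrable (A0 x) x).
- apply: L1_measurable; apply: L1_sum => k.
  by case: (sL k (ltn_ord k : (k <= N)%N)).
apply: filterS2 action_chain (proj2 xY) => z h1 h2 zI.
have -> : sesq (H z) (L2_repr (A0 x) z) (L2_repr x z) =
    sesq 1%:M (L2_repr (A0 x) z) (density_mul x z).
  by rewrite /sesq mulmx1 mulmxA.
rewrite (h1 zI) (h2 zI) -/(rdot _ _) rdotC /rdot /sesq mulmx1 mulmx_sumr summxE raddf_sum.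
by apply: eq_bigr => k _; rewrite mulmxA.
Qed.

End one_chain.

Lemma maximal_linear a (x x' : X) : domain A0 x -> domain A0 x' ->
  domain A0 (a *: x + x') /\ A0 (a *: x + x') = a *: A0 x + A0 x'.
Proof.
move=> /domain_chainP [Y xY] /domain_chainP [Y' xY'].
have h := chain_of_linear a xY xY'; split; first by apply/domain_chainP; eexists; exact: h.
apply: L2_eq_linear (action_chain xY) (action_chain xY') _.
apply: filterS (action_chain h) => z hz zI; rewrite (hz zI) scaler_sumr -big_split.
by apply: eq_bigr => k _; rewrite mulmxDr -scalemxAr.
Qed.

End chains.

Section hermite.
Variable R : realType.
Implicit Types p q : {poly R}.

Lemma derivn_power_root (c : R) m j q : (j <= m)%N ->
  (((('X - c%:P) ^+ m * q)^`(j)).[c])%R = if j == m then m`!%:R * q.[c] else 0.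
Proof.
elim: j m q => [|j IH] [|m] q //.
- by rewrite derivn0 expr0 mul1r fact0 mul1r.
- by rewrite derivn0 hornerM horner_exp hornerXsubC subrr expr0n mul0r.
move=> jm; have -> : (('X - c%:P) ^+ m.+1 * q)^`(j.+1) =
    (('X - c%:P) ^+ m * (m.+1%:R *: q + ('X - c%:P) * q^`()))^`(j).
  rewrite derivSn derivM deriv_exp derivXsubC; congr (_^`(j)).
  rewrite /= mul1r exprS -scaler_nat -scalerAl mulrDr -scalerAr mulrCA; congr (_ + _).
  by rewrite mulrCA -mulrA mulrCA.
rewrite IH// eqSS; case: eqP => // _.
by rewrite hornerD hornerZ hornerM hornerXsubC subrr mul0r addr0 mulrA factS natrM (mulrC m.+1%:R).
Qed.

Lemma hermite_interpolation n (a b : nat -> R) : exists p, forall j, (j < n)%N ->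
  p^`(j).[0] = a j /\ p^`(j).[1] = b j.
Proof.
elim: n => [|n [p hp]]; first by exists 0.
pose u : {poly R} := ('X - 0%:P) ^+ n; pose v : {poly R} := ('X - 1%:P) ^+ n.
pose al := (a n - p^`(n).[0]) / (n`!%:R * (v * ('X - 1%:P)).[0]).
pose be := (b n - p^`(n).[1]) / (n`!%:R * (u * 'X).[1]).
exists (p + al *: (u * (v * ('X - 1%:P))) + be *: (v * (u * 'X))) => j.
rewrite ltnS => jn; rewrite !derivnD !derivnZ !hornerD !hornerZ.
have f0 : n`!%:R != 0 :> R by rewrite pnatr_eq0 -lt0n fact_gt0.
have e1 : (u * (v * ('X - 1%:P)))^`(j).[1] = 0.
  rewrite (_ : u * _ = v * (u * ('X - 1%:P))); last by rewrite mulrCA.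
  rewrite derivn_power_root//; case: eqP => // _.
  by rewrite hornerM hornerXsubC subrr !mulr0.
have e2 : (v * (u * 'X))^`(j).[0] = 0.
  rewrite mulrCA derivn_power_root//; case: eqP => // _.
  by rewrite !hornerM hornerX !mulr0.
rewrite e1 e2 !derivn_power_root// !mulr0 !addr0.
have [->|jn'] := eqVneq j n.
  rewrite !divfK; first by rewrite addrC subrK addrC subrK.
    rewrite mulf_neq0// hornerM hornerX mulr1 horner_exp hornerXsubC subr0.
    by rewrite expr1n oner_eq0.
  rewrite mulf_neq0// hornerM horner_exp hornerXsubC mulf_neq0 ?expf_neq0//;
  by rewrite sub0r oppr_eq0 oner_eq0.
by rewrite !mulr0 !addr0; apply: hp; rewrite ltn_neqAle jn'.
Qed.

End hermite.

Section smooth_chains.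
Variables (R : realType) (d : nat).
Notation mu := (@lebesgue_measure R).
Notation I := (@I01 R).
Notation C := R[i].
Local Notation Re := (@complex.Re R).
Local Notation L2f := (@square_integrable R d).

Definition clamp (z : R) : R := Num.max 0 (Num.min 1 z).

Lemma clamp_itv z : 0 <= clamp z <= 1.
Proof. by rewrite /clamp le_max lexx ge_max ler01 ge_min lexx. Qed.

Lemma clamp_id z : 0 <= z <= 1 -> clamp z = z.
Proof. by move=> /andP[z0 z1]; rewrite /clamp (min_idPr z1) (max_idPr z0). Qed.

Lemma clamp_I01 z : I z -> clamp z = z.
Proof. by rewrite /I01/= in_itv/= => /andP[/ltW z0 /ltW z1]; rewrite clamp_id ?z0. Qed.

Lemma vol_clamp (h : R -> C) z : vol h (clamp z) = vol h z.
Proof.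
have [z0|z0] := leP z 0.
  have -> : clamp z = 0 by rewrite /clamp (min_idPr (le_trans z0 ler01)) (max_idPl z0).
  by rewrite !vol_le0.
have [z1|z1] := leP 1 z; last by rewrite clamp_id// !ltW.
have -> : clamp z = 1 by rewrite /clamp (min_idPl z1) (max_idPr ler01).
by rewrite !vol_ge1.
Qed.

Definition smooth_family (phi : R -> R) (u : 'cV[C]_d) (k : nat) (z : R) : 'cV[C]_d :=
  (derive1n k phi (clamp z))%:C *: u.

Lemma smooth_chain N phi u : smooth phi -> sobolev_chain N (smooth_family phi u).
Proof.
move=> sphi.
have sL k : L2s (fun z => (derive1n k phi (clamp z))%:C).
  have cL := continuous_L2s (smooth_continuous (@smooth_derive1n _ phi k sphi)).
  apply: (@L2s_ae _ _ (fun z => (derive1n k phi z)%:C)) (cL) _.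
    have [m1 m2] := cL.1; split; last exact: measurable_cst.
    apply: eq_measurable_fun m1 => z; rewrite inE => zI /=.
    by rewrite clamp_I01.
  by apply: nearW => z zI; rewrite clamp_I01.
split=> k kN.
  apply/square_integrableP => i.
  apply: eq_L2s (L2sZ (u i 0) (sL k)) => z; rewrite mxE mulrC; done.
move=> i z; rewrite -vol_clamp !mxE.
have -> : vol (fun s => smooth_family phi u k.+1 s i 0) (clamp z) =
    u i 0 * vol (fun s => (derive1n k.+1 phi s)%:C) (clamp z).
  rewrite -volZ; last exact: L2s_cintegrable (continuous_L2s
    (smooth_continuous (@smooth_derive1n _ phi k.+1 sphi))).
  by apply: eq_cintegral => s sI; rewrite !mxE (clamp_I01 sI) [_ * u i 0]mulrC.
have -> : clamp 0 = 0 by rewrite clamp_id// lexx ler01.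
rewrite [u i 0 * _]mulrC -mulrDl; congr (_ * _).
rewrite volE/=; apply/eqP; rewrite eq_complex /=; apply/andP; split; apply/eqP.
  apply: (@unit_ftc _ (derive1n k phi) (derive1n k.+1 phi)) (clamp_itv z) => [t|].
    by rewrite derive1nS; exact: smooth_is_derive (@smooth_derive1n _ phi k sphi).
  exact: smooth_continuous (@smooth_derive1n _ phi k.+1 sphi).
rewrite add0r -[LHS](rint_cst 0); apply: rint_eq => s _.
by case: ifP.
Qed.

Lemma chain_sum N (J : Type) (s : seq J) (Y : J -> nat -> R -> 'cV[C]_d) :
  (forall j, sobolev_chain N (Y j)) ->
  sobolev_chain N (fun k z => \sum_(j <- s) Y j k z).
Proof.
move=> YN; elim: s => [|j s IH].
  have h := smooth_chain N (0 : 'cV[C]_d) (@smooth_bump R 0 0 0).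
  rewrite (_ : (fun _ _ => _) = smooth_family (ebump 0 0 0) 0)//.
  by apply/funext => k; apply/funext => z; rewrite big_nil /smooth_family scaler0.
rewrite (_ : (fun _ _ => _) = (fun k z => 1 *: Y j k z + \sum_(i <- s) Y i k z)).
  exact: chain_linear.
by apply/funext => k; apply/funext => z; rewrite big_cons scale1r.
Qed.

Lemma derive1n_poly (p : {poly R}) k : derive1n k (horner p) = horner p^`(k).
Proof.
elim: k => [|k IH]; first by rewrite derivn0.
rewrite derive1nS IH derivnS; apply/funext => t; rewrite derive1E.
by have [_ ->] := is_derive_poly p^`(k) t.
Qed.

Lemma smooth_poly (p : {poly R}) : smooth (horner p).
Proof.
by move=> k t; rewrite derive1n_poly; have [] := is_derive_poly p^`(k) t.
Qed.

Lemma derive1n_bump_flat (w : {poly R}) m p k t : w.[t] <= 0 ->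
  derive1n k (ebump w m p) t = 0.
Proof.
move=> wt; elim: k m p => [|k IH] m p; last by rewrite derive1Sn derive1_bump IH.
by rewrite derive1n0 /ebump ltNge wt.
Qed.

Definition boundary_layer (w p : {poly R}) (t : R) : R := p.[t] + -1 * ebump w 0 p t.

Lemma boundary_layerE w p t : boundary_layer w p t = p.[t] * (1 - ebump w 0 1 t).
Proof.
rewrite /boundary_layer /ebump; case: ifP => _; rewrite ?hornerC ?expr0; ring.
Qed.

Lemma smooth_boundary_layer w p : smooth (boundary_layer w p).
Proof. by apply: smooth_linear; [exact: smooth_poly|exact: smooth_bump]. Qed.

Lemma boundary_layer_jet w p k t : w.[t] <= 0 ->
  derive1n k (boundary_layer w p) t = p^`(k).[t].
Proof.
move=> wt; rewrite /boundary_layer derive1n_linear.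
- by rewrite derive1n_bump_flat// mulr0 addr0 derive1n_poly.
- exact: smooth_poly.
- exact: smooth_bump.
Qed.

End smooth_chains.

Section dissipativity.
Variables (R : realType) (N d : nat).
Notation mu := (@lebesgue_measure R).
Notation I := (@I01 R).
Notation C := R[i].
Local Notation Re := (@complex.Re R).
Local Notation L2f := (@square_integrable R d).
Hypothesis N_ge1 : (1 <= N)%N.
Variable P : nat -> 'M[C]_d.
Hypothesis P_sym : forall k : nat, (1 <= k <= N)%N ->
  (P k) ^t* = (-1) ^+ k.-1 *: P k.
Hypothesis PN_unit : P N \in unitmx.
Variables (H : R -> 'M[C]_d) (hH : energy_density H).
Local Notation X := (energy_space hH).
Local Notation n := (blockdim N d).
Variable W : 'M[C]_(n, n + n).
Hypothesis W_rank : \rank W = n.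
Local Notation A := (port_operator P hH W).
Local Notation ip := (energy_ip hH).
Local Notation chain_of := (@chain_of R d H hH N).

Lemma chain_exists Y : sobolev_chain N Y -> exists x : X, chain_of x Y.
Proof.
move=> YN; pose f z := cramer_inverse (H z) *m Y 0%N z.
have fL : f \in L2f.
  by apply: mulmx_L2; [exact: density_inverse_multiplier|exact: (chain_in YN)].
exists (L2_class f); split=> //.
apply: filterS2 (L2_class_repr fL) (density_inverseK hH) => z h1 h2 zI.
by rewrite /density_mul (h1 zI) /f mulmxA (h2 zI).1 mul1mx.
Qed.

Definition chain_port (Y : nat -> R -> 'cV[C]_d) :=
  port_vector P (col_mx (\mxcol_(k < N) Y k 1) (\mxcol_(k < N) Y k 0)).

Lemma port_domainP (x : X) : domain A x <-> exists Y, chain_of x Y /\ W *m chain_port Y = 0.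
Proof.
split=> [[/domain_chainP [Y xY] Wx]|[Y [xY WY]]].
  by exists Y; split; [exact: xY|rewrite /chain_port -(boundary_port_chain P xY); exact: Wx].
split; first by apply/domain_chainP; exists Y.
by rewrite (boundary_port_chain P xY).
Qed.

Lemma chain_port_linear a Y Y' :
  chain_port (fun k z => a *: Y k z + Y' k z) = a *: chain_port Y + chain_port Y'.
Proof.
rewrite /chain_port /port_vector.
have e x : \mxcol_(k < N) (a *: Y k x + Y' k x) =
    a *: (\mxcol_(k < N) Y k x) + \mxcol_(k < N) Y' k x.
  by apply/matrixP => i j; rewrite !mxE.
by rewrite !e -add_col_mx -scale_col_mx mulmxDr -scalemxAr scalerDr !scalerA mulrC.
Qed.

Lemma port_operator_linear a (x x' : X) : domain A x -> domain A x' ->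
  domain A (a *: x + x') /\ A (a *: x + x') = a *: A x + A x'.
Proof.
move=> Ax Ax'; split; last first.
  by case: (@maximal_linear R d H hH N P a x x' Ax.1 Ax'.1).
move: Ax Ax' => /port_domainP [Y [xY WY]] /port_domainP [Y' [xY' WY']].
apply/port_domainP; eexists; split; first exact: chain_of_linear xY xY'.
by rewrite chain_port_linear mulmxDr -scalemxAr WY WY' scaler0 addr0.
Qed.

Lemma herm_form (B : 'M[C]_d) u : Re (sesq (herm_part B) u u) = Re (sesq B u u).
Proof.
rewrite /herm_part sesqZA sesqDA -(sesqJ B u u).
have -> : (2^-1 : C) = (2^-1 : R)%:C by rewrite rmorphV ?unitfE ?pnatr_eq0// rmorph_nat.
by case: (sesq B u u) => a b; simpc => /=; lra.
Qed.

Lemma herm_part_sym (B : 'M[C]_d) : (herm_part B) ^t* = herm_part B.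
Proof.
rewrite /herm_part trmxCZ trmxCD trmxCK addrC; congr (_ *: _).
by rewrite rmorphV ?unitfE ?pnatr_eq0// rmorph_nat.
Qed.

Lemma psdmx_Re m (B : 'M[C]_m) : B ^t* = B ->
  (forall u, 0 <= Re (sesq B u u)) -> psdmx B.
Proof.
move=> BB hB; split=> // u; have := sesqJ B u u; rewrite BB.
have := hB u; case: (sesq B u u) => a b /= a0 [] e.
have b0 : b = 0 by lra.
by rewrite lecE /= b0 eqxx.
Qed.

Lemma nsdmx_herm_partP (B : 'M[C]_d) :
  nsdmx (herm_part B) <-> forall u, Re (sesq B u u) <= 0.
Proof.
split=> [[_ hB] u|hB].
  have := hB u; rewrite sesqNA lecE => /andP[_].
  by rewrite -herm_form raddfN /= oppr_ge0.
apply: psdmx_Re; first by rewrite trmxCN herm_part_sym.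
by move=> u; rewrite sesqNA raddfN /= herm_form oppr_ge0.
Qed.

Lemma boundary_dissipative :
  psdmx (W *m swap_mx R n *m W ^t*) -> nsdmx (herm_part (P 0%N)) -> dissipative ip A.
Proof.
move=> /(kernel_nonpositiveP W_rank) hW /nsdmx_herm_partP hP x /port_domainP [Y [xY WY]].
have := dissipation_identity xY P_sym.
have h1 : Re (sesq (swap_mx R n) (boundary_port N P (density_mul x))
    (boundary_port N P (density_mul x))) <= 0.
  by apply: hW; rewrite (boundary_port_chain P xY).
have h2 : rint (fun z => Re (sesq (P 0%N) (Y 0%N z) (Y 0%N z))) <= 0.
  have YL := chain_in (proj1 xY) (leq0n N).
  rewrite -[leRHS](rint_cst 0); apply: rint_le; last by move=> z _; exact: hP.
    by case: (sesq_cst_integrable (P 0%N) YL YL).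
  exact: L1_cst.
rewrite -[A x]/(maximal_operator N P hH x).
by move: h1 h2; move: (rint _) (Re (sesq _ _ _)) (Re (ip _ _)) => a b c; lra.
Qed.

Hypothesis A_dissipative : dissipative ip A.

Lemma chain_dissipation Y : sobolev_chain N Y -> W *m chain_port Y = 0 ->
  Re (sesq (swap_mx R n) (chain_port Y) (chain_port Y)) +
  2 * rint (fun z => Re (sesq (P 0%N) (Y 0%N z) (Y 0%N z))) <= 0.
Proof.
move=> YN WY; have [x xY] := chain_exists YN.
have := dissipation_identity xY P_sym; rewrite (boundary_port_chain P xY) => <-.
rewrite pmulr_rle0//; apply: A_dissipative; apply/port_domainP; by exists Y.
Qed.

Lemma dissipative_potential : nsdmx (herm_part (P 0%N)).
Proof.
apply/nsdmx_herm_partP => u; rewrite leNgt; apply/negP => hu.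
pose w : {poly R} := wedge 0 1; pose phi := ebump w 0 1.
have flat k t : t = 0 \/ t = 1 -> derive1n k phi t = 0.
  move=> ht; apply: derive1n_bump_flat; rewrite leNgt wedge_gt0//.
  by case: ht => ->; rewrite ltxx ?andbF.
have sphi : smooth phi := @smooth_bump R w 0 1.
pose Y := smooth_family phi u; have YN := smooth_chain N u sphi.
have Y0 k x : x = 0 \/ x = 1 -> Y k x = 0.
  move=> hx; rewrite /Y /smooth_family clamp_id ?flat ?scale0r//.
  by case: hx => ->; rewrite lexx ler01.
have pY : chain_port Y = 0.
  have e x : x = 0 \/ x = 1 -> \mxcol_(k < N) Y k x = 0.
    by move=> hx; apply/mxcolP => k; rewrite mxcolK submxcol0 Y0.
  rewrite /chain_port /port_vector !e; [|by left|by right].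
  by rewrite col_mx0 mulmx0 scaler0.
have := chain_dissipation YN; rewrite -/Y pY mulmx0 => /(_ erefl).
rewrite {1}/sesq mulmx0 mxE add0r pmulr_rle0//.
rewrite (rint_eq (g := fun z => Re (sesq (P 0%N) u u) * phi z ^+ 2)); last first.
  move=> z zI; rewrite /Y /smooth_family (clamp_I01 zI) derive1n0.
  by rewrite sesqZ expr0n addr0 mulrC.
have pL : L1 (fun z => phi z ^+ 2).
  have [_] := continuous_L2s (smooth_continuous sphi).
  by apply: eq_L1 => z; rewrite csq_real.
rewrite rintZ// pmulr_rle0// => p0.
have {}p0 : rint (fun z => phi z ^+ 2) = 0.
  by apply/le_anti; rewrite p0; apply: rint_ge0 => z _; exact: sqr_ge0.
have [z [z0 z1 e]] := ae_exists_between (lexx 0) ltr01 (lexx 1)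
  (rint_eq0_ae pL (fun z => sqr_ge0 (phi z)) p0).
move/eqP: e; rewrite sqrf_eq0 /phi /ebump wedge_gt0// z0 z1.
by rewrite hornerC expr0 !mul1r gt_eqF// expR_gt0.
Qed.

Definition layer_chain (w : {poly R}) (e f : 'I_N -> {poly R}) (Y0 Y1 : 'I_N -> 'cV[C]_d)
    (k : nat) (z : R) : 'cV[C]_d :=
  \sum_(j < N) (smooth_family (boundary_layer w (e j)) (Y0 j) k z +
    smooth_family (boundary_layer w (f j)) (Y1 j) k z).

Lemma dissipative_boundary : psdmx (W *m swap_mx R n *m W ^t*).
Proof.
apply/(kernel_nonpositiveP W_rank) => v Wv.
have [V VE] := port_vector_surj PN_unit v.
pose Y1 := submxcol (usubmx V); pose Y0 := submxcol (dsubmx V).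
have [e he] := choice (fun j : 'I_N =>
  @hermite_interpolation R N (fun k => (k == j)%:R) (fun=> 0)).
have [f hf] := choice (fun j : 'I_N =>
  @hermite_interpolation R N (fun=> 0) (fun k => (k == j)%:R)).
pose w m : {poly R} := m.+1%:R *: wedge 0 1.
have w0 m t : t = 0 \/ t = 1 -> (w m).[t] <= 0.
  move=> ht; rewrite hornerZ pmulr_rle0// leNgt wedge_gt0//.
  by case: ht => ->; rewrite ltxx ?andbF.
pose Y m := layer_chain (w m) e f Y0 Y1.
have YN m : sobolev_chain N (Y m).
  apply: chain_sum => j.
  rewrite (_ : (fun _ _ => _) = (fun k z =>
    1 *: smooth_family (boundary_layer (w m) (e j)) (Y0 j) k z +
    smooth_family (boundary_layer (w m) (f j)) (Y1 j) k z)); last first.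
    by apply/funext => k; apply/funext => z; rewrite scale1r.
  by apply: chain_linear; apply: smooth_chain; exact: smooth_boundary_layer.
have jet m k x : (k < N)%N -> x = 0 \/ x = 1 ->
    Y m k x = \sum_(j < N) (((e j)^`(k).[x])%:C *: Y0 j + ((f j)^`(k).[x])%:C *: Y1 j).
  move=> kN hx; apply: eq_bigr => j _; rewrite /smooth_family clamp_id ?boundary_layer_jet ?w0//.
  by case: hx => ->; rewrite lexx ler01.
have Ym0 m (k : 'I_N) : Y m k 0 = Y0 k.
  rewrite jet; [|by []|by left]; rewrite (bigD1 k)//= big1 => [|j jk].
    by rewrite (he k _ (ltn_ord k)).1 (hf k _ (ltn_ord k)).1 eqxx scale1r scale0r !addr0.
  have kj : (k == j :> nat) = false by apply/negbTE; rewrite eq_sym.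
  by rewrite (he j _ (ltn_ord k)).1 (hf j _ (ltn_ord k)).1 ?kj !scale0r addr0.
have Ym1 m (k : 'I_N) : Y m k 1 = Y1 k.
  rewrite jet; [|by []|by right]; rewrite (bigD1 k)//= big1 => [|j jk].
    by rewrite (he k _ (ltn_ord k)).2 (hf k _ (ltn_ord k)).2 eqxx scale1r scale0r !add0r addr0.
  have kj : (k == j :> nat) = false by apply/negbTE; rewrite eq_sym.
  by rewrite (he j _ (ltn_ord k)).2 (hf j _ (ltn_ord k)).2 ?kj !scale0r addr0.
have pY m : chain_port (Y m) = v.
  rewrite /chain_port -VE -[V in RHS]vsubmxK -[usubmx V]submxcolK -[dsubmx V]submxcolK.
  by congr (port_vector _ (col_mx _ _)); apply: eq_mxcol => k; rewrite ?Ym0 ?Ym1.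
pose g z : 'cV[C]_d := \sum_(j < N) (((e j).[z])%:C *: Y0 j + ((f j).[z])%:C *: Y1 j).
pose G z := Re (sesq (P 0%N) (g z) (g z)).
have YG m z : I z -> Re (sesq (P 0%N) (Y m 0%N z) (Y m 0%N z)) =
    (1 - ebump (w m) 0 1 z) ^+ 2 * G z.
  move=> zI; have -> : Y m 0%N z = (1 - ebump (w m) 0 1 z)%:C *: g z.
    rewrite /g scaler_sumr; apply: eq_bigr => j _.
    rewrite /smooth_family (clamp_I01 zI) !derive1n0 !boundary_layerE scalerDr !scalerA.
    by rewrite !rmorphM ![_ * (1 - _)%:C]mulrC.
  by rewrite sesqZ expr0n addr0.
have gL : L1 G.
  have h : g \in L2f.
    apply/square_integrableP => i.
    apply: (@eq_L2s _ (fun z => \sum_(j < N) (Y0 j i 0 * ((e j).[z])%:C +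
      Y1 j i 0 * ((f j).[z])%:C))).
      move=> z; rewrite summxE; apply: eq_bigr => j _.
      by rewrite !mxE ![(_)%:C * _]mulrC.
    apply: L2s_sum => j; apply: L2sD; apply: L2sZ; apply: continuous_L2s;
      exact: continuous_horner.
  by case: (sesq_cst_integrable (P 0%N) h h).
have lim0 : rint (fun z => (1 - ebump (w m) 0 1 z) ^+ 2 * G z) @[m --> \oo] --> (0 : R).
  rewrite -[X in _ --> X](rint_cst 0).
  apply: (@rint_dominated_cvg _ _ _ (fun z => `|G z|)).
  - move=> m; apply: measurable_funM; last exact: L1_measurable.
    apply: measurable_funX; apply: measurable_funB; first exact: measurable_cst.
    exact: measurable_bump.
  - exact: measurable_cst.
  - exact: integrable_norm gL.
  - move=> z; rewrite /I01/= in_itv/= => z01.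
    have c : ebump (w m) 0 1 z @[m --> \oo] --> (1 : R).
      by have := @ebump1_cvg R (wedge 0 1) z; rewrite wedge_gt0// z01.
    have c1 : (1 - ebump (w m) 0 1 z) @[m --> \oo] --> (1 - 1 : R).
      by apply: cvgB; [exact: cvg_cst|exact: c].
    rewrite subrr in c1; rewrite -(mul0r (G z)) -(mul0r (0 : R)).
    by apply: cvgM; [exact: (cvgM c1 c1)|exact: cvg_cst].
  - move=> m z _; rewrite normrM ler_piMl// ger0_norm ?sqr_ge0//.
    have /andP[b0 b1] := ebump1_itv (w m) z.
    by rewrite expr_le1// ?subr_ge0// gerBl.
have h m : Re (sesq (swap_mx R n) v v) +
    2 * rint (fun z => (1 - ebump (w m) 0 1 z) ^+ 2 * G z) <= 0.
  have := chain_dissipation (YN m); rewrite pY => /(_ Wv).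
  by rewrite (rint_eq (YG m)).
have c : Re (sesq (swap_mx R n) v v) +
    2 * rint (fun z => (1 - ebump (w m) 0 1 z) ^+ 2 * G z) @[m --> \oo] -->
    Re (sesq (swap_mx R n) v v) + 2 * 0.
  by apply: cvgD; [exact: cvg_cst|apply: cvgM; [exact: cvg_cst|exact: lim0]].
rewrite mulr0 addr0 in c.
rewrite -(cvg_lim (@Rhausdorff R) c); apply: limr_le; first exact: cvgP c.
exact: nearW.
Qed.

End dissipativity.

Section fixpoint.
Variables (R : realType) (V : normedModType R[i]).

Lemma contraction_fixpoint (T : V -> V) : seq_complete V ->
  (forall x y, rnorm (T x - T y) <= 2^-1 * rnorm (x - y)) -> exists x, T x = x.
Proof.
move=> Vc hT; pose u k := iter k T 0.
have [l ul] : exists l : V, u n @[n --> \oo] --> l.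
  apply: (@geometric_cvg _ _ _ (rnorm (u 0%N - u 1%N))) => //.
  elim=> [|k IH]; first by rewrite expr0 mulr1.
  rewrite /u !iterS; apply: le_trans (hT _ _) _.
  by rewrite exprS mulrCA ler_pM2l ?invr_gt0.
have uTl : u n @[n --> \oo] --> T l.
  rewrite -cvg_shiftS /=.
  apply: (@cvg_rnorm_squeeze _ _ _ _ _ _ _ (fun n => 2^-1 * rnorm (l - u n))).
    by apply: nearW => n; exact: hT.
  rewrite -(mulr0 2^-1); apply: cvgMr.
  rewrite -(rnorm0 V) -(subrr l); apply: rnorm_cvg.
  by apply: cvgB => //; exact: cvg_cst.
exists l; exact: (cvg_unique (@norm_hausdorff _ V) uTl ul).
Qed.

End fixpoint.

Section ode.
Variables (R : realType) (n : nat).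
Notation mu := (@lebesgue_measure R).
Notation I := (@I01 R).
Notation C := R[i].
Local Notation Re := (@complex.Re R).
Local Notation L2f := (@square_integrable R n).
Implicit Types f g : R -> 'cV[C]_n.

Definition volv f (z : R) : 'cV[C]_n := \col_i vol (fun s => f s i 0) z.

Definition wt (om z : R) : R := expR (- (2 * om) * z).

Lemma wt_gt0 om z : 0 < wt om z. Proof. exact: expR_gt0. Qed.

Lemma wt_le1 om z : 0 < om -> I z -> wt om z <= 1.
Proof.
move=> om0; rewrite /I01/= in_itv/= => /andP[z0 _].
by rewrite expR_le1 mulNr oppr_le0 mulr_ge0 ?ltW// mulr_gt0.
Qed.

Lemma wt_ge om z : 0 < om -> I z -> wt om 1 <= wt om z.
Proof.
move=> om0; rewrite /I01/= in_itv/= => /andP[_ z1].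
by rewrite ler_expR mulr1 ler_nMr ?(ltW z1)// oppr_lt0 mulr_gt0.
Qed.

Lemma is_derive_expR_scaled (c t : R) :
  is_derive t (1 : R) (fun z => expR (c * z)) (c * expR (c * t)).
Proof.
have d1 : is_derive t (1 : R) (fun z : R => c * z) c.
  have := is_deriveZ c (@is_derive_id _ _ t (1 : R)).
  by rewrite /GRing.scale /= mulr1.
have := is_derive1_comp (is_derive_expR (c * t)) d1.
by rewrite mulrC.
Qed.

Lemma continuous_expR_scaled (c : R) : continuous (fun z : R => expR (c * z)).
Proof.
move=> t; apply/differentiable_continuous/derivable1_diffP.
by have [] := is_derive_expR_scaled c t.
Qed.

Lemma rint_expR_below (om t : R) : 0 < om -> 0 <= t <= 1 ->
  rint (fun s => if s < t then expR (2 * om * s) else 0) <= (2 * om)^-1 * expR (2 * om * t).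
Proof.
move=> om0 t01; have c0 : 0 < 2 * om by rewrite mulr_gt0.
have de s : is_derive s (1 : R) (fun t => (2 * om)^-1 * expR (2 * om * t)) (expR (2 * om * s)).
  have := is_deriveZ (2 * om)^-1 (is_derive_expR_scaled (2 * om) s).
  by rewrite /GRing.scale /= mulKf ?gt_eqF.
rewrite (unit_ftc de (@continuous_expR_scaled (2 * om)) t01).
by rewrite lerDr mulr_ge0 ?expR_ge0 ?invr_ge0 ?ltW.
Qed.

Lemma L2s_expR c (h : R -> C) : L2s h -> L2s (fun z => (expR (c * z))%:C * h z).
Proof.
move=> hL; apply: (@L2sM_bounded _ _ _ (expR `|c| ^+ 2)) => //.
  by case: (continuous_L2s (@continuous_expR_scaled c)).
apply: nearW => z; rewrite /I01/= in_itv/= => /andP[z0 z1].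
rewrite csq_real ler_sqr ?nnegrE ?expR_ge0// ler_expR.
apply: le_trans (ler_norm _) _; rewrite normrM ler_piMr//.
by rewrite ger0_norm ltW.
Qed.

Lemma vol_weighted (h : R -> C) om t : L2s h -> 0 < om -> 0 <= t <= 1 ->
  wt om t * csq (vol h t) <= (2 * om)^-1 * rint (fun s => wt om s * csq (h s)).
Proof.
move=> hL om0 t01.
have ML c (k : R -> C) : L2s k -> L2s (fun z => if z < t then (expR (c * z))%:C * k z else 0).
  move=> kL; apply: L2s_mask; last exact: L2s_expR.
  by apply: measurable_fun_ltr => //; exact: measurable_cst.
pose p z := expR (om * z); pose q z := expR (- om * z).
have pq z : p z * q z = 1 by rewrite -expRD mulNr subrr expR0.
have pL := ML om _ (L2s_cst (1 : C)); have qL := ML (- om) h hL.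
have := cauchy_schwarz pL qL.
rewrite (eq_cintegral (g := fun z => if z < t then h z else 0)); last first.
  move=> z _; case: ifP => _; last by rewrite mul0r.
  by rewrite mulr1 mulrA -rmorphM pq mul1r.
rewrite -/(vol h t).
rewrite (rint_eq (g := fun s => if s < t then expR (2 * om * s) else 0)); last first.
  move=> s _; case: ifP => _; last by rewrite /csq /= expr0n addr0.
  by rewrite mulr1 csq_real expr2 -expRD -mulrDl -mulr2n mulr_natl.
set r1 := rint _; set r2 := rint _ => h1.
have e2 z : csq ((q z)%:C * h z) = wt om z * csq (h z).
  by rewrite csqM csq_real expr2 -expRD -mulrDl -mulr2n /wt mulNrn mulr_natl.
have qhL : L2s (fun z => (q z)%:C * h z) by exact: L2s_expR.
have r2le : r2 <= rint (fun s => wt om s * csq (h s)).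
  apply: rint_le; first by case: qL.
    by apply: eq_L1 qhL.2 => z; rewrite e2.
  move=> s _; case: ifP => _; first by rewrite e2.
  rewrite [leLHS](_ : _ = 0); last by rewrite /csq /= expr0n addr0.
  by rewrite mulr_ge0 ?csq_ge0// ltW// wt_gt0.
have r1le := rint_expR_below om0 t01; rewrite -/r1 in r1le.
have r20 : 0 <= r2 by apply: rint_ge0 => z _; exact: csq_ge0.
have wE : wt om t * expR (2 * om * t) = 1 by rewrite -expRD mulNr addNr expR0.
apply: (@le_trans _ _ (wt om t * ((2 * om)^-1 * expR (2 * om * t) * r2))).
  rewrite ler_pM2l ?wt_gt0//; apply: le_trans h1 _.
  exact: ler_wpM2r.
rewrite mulrA (mulrCA (wt _ _)) wE mulr1 ler_pM2l// invr_gt0 mulr_gt0//.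
Qed.

End ode.

Section ode.
Variables (R : realType) (n : nat).
Notation mu := (@lebesgue_measure R).
Notation I := (@I01 R).
Notation C := R[i].
Local Notation Re := (@complex.Re R).
Local Notation L2f := (@square_integrable R n).
Implicit Types f g : R -> 'cV[C]_n.

Definition wsq om f : R := rint (fun z => wt om z * sqnorm (f z)).

Lemma measurable_wt om : measurable_fun I (wt om).
Proof.
by apply: measurable_funTS; apply: continuous_measurable_fun; exact: continuous_expR_scaled.
Qed.

Lemma L1_wsq om f : 0 < om -> f \in L2f -> L1 (fun z => wt om z * sqnorm (f z)).
Proof.
move=> om0 fL; apply: (L1_ae_le _ (nsq_L1 fL)).
  by apply: measurable_funM; [exact: measurable_wt|exact: L1_measurable (nsq_L1 fL)].
apply: nearW => z zI; rewrite ger0_norm; last by rewrite mulr_ge0 ?sqnorm_ge0// ltW// wt_gt0.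
by rewrite ler_piMl ?sqnorm_ge0// wt_le1.
Qed.

Lemma wsq_ge0 om f : 0 <= wsq om f.
Proof. by apply: rint_ge0 => z _; rewrite mulr_ge0 ?sqnorm_ge0// ltW// wt_gt0. Qed.

Lemma wsq_ae om f g : 0 < om -> f \in L2f -> g \in L2f ->
  {ae mu, forall z, I z -> f z = g z} -> wsq om f = wsq om g.
Proof.
move=> om0 fL gL fg; apply: rint_ae; try exact: L1_measurable (L1_wsq om0 _).
by apply: filterS fg => z /[swap] zI /(_ zI) ->.
Qed.

Lemma wsqD om f g : 0 < om -> f \in L2f -> g \in L2f ->
  wsq om (fun z => f z + g z) <= 2 * wsq om f + 2 * wsq om g.
Proof.
move=> om0 fL gL; have fi := L1_wsq om0 fL; have gi := L1_wsq om0 gL.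
rewrite -!rintZ// -rintD; try exact: L1Z.
apply: rint_le; [exact: L1_wsq om0 (rpredD fL gL)|apply: L1D; exact: L1Z|move=> z _].
rewrite ![2 * (wt _ _ * _)]mulrCA -mulrDr ler_pM2l ?wt_gt0//; exact: sqnormD.
Qed.

Lemma wsq_le_nsq om f : 0 < om -> f \in L2f -> wsq om f <= nsq f.
Proof.
move=> om0 fL; apply: rint_le; [exact: L1_wsq|exact: nsq_L1|move=> z zI].
by rewrite ler_piMl ?sqnorm_ge0// wt_le1.
Qed.

Lemma nsq_le_wsq om f : 0 < om -> f \in L2f -> nsq f <= (wt om 1)^-1 * wsq om f.
Proof.
move=> om0 fL; rewrite -rintZ; last exact: L1_wsq.
apply: rint_le; [exact: nsq_L1|apply: L1Z; exact: L1_wsq|move=> z zI].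
rewrite mulrA ler_peMl ?sqnorm_ge0// mulrC ler_pdivlMr ?wt_gt0// mul1r.
exact: wt_ge.
Qed.

Lemma volv_L2 f : f \in L2f -> volv f \in L2f.
Proof.
move=> /square_integrableP fL; apply/square_integrableP => i.
by apply: (eq_L2s _ (vol_L2s (fL i))) => z; rewrite mxE.
Qed.

Lemma volvD f g z : f \in L2f -> g \in L2f ->
  volv (fun s => f s + g s) z = volv f z + volv g z.
Proof.
move=> /square_integrableP fL /square_integrableP gL; apply/colP => i; rewrite !mxE.
rewrite -volD; try exact: L2s_cintegrable.
by apply: eq_cintegral => s _; rewrite mxE.
Qed.

Lemma volvZ (a : C) f z : f \in L2f -> volv (fun s => a *: f s) z = a *: volv f z.
Proof.
move=> /square_integrableP fL; apply/colP => i; rewrite !mxE.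
rewrite -volZ; last exact: L2s_cintegrable.
by apply: eq_cintegral => s _; rewrite mxE.
Qed.

Lemma volv_ae f g z : f \in L2f -> g \in L2f ->
  {ae mu, forall z, I z -> f z = g z} -> volv f z = volv g z.
Proof.
move=> /square_integrableP fL /square_integrableP gL fg; apply/colP => i; rewrite !mxE.
apply: vol_ae; try exact: L2s_cintegrable.
by apply: filterS fg => s /[swap] sI /(_ sI) ->.
Qed.

Lemma wsq_volv om f : 0 < om -> f \in L2f -> wsq om (volv f) <= (2 * om)^-1 * wsq om f.
Proof.
move=> om0 fL; have /square_integrableP fs := fL.
have fi i : L1 (fun z => wt om z * csq (f z i 0)).
  apply: (L1_ae_le _ (fs i).2).
    by apply: measurable_funM; [exact: measurable_wt|exact: L1_measurable (fs i).2].
  apply: nearW => z zI; rewrite ger0_norm; last by rewrite mulr_ge0 ?csq_ge0// ltW// wt_gt0.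
  by rewrite ler_piMl ?csq_ge0// wt_le1.
rewrite -[leRHS]rint_cst; apply: rint_le; [exact: L1_wsq om0 (volv_L2 fL)|exact: L1_cst|].
move=> z; rewrite /I01/= in_itv/= => /andP[/ltW z0 /ltW z1].
have -> : wsq om f = \sum_i rint (fun z => wt om z * csq (f z i 0)).
  rewrite -rint_sum//; apply: rint_eq => s _; by rewrite sqnormE mulr_sumr.
rewrite sqnormE !mulr_sumr; apply: ler_sum => i _; rewrite mxE.
by apply: vol_weighted => //; rewrite z0.
Qed.

Lemma wsq_mul (B : R -> 'M[C]_n) : bounded_multiplier B ->
  exists2 K, 0 < K & forall om f, 0 < om -> f \in L2f ->
    wsq om (fun z => B z *m f z) <= K * wsq om f.
Proof.
move=> hB; have [_ [K BK]] := hB; pose K1 := `|(n * n)%:R * K| + 1.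
have K10 : 0 < K1 by rewrite ltr_pwDr.
exists K1 => // om f om0 fL; have fi := L1_wsq om0 fL.
rewrite -rintZ//; apply: rint_ae_le; [exact: L1_wsq om0 (mulmx_L2 hB fL)|exact: L1Z|].
apply: filterS BK => z h zI; rewrite mulrCA ler_pM2l ?wt_gt0//.
apply: le_trans (sqnorm_mulmx (f z) (h zI)) _; rewrite ler_wpM2r ?sqnorm_ge0//.
by rewrite (le_trans (ler_norm _))// lerDl.
Qed.

Definition ode (B : R -> 'M[C]_n) (c : 'cV[C]_n) G Z :=
  Z \in L2f /\ forall z, Z z = c + volv (fun s => B s *m Z s + G s) z.

Section solve.
Variable B : R -> 'M[C]_n.
Hypothesis hB : bounded_multiplier B.

Lemma rhs_L2 Z G : Z \in L2f -> G \in L2f -> (fun s => B s *m Z s + G s) \in L2f.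
Proof. by move=> ZL GL; exact: (rpredD (mulmx_L2 hB ZL) GL). Qed.

Lemma cst_L2 (c : 'cV[C]_n) : (fun=> c) \in L2f.
Proof. by apply/square_integrableP => i; exact: L2s_cst. Qed.

Lemma wsq_cst om (c : 'cV[C]_n) : 0 < om -> wsq om (fun=> c) <= sqnorm c.
Proof.
move=> om0; apply: le_trans (wsq_le_nsq om0 (cst_L2 c)) _.
by rewrite /nsq rint_cst.
Qed.

Let absorption (z a b wc sc v t g1 g2 nG t3 : R) :
  z <= 2 * a + 2 * b -> a <= 2 * wc + 2 * v -> b <= t -> t <= 8^-1 * z ->
  v <= g1 -> g1 <= g2 -> wc <= sc -> 0 <= sc -> 0 <= nG -> 0 <= t3 -> 0 <= v ->
  z <= 8 * sc + 8 * nG + 8 * t3 + 8 * g2.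
Proof. by move=> *; lra. Qed.

Lemma ode_bound : exists2 K, 0 <= K & forall c G Z, ode B c G Z -> G \in L2f ->
  nsq Z <= K * (sqnorm c + nsq G).
Proof.
have [K K0 hK] := wsq_mul hB; pose om := 4 * K.
have om0 : 0 < om by rewrite mulr_gt0.
exists ((wt om 1)^-1 * (8 + 8 * (2 * om)^-1)).
  apply: mulr_ge0; first by rewrite invr_ge0 ltW// wt_gt0.
  by rewrite addr_ge0// mulr_ge0// invr_ge0 mulr_ge0// ltW.
move=> c G Z [ZL ZE] GL; apply: le_trans (nsq_le_wsq om0 ZL) _.
rewrite -mulrA ler_pM2l ?invr_gt0 ?wt_gt0//.
have BZL := mulmx_L2 hB ZL.
have e : wsq om Z = wsq om (fun z => (c + volv G z) + volv (fun s => B s *m Z s) z).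
  apply: rint_eq => z _; congr (_ * sqnorm _).
  by rewrite ZE volvD// -addrA [X in c + X]addrC.
have h1 := wsqD om0 (rpredD (cst_L2 c) (volv_L2 GL)) (volv_L2 BZL).
have h2 := wsqD om0 (cst_L2 c) (volv_L2 GL).
have h3 := wsq_volv om0 BZL; have h4 := hK om Z om0 ZL.
have h5 := wsq_volv om0 GL; have h6 := wsq_le_nsq om0 GL; have h7 := wsq_cst c om0.
have h8 : (2 * om)^-1 * wsq om (fun s => B s *m Z s) <= 8^-1 * wsq om Z.
  have -> : 8^-1 * wsq om Z = (2 * om)^-1 * (K * wsq om Z).
    by rewrite /om; field; rewrite gt_eqF.
  by rewrite ler_pM2l// invr_gt0 mulr_gt0.
have h9 : (2 * om)^-1 * wsq om G <= (2 * om)^-1 * nsq G.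
  by rewrite ler_pM2l// invr_gt0 mulr_gt0.
have h10 : 0 <= (2 * om)^-1 * sqnorm c.
  by rewrite mulr_ge0 ?sqnorm_ge0 ?invr_ge0 ?mulr_ge0// ltW.
have h11 : 0 <= nsq G by exact: nsq_ge0.
have -> : (8 + 8 * (2 * om)^-1) * (sqnorm c + nsq G) =
   8 * sqnorm c + 8 * nsq G + 8 * ((2 * om)^-1 * sqnorm c) + 8 * ((2 * om)^-1 * nsq G).
  by ring.
have h12 : wsq om Z <= 2 * wsq om (fun z => c + volv G z) +
    2 * wsq om (volv (fun s => B s *m Z s)).
  by rewrite e; exact: h1.
exact: absorption h12 h2 h3 h8 h5 h9 h7 (sqnorm_ge0 c) h11 h10 (wsq_ge0 om (volv G)).
Qed.

Lemma weight_density om : 0 < om -> energy_density (fun z => ((wt om z)%:C)%:M : 'M[C]_n).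
Proof.
move=> om0; have sE a u : Re (sesq ((a%:C)%:M : 'M[C]_n) u u) = a * sqnorm u.
  rewrite -scalemx1 sesqZA sesq_sqnorm -rmorphM; done.
split=> [i j|].
  rewrite (_ : (fun _ => _) = (fun z => (i == j)%:R * (wt om z)%:C)).
    apply: cmeasurableM; first exact: cmeasurable_cst.
    split; [exact: measurable_wt|exact: measurable_cst].
  by apply/funext => z; rewrite mxE mulr_natl.
exists (wt om 1), 1; split; first exact: wt_gt0.
  by rewrite expR_le1 mulr1 oppr_le0 ltW// mulr_gt0.
apply: nearW => z zI; split=> [|u].
  rewrite tr_scalar_mx map_scalar_mx; congr (_%:M).
  by apply/eqP; rewrite eq_complex /= oppr0 !eqxx.
by rewrite sE mul1r ler_wpM2r ?sqnorm_ge0 ?wt_ge// ler_piMl ?sqnorm_ge0// wt_le1.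
Qed.

Lemma ode_exists c G : G \in L2f -> exists Z, ode B c G Z.
Proof.
move=> GL; have [K K0 hK] := wsq_mul hB; pose om := 2 * K.
have om0 : 0 < om by rewrite mulr_gt0.
have hom := weight_density om0; pose X := energy_space hom.
have rE (x : X) : rnorm x ^+ 2 = wsq om (L2_repr x).
  rewrite -(ip_rnorm (energy_real_ip hom)) Re_ip; apply: rint_eq => z _.
  rewrite -scalemx1 sesqZA sesq_sqnorm -rmorphM; done.
pose F (f : R -> 'cV[C]_n) z := c + volv (fun s => B s *m f s + G s) z.
have FL f : f \in L2f -> F f \in L2f.
  by move=> fL; exact: (rpredD (cst_L2 c) (volv_L2 (rhs_L2 fL GL))).
have [T hT] : exists T : X -> X, forall x,
    {ae mu, forall z, I z -> L2_repr (T x) z = F (L2_repr x) z}.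
  exists (fun x => L2_class (F (L2_repr x))) => x.
  exact: (@L2_class_repr R n _ (FL _ (@L2_repr_L2 R n _ hom x))).
have diff (x y : X) : exists2 r : X, rnorm (x - y) = rnorm r &
    {ae mu, forall z, I z -> L2_repr r z = L2_repr x z - L2_repr y z}.
  by exists (x - y); [reflexivity|exact: (@L2_reprB R n _ hom x y)].
have [x Tx] : exists x, T x = x.
  apply: contraction_fixpoint; first exact: energy_complete.
  move=> x y; have [p -> hp] := diff (T x) (T y); have [q -> hq] := diff x y.
  have xL := @L2_repr_L2 R n _ hom x; have yL := @L2_repr_L2 R n _ hom y.
  have pL := @L2_repr_L2 R n _ hom p; have qL := @L2_repr_L2 R n _ hom q.
  have dL : (fun z => L2_repr x z - L2_repr y z) \in L2f := rpredB xL yL.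
  have e1 : wsq om (L2_repr p) =
      wsq om (volv (fun s => B s *m (L2_repr x s - L2_repr y s))).
    apply: wsq_ae om0 pL (volv_L2 (mulmx_L2 hB dL)) _.
    apply: filterS3 (hT x) (hT y) hp => z h1 h2 h3 zI.
    apply: etrans (h3 zI) _; apply: etrans (f_equal2 (fun a b => a - b) (h1 zI) (h2 zI)) _.
    rewrite /F; move: (L2_repr x) (L2_repr y) xL yL dL => f g fL gL fgL.
    rewrite opprD addrACA subrr add0r -scaleN1r -volvZ; last exact: rhs_L2.
    rewrite -volvD; last 2 first.
    - exact: rhs_L2.
    - exact: (rpredZ (-1) (rhs_L2 gL GL)).
    congr (volv _ z); apply/funext => s.
    by rewrite scaleN1r opprD addrACA subrr addr0 -mulmxBr.
  have e2 : wsq om (L2_repr q) = wsq om (fun z => L2_repr x z - L2_repr y z).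
    exact: wsq_ae om0 qL dL hq.
  have h1 := wsq_volv om0 (mulmx_L2 hB dL); have h2 := hK om _ om0 dL.
  move: (rE p) (rE q) (rnorm_ge0 p) (rnorm_ge0 q); rewrite e1 e2.
  move: (rnorm p) (rnorm q) => a b ea eb a0 b0.
  have b0' : 0 <= 2^-1 * b by rewrite mulr_ge0 ?invr_ge0//.
  rewrite -(@ler_sqr R)// exprMn ea eb; apply: le_trans h1 _.
  have -> : 2^-1 ^+ 2 * wsq om (fun z => L2_repr x z - L2_repr y z) =
      (2 * om)^-1 * (K * wsq om (fun z => L2_repr x z - L2_repr y z)).
    by rewrite /om; move: (wsq _ _) => w; field; rewrite gt_eqF.
  by rewrite ler_pM2l// invr_gt0 mulr_gt0.
have hx : {ae mu, forall z, I z -> L2_repr x z = F (L2_repr x) z}.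
  by have := hT x; rewrite Tx; exact: id.
have xL := @L2_repr_L2 R n _ hom x; have FxL := FL _ xL.
exists (F (L2_repr x)); split=> [|z]; first exact: FxL.
rewrite {1}/F; congr (c + _); apply: volv_ae; [exact: rhs_L2|exact: rhs_L2|].
by apply: filterS hx => s hx sI; congr (B s *m _ + G s); exact: hx.
Qed.

End solve.
End ode.

Section bounds.
Variable R : realType.
Notation mu := (@lebesgue_measure R).
Notation I := (@I01 R).
Notation C := R[i].

Lemma multiplierD m n (B B' : R -> 'M[C]_(m, n)) : bounded_multiplier B ->
  bounded_multiplier B' -> bounded_multiplier (fun z => B z + B' z).
Proof.
move=> [mB [K hK]] [mB' [K' hK']]; split=> [i j|].
  rewrite (_ : (fun _ => _) = (fun z => B z i j + B' z i j)); first exact: cmeasurableD.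
  by apply/funext => z; rewrite mxE.
exists (2 * K + 2 * K'); apply: filterS2 hK hK' => z hK hK' zI i j; rewrite mxE.
by apply: le_trans (csqD _ _) _; rewrite lerD// ler_pM2l// ?hK ?hK'.
Qed.

Lemma multiplier_mulc m n p (A : 'M[C]_(m, n)) (B : R -> 'M[C]_(n, p)) :
  bounded_multiplier B -> bounded_multiplier (fun z => A *m B z).
Proof.
move=> [mB [K hK]]; split=> [i j|].
  rewrite (_ : (fun _ => _) = (fun z => \sum_k A i k * B z k j)).
    by apply: cmeasurable_sum => k; apply: cmeasurableM => //; exact: cmeasurable_cst.
  by apply/funext => z; rewrite mxE.
pose K' := \sum_(i < m) \sum_(k < n) csq (A i k) * `|K|.
exists (n%:R * K'); apply: filterS hK => z hK zI i j; rewrite mxE.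
apply: le_trans (csq_sum_le _) _; rewrite card_ord ler_wpM2l//.
rewrite /K' [leRHS](bigD1 i)//= -[leLHS]addr0 lerD//.
  apply: ler_sum => k _; rewrite csqM ler_wpM2l ?csq_ge0//.
  exact: le_trans (hK zI k j) (ler_norm _).
by apply: sumr_ge0 => a _; apply: sumr_ge0 => b _; rewrite mulr_ge0 ?csq_ge0.
Qed.

Lemma multiplier_block N d (F : 'I_N -> 'I_N -> R -> 'M[C]_d) :
  (forall i j, bounded_multiplier (F i j)) ->
  bounded_multiplier (fun z => \mxblock_(i < N, j < N) F i j z).
Proof.
move=> hF; split=> [i j|].
  rewrite (_ : (fun _ => _) = (fun z =>
    F (tagnat.sig1 i) (tagnat.sig1 j) z (tagnat.sig2 i) (tagnat.sig2 j))).
    by case: (hF (tagnat.sig1 i) (tagnat.sig1 j)).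
  by apply/funext => z; rewrite !mxE.
have [K hK] := choice (fun p : 'I_N * 'I_N => (hF p.1 p.2).2).
exists (\sum_p `|K p|).
have h : {ae mu, forall z, forall p : 'I_N * 'I_N, I z -> forall i j,
    csq (F p.1 p.2 z i j) <= K p}.
  exact: (filter_forall (F := almost_everywhere mu)).
apply: filterS h => z h zI i j; rewrite !mxE.
pose p := (tagnat.sig1 i, tagnat.sig1 j).
apply: le_trans (h p zI _ _) _; rewrite (bigD1 p)//= -[leLHS]addr0 lerD ?ler_norm//.
by apply: sumr_ge0.
Qed.

Lemma sqnorm_mulc m n (A : 'M[C]_(m, n)) :
  exists2 K, 0 <= K & forall u : 'cV[C]_n, sqnorm (A *m u) <= K * sqnorm u.
Proof.
pose K := \sum_i \sum_j csq (A i j).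
have K0 : 0 <= K by apply: sumr_ge0 => a _; apply: sumr_ge0 => b _; exact: csq_ge0.
exists ((m * n)%:R * K); first by rewrite mulr_ge0.
move=> u; apply: sqnorm_mulmx => i j; rewrite /K (bigD1 i)//= (bigD1 j)//= -addrA lerDl.
rewrite addr_ge0// ?sumr_ge0// => [a _|a _]; first exact: csq_ge0.
by apply: sumr_ge0 => b _; exact: csq_ge0.
Qed.

Lemma nsq_mul m n (B : R -> 'M[C]_(m, n)) : bounded_multiplier B ->
  exists2 K, 0 <= K & forall f, f \in @square_integrable R n ->
    nsq (fun z => B z *m f z) <= K * nsq f.
Proof.
move=> hB; have [_ [K BK]] := hB; exists (`|(m * n)%:R * K|) => // f fL.
have fi := nsq_L1 fL; rewrite -rintZ//.
apply: rint_ae_le; [exact: nsq_L1 (mulmx_L2 hB fL)|exact: L1Z|].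
apply: filterS BK => z h zI.
apply: le_trans (sqnorm_mulmx (f z) (h zI)) _; rewrite ler_wpM2r ?sqnorm_ge0//.
exact: ler_norm.
Qed.

Lemma nsqD n (f g : R -> 'cV[C]_n) : f \in @square_integrable R n ->
  g \in @square_integrable R n ->
  nsq (fun z => f z + g z) <= 2 * nsq f + 2 * nsq g.
Proof.
move=> fL gL; have fi := nsq_L1 fL; have gi := nsq_L1 gL.
rewrite -!rintZ// -rintD; try exact: L1Z.
by apply: rint_le; [exact: nsq_L1 (rpredD fL gL)|apply: L1D; exact: L1Z|move=> z _; exact: sqnormD].
Qed.

Lemma volv0 n (f : R -> 'cV[C]_n) : volv f 0 = 0.
Proof. by apply/colP => i; rewrite !mxE vol_le0. Qed.

Lemma sqnorm_volv1 n (f : R -> 'cV[C]_n) : f \in @square_integrable R n ->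
  sqnorm (volv f 1) <= nsq f.
Proof.
move=> fL; have /square_integrableP fs := fL; rewrite nsq_sum// sqnormE.
by apply: ler_sum => i _; rewrite mxE; apply: vol_sq_le => //; rewrite ler01 lexx.
Qed.

Variables (n : nat) (B : R -> 'M[C]_n).
Hypothesis hB : bounded_multiplier B.
Implicit Types (c : 'cV[C]_n) (G Z : R -> 'cV[C]_n).
Local Notation L2f := (@square_integrable R n).

Lemma ode_start c G Z : ode B c G Z -> Z 0 = c.
Proof. by move=> [_ ->]; rewrite volv0 addr0. Qed.

Lemma ode_linear a c c' G G' Z Z' : G \in L2f -> G' \in L2f ->
  ode B c G Z -> ode B c' G' Z' ->
  ode B (a *: c + c') (fun z => a *: G z + G' z) (fun z => a *: Z z + Z' z).
Proof.
move=> GL GL' [ZL ZE] [ZL' ZE'].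
split=> [|z]; first exact: (rpredD (rpredZ a ZL) ZL').
rewrite ZE ZE' scalerDr addrACA; congr (_ + _).
rewrite -volvZ; last exact: rhs_L2.
rewrite -volvD; [|exact: (rpredZ a (rhs_L2 hB ZL GL))|exact: rhs_L2].
congr (volv _ z); apply/funext => s.
by rewrite mulmxDr -scalemxAr scalerDr addrACA.
Qed.

Lemma zero_L2 : (fun=> 0) \in L2f. Proof. exact: cst_L2. Qed.

Lemma ode_superposition (J : Type) (s : seq J) (a : J -> C) (c : J -> 'cV[C]_n)
    (Z : J -> R -> 'cV[C]_n) c0 G Z0 : G \in L2f -> ode B c0 G Z0 ->
  (forall j, ode B (c j) (fun=> 0) (Z j)) ->
  ode B (\sum_(j <- s) a j *: c j + c0) G (fun z => \sum_(j <- s) a j *: Z j z + Z0 z).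
Proof.
move=> GL Z0E ZE; elim: s => [|j s IH].
  rewrite big_nil add0r (_ : (fun _ => _) = Z0)//.
  by apply/funext => z; rewrite big_nil add0r.
have := ode_linear (a j) zero_L2 GL (ZE j) IH.
rewrite big_cons addrA (_ : (fun z => a j *: 0 + G z) = G); last first.
  by apply/funext => z; rewrite scaler0 add0r.
rewrite (_ : (fun z => a j *: Z j z + _) =
  (fun z => \sum_(k <- j :: s) a k *: Z k z + Z0 z))//.
by apply/funext => z; rewrite big_cons addrA.
Qed.

Lemma ode_rhs_bound : exists2 K, 0 <= K & forall c G Z, ode B c G Z -> G \in L2f ->
  nsq (fun s => B s *m Z s + G s) <= K * (sqnorm c + nsq G).
Proof.
have [K K0 hK] := ode_bound hB; have [K' K'0 hK'] := nsq_mul hB.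
exists (2 * (K' * K) + 2); first by rewrite addr_ge0// mulr_ge0// mulr_ge0.
move=> c G Z ZE GL; apply: le_trans (nsqD (mulmx_L2 hB ZE.1) GL) _.
have h1 := hK c G Z ZE GL; have h2 := hK' Z ZE.1.
have h3 : K' * nsq Z <= K' * (K * (sqnorm c + nsq G)) by rewrite ler_wpM2l.
have h4 := sqnorm_ge0 c.
rewrite [leRHS]mulrDl -!(mulrA _ _ (_ + _)); apply: lerD; last by rewrite ler_pM2l// lerDr.
by rewrite ler_pM2l//; apply: le_trans h2 _.
Qed.

End bounds.

Section range.
Variables (R : realType) (N d : nat).
Notation mu := (@lebesgue_measure R).
Notation I := (@I01 R).
Notation C := R[i].
Local Notation Re := (@complex.Re R).
Hypothesis N_ge1 : (1 <= N)%N.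
Variable P : nat -> 'M[C]_d.
Hypothesis PN_unit : P N \in unitmx.
Variables (H : R -> 'M[C]_d) (hH : energy_density H).
Local Notation X := (energy_space hH).
Local Notation n := (blockdim N d).
Variable W : 'M[C]_(n, n + n).
Local Notation A := (port_operator P hH W).
Local Notation ip := (energy_ip hH).
Local Notation chain_of := (@chain_of R d H hH N).
Local Notation L2d := (@square_integrable R d).
Local Notation L2n := (@square_integrable R n).

Variables (h : R) (h0 : 0 < h).

Let hc : C := h%:C.
Let hc0 : hc != 0.
Proof. by apply/negP => /eqP/(congr1 Re) /= e; move: h0; rewrite e ltxx. Qed.

Definition top_row (j : nat) (z : R) : 'M[C]_d :=
  if j == 0%N then (hc^-1 *: invmx (P N)) *m cramer_inverse (H z) + - (invmx (P N) *m P 0%N)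
  else - (invmx (P N) *m P j).

Definition companion_block (i j : 'I_N) (z : R) : 'M[C]_d :=
  if (i.+1 < N)%N then (if j == i.+1 :> nat then 1%:M else 0) else top_row j z.

Definition companion (z : R) : 'M[C]_n := \mxblock_(i < N, j < N) companion_block i j z.

Definition source : 'M[C]_(n, d) :=
  \mxcol_(i < N) (if (i.+1 < N)%N then 0 else - (hc^-1 *: invmx (P N))).

Lemma companion_multiplier : bounded_multiplier companion.
Proof.
apply: multiplier_block => i j; rewrite /companion_block.
case: (i.+1 < N)%N; first exact: multiplier_cst.
rewrite /top_row; case: (j == 0%N :> nat); last exact: multiplier_cst.
apply: multiplierD; last exact: multiplier_cst.
by apply: multiplier_mulc; exact: density_inverse_multiplier.
Qed.

Lemma submxcol_companion (u : 'cV[C]_n) (v : 'cV[C]_d) z (k : 'I_N) :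
  submxcol (companion z *m u + source *m v) k =
  \sum_j companion_block k j z *m submxcol u j +
  (if (k.+1 < N)%N then 0 else - (hc^-1 *: invmx (P N))) *m v.
Proof.
rewrite submxcolD; congr (_ + _); last by rewrite /source mxcol_mul mxcolK.
rewrite -{1}[u]submxcolK /companion mxblockEh mul_mxrow_mxcol submxcol_sum.
by apply: eq_bigr => j _; rewrite -submxcol_mul mxcolK.
Qed.

Section from_ode.
Variables (c : 'cV[C]_n) (g : R -> 'cV[C]_d) (Z : R -> 'cV[C]_n).
Hypothesis gL : g \in L2d.
Let G z := source *m g z.
Hypothesis ZE : ode companion c G Z.

Let ord_last_lt : (N.-1 < N)%N. Proof. by rewrite prednK. Qed.
Let last := Ordinal ord_last_lt.
Let slope z := companion z *m Z z + G z.

Definition ode_chain (k : nat) (z : R) : 'cV[C]_d :=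
  if insub k is Some j then submxcol (Z z) j else submxcol (slope z) last.

Lemma ode_chainE (k : 'I_N) z : ode_chain k z = submxcol (Z z) k.
Proof. by rewrite /ode_chain valK. Qed.

Lemma ode_chainS (k : 'I_N) z : ode_chain k.+1 z = submxcol (slope z) k.
Proof.
rewrite /ode_chain; case: insubP => [j jN jk|].
  rewrite /slope /G submxcol_companion.
  have kN : (k.+1 < N)%N by rewrite -jk ltn_ord.
  rewrite kN mul0mx addr0 (bigD1 j)//= big1 ?addr0 => [|i ij].
    by rewrite /companion_block kN jk eqxx mul1mx.
  by rewrite /companion_block kN -jk (inj_eq val_inj) (negbTE ij) mul0mx.
rewrite -leqNgt => Nk; congr submxcol; apply: val_inj => /=.
by have := ltn_ord k; lia.
Qed.

Lemma slope_L2 : slope \in L2n.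
Proof.
apply: rhs_L2; [exact: companion_multiplier|exact: ZE.1|].
exact: mulmx_L2 (multiplier_cst _) gL.
Qed.

Lemma submxcol_L2 (f : R -> 'cV[C]_n) (k : 'I_N) : f \in L2n -> (fun z => submxcol (f z) k) \in L2d.
Proof.
move=> /square_integrableP fL; apply/square_integrableP => i.
by apply: eq_L2s (fL (tagnat.Rank k i)) => z; rewrite mxE.
Qed.

Lemma ode_chain_sobolev : sobolev_chain N ode_chain.
Proof.
split=> k kN.
  rewrite /ode_chain; case: insubP => [j _ _|_]; last exact: submxcol_L2 slope_L2.
  exact: submxcol_L2 ZE.1.
move=> i z; pose j := Ordinal kN.
have -> : vol (fun s => ode_chain k.+1 s i 0) z = vol (fun s => slope s (tagnat.Rank j i) 0) z.
  by apply: eq_cintegral => s _; rewrite (ode_chainS j) mxE.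
rewrite !(ode_chainE j) !mxE (ode_start ZE) [in LHS](ZE.2 z) mxE; congr (_ + _).
by rewrite mxE.
Qed.

Lemma ode_chain_equation : {ae mu, forall z, I z ->
  cramer_inverse (H z) *m ode_chain 0 z - hc *: \sum_(k < N.+1) P k *m ode_chain k z = g z}.
Proof.
apply: nearW => z _.
have eN : ode_chain N z = submxcol (slope z) last.
  by rewrite -(ode_chainS last) /= prednK.
rewrite big_ord_recr /= eN /slope /G submxcol_companion /= (_ : (N.-1.+1 < N)%N = false); last first.
  by rewrite prednK// ltnn.
have -> : \sum_j companion_block last j z *m submxcol (Z z) j =
    (hc^-1 *: invmx (P N)) *m cramer_inverse (H z) *m ode_chain 0 z -
    invmx (P N) *m \sum_(k < N) P k *m ode_chain k z.
  rewrite (eq_bigr (fun j : 'I_N => (if j == 0%N :> nat then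
      (hc^-1 *: invmx (P N)) *m cramer_inverse (H z) *m ode_chain j z else 0) -
      invmx (P N) *m (P j *m ode_chain j z))).
    rewrite sumrB mulmx_sumr -big_mkcond /=; congr (_ - _).
    rewrite (big_pred1 (Ordinal N_ge1))// => j.
  move=> j _; rewrite /companion_block /= prednK// ltnn /top_row ode_chainE.
  case: ifP => [/eqP ->|_]; last by rewrite sub0r mulNmx mulmxA.
  by rewrite mulmxDl mulNmx mulmxA.
move: (cramer_inverse (H z)) => Hi.
rewrite mulNmx -!scalemxAl mulmxDr mulmxDr !mulmxN -!scalemxAr !mulmxA mulmxV// !mul1mx.
move: (\sum_(k < N) _) (_ *m ode_chain 0 z) => S u.
have -> : S + (hc^-1 *: u - S - hc^-1 *: g z) = hc^-1 *: (u - g z).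
  by rewrite scalerBr addrA [S + _]addrCA subrr addr0.
by rewrite scalerA mulfV// scale1r opprB addrCA subrr addr0.
Qed.

End from_ode.
Lemma chain_port_ends (Y : nat -> R -> 'cV[C]_d) (Z : R -> 'cV[C]_n) :
  (forall (k : 'I_N) z, Y k z = submxcol (Z z) k) ->
  chain_port N P Y = port_vector P (col_mx (Z 1) (Z 0)).
Proof.
move=> YZ; congr (port_vector P (col_mx _ _)); rewrite -[RHS]submxcolK;
  by apply: eq_mxcol => k; rewrite YZ.
Qed.

Definition end_matrix : 'M[C]_(n, n + n) := (sqrtC 2)^-1 *: (W *m port_map N P).
Local Notation E1 := (lsubmx end_matrix).
Local Notation E0 := (rsubmx end_matrix).

Lemma end_matrixE u v : W *m port_vector P (col_mx u v) = E1 *m u + E0 *m v.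
Proof.
rewrite -mul_row_col hsubmxK /end_matrix /port_vector -scalemxAr -scalemxAl.
by rewrite mulmxA.
Qed.

Lemma ode_solution c (g : X) Z : ode companion c (fun z => source *m L2_repr g z) Z ->
  E1 *m Z 1 + E0 *m c = 0 ->
  exists x : X, [/\ chain_of x (ode_chain (L2_repr g) Z),
    W *m chain_port N P (ode_chain (L2_repr g) Z) = 0 & x - hc *: A x = g].
Proof.
move=> ZE bc; have gL := @L2_repr_L2 R d _ hH g.
have YN := ode_chain_sobolev gL ZE.
have [x xY] := chain_exists hH YN; exists x; split=> //.
  rewrite (@chain_port_ends _ Z); last by move=> k z; exact: ode_chainE.
  by rewrite end_matrixE (ode_start ZE).
have rx : {ae mu, forall z, I z ->
    L2_repr x z = cramer_inverse (H z) *m ode_chain (L2_repr g) Z 0 z}.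
  apply: filterS2 (proj2 xY) (density_inverseK hH) => z h1 h2 zI.
  by rewrite -(h1 zI) /density_mul mulmxA (h2 zI).2 mul1mx.
have e := @L2_eq_linear R d H hH (- hc) g (A x) x _ _ (action_chain P xY) rx.
rewrite addrC -scaleNr; apply: esym; apply: e.
apply: filterS (ode_chain_equation Z gL) => z ez zI.
by apply: etrans (esym (ez zI)) _; rewrite addrC scaleNr.
Qed.

Lemma ode_ae (B : R -> 'M[C]_n) c G G' Z : bounded_multiplier B -> G \in L2n -> G' \in L2n ->
  {ae mu, forall z, I z -> G z = G' z} -> ode B c G Z -> ode B c G' Z.
Proof.
move=> hB GL GL' GG [ZL ZE]; split=> // z; rewrite {1}ZE; congr (c + _).
apply: volv_ae; [exact: rhs_L2|exact: rhs_L2|].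
by apply: filterS GG => s GG sI; rewrite (GG sI).
Qed.

Lemma source_L2 (g : R -> 'cV[C]_d) : g \in L2d -> (fun z => source *m g z) \in L2n.
Proof. by move=> gL; apply: mulmx_L2 gL; exact: multiplier_cst. Qed.

Lemma zero_chain : sobolev_chain N (fun _ _ => 0 : 'cV[C]_d).
Proof.
have s := smooth_chain N (0 : 'cV[C]_d) (@smooth_poly R 0).
rewrite (_ : (fun _ _ => _) = smooth_family (horner (0 : {poly R})) 0)//.
by apply/funext => k; apply/funext => z; rewrite /smooth_family scaler0.
Qed.

Hypothesis A_dissipative : dissipative ip A.

Lemma dissipative_injective (x : X) : domain A x -> x - hc *: A x = 0 -> x = 0.
Proof.
move=> dx e; apply: rnorm0_eq0; apply/le_anti; rewrite rnorm_ge0 andbT.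
have := dissipative_le (energy_real_ip hH) A_dissipative (ltW h0) dx.
by rewrite -/hc e rnorm0.
Qed.

Lemma homogeneous_ode_zero c Z : ode companion c (fun=> 0) Z ->
  E1 *m Z 1 + E0 *m c = 0 -> c = 0.
Proof.
move=> ZE bc.
have r0 : {ae mu, forall z, I z -> L2_repr (0 : X) z = 0}.
  by apply: filterS (L2_reprB (0 : X) 0) => z e zI; move: (e zI); rewrite !subrr.
have ZE' : ode companion c (fun z => source *m L2_repr (0 : X) z) Z.
  apply: ode_ae companion_multiplier _ _ _ ZE; first exact: zero_L2.
    by apply: source_L2; exact: (@L2_repr_L2 R d _ hH).
  by apply: filterS r0 => z e zI; rewrite (e zI) mulmx0.
have [x [xY WY e]] := ode_solution ZE' bc.
have dx : domain A x by apply/port_domainP; eexists; split; [exact: xY|exact: WY].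
have x0 : x = 0 by exact: dissipative_injective dx e.
have Y0 : {ae mu, forall z, I z -> 0 = ode_chain (L2_repr (0 : X)) Z 0 z}.
  apply: filterS2 (proj2 xY) r0 => z h1 h2 zI.
  by rewrite -(h1 zI) /density_mul x0 (h2 zI) mulmx0.
have i01 : 0 <= (0 : R) <= 1 by rewrite ler01 lexx.
have zL : (fun=> 0) \in L2d := cst_L2 0.
rewrite -(ode_start ZE) -[Z 0]submxcolK; apply/mxcolP => k; rewrite mxcolK submxcol0.
rewrite -(ode_chainE (L2_repr (0 : X)) Z k 0).
rewrite -(trace_chain (proj1 xY) zL Y0 (ltn_ord k) i01).
by rewrite (trace_chain zero_chain zL _ (ltn_ord k) i01)//; exact: nearW.
Qed.

Lemma resolvent_solution : exists2 K, 0 <= K & forall g : X, exists x Y,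
  [/\ chain_of x Y, W *m chain_port N P Y = 0, x - hc *: A x = g,
    forall i, csq (Y 0%N 0 i 0) <= K * nsq (L2_repr g) &
    forall i, rint (fun z => csq (Y 1%N z i 0)) <= K * nsq (L2_repr g)].
Proof.
have cB := companion_multiplier.
have [F FE] := choice (fun j : 'I_n => ode_exists cB (delta_mx j 0) (zero_L2 R n)).
pose Phi : 'M[C]_n := \matrix_(i, j) F j 1 i 0.
pose M := E1 *m Phi + E0.
have sumE (c : 'cV[C]_n) : \sum_j c j 0 *: delta_mx j 0 = c :> 'cV[C]_n.
  by rewrite [RHS]matrix_sum_delta; apply: eq_bigr => j _; rewrite big_ord1.
have PhiE (c : 'cV[C]_n) : \sum_j c j 0 *: F j 1 = Phi *m c.
  apply/colP => i; rewrite summxE mxE; apply: eq_bigr => j _.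
  by rewrite !mxE mulrC.
have MU : M \in unitmx.
  apply: unitmx_of_inj => c Mc.
  have z0 : ode companion 0 (fun=> 0) (fun=> 0 : 'cV[C]_n).
    split=> [|z]; first exact: zero_L2.
    rewrite add0r; apply/colP => i; rewrite !mxE -[LHS](cintegral_cst 0).
    by apply: eq_cintegral => s _; rewrite mulmx0 addr0 mxE; case: ifP.
  have := ode_superposition cB (index_enum 'I_n) (fun j => c j 0) (zero_L2 R n) z0 FE.
  rewrite sumE addr0 => /homogeneous_ode_zero; apply.
  by rewrite addr0 PhiE mulmxA -mulmxDl.
have [K1 K10 hK1] := sqnorm_mulc (- (invmx M *m E1)).
have [K2 K20 hK2] := ode_rhs_bound cB.
have [K3 K30 hK3] := nsq_mul (multiplier_cst source : bounded_multiplier (fun=> source)).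
pose Kc := K1 * K2 * K3; have Kc0 : 0 <= Kc by rewrite !mulr_ge0.
exists (Kc + K2 * (Kc + K3)); first by rewrite addr_ge0// mulr_ge0// addr_ge0.
move=> g; have gL := @L2_repr_L2 R d _ hH g; have GL := source_L2 gL.
have [Zg ZgE] := ode_exists cB 0 GL.
pose c := - (invmx M *m E1) *m Zg 1.
have := ode_superposition cB (index_enum 'I_n) (fun j => c j 0) GL ZgE FE.
rewrite sumE addr0 => ZE; set Z := (X in ode _ _ _ X) in ZE.
have bc : E1 *m Z 1 + E0 *m c = 0.
  rewrite /Z PhiE mulmxDr mulmxA addrAC -mulmxDl -/M /c mulNmx mulmxN.
  by rewrite !mulmxA mulmxV// mul1mx addNr.
have [x [xY WY e]] := ode_solution ZE bc.
have G0 := nsq_ge0 (L2_repr g); have G3 := hK3 _ gL.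
have cK : sqnorm c <= Kc * nsq (L2_repr g).
  apply: le_trans (hK1 _) _; rewrite /Kc -!mulrA ler_wpM2l//.
  have -> : Zg 1 = volv (fun s => companion s *m Zg s + source *m L2_repr g s) 1.
    by rewrite {1}(ZgE.2 1) add0r.
  apply: le_trans (sqnorm_volv1 (rhs_L2 cB ZgE.1 GL)) _.
  apply: le_trans (hK2 _ _ _ ZgE GL) _; rewrite sqnorm0 add0r ler_wpM2l//.
have sK : nsq (fun s => companion s *m Z s + source *m L2_repr g s) <=
    K2 * (Kc + K3) * nsq (L2_repr g).
  apply: le_trans (hK2 _ _ _ ZE GL) _; rewrite -mulrA ler_wpM2l// mulrDl.
  exact: lerD.
exists x, (ode_chain (L2_repr g) Z); split=> // i.
- have := ode_chainE (L2_repr g) Z (Ordinal N_ge1) 0 => /= ->.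
  rewrite (ode_start ZE) mxE; apply: le_trans (csq_le_sqnorm _ _) _.
  apply: le_trans cK _; rewrite mulrDl lerDl mulr_ge0// mulr_ge0// addr_ge0//.
- have sL := slope_L2 gL ZE; have /square_integrableP sLi := sL.
  rewrite (rint_eq (g := fun z => csq ((companion z *m Z z + source *m L2_repr g z)
    (tagnat.Rank (Ordinal N_ge1) i) 0))); last first.
    move=> z _; have := ode_chainS Z gL (Ordinal N_ge1) z => /= ->.
    by rewrite mxE.
  apply: le_trans (_ : _ <= nsq (fun s => companion s *m Z s + source *m L2_repr g s)) _.
    by apply: rint_le; [case: (sLi (tagnat.Rank (Ordinal N_ge1) i))|exact: nsq_L1 sL|move=> z _; exact: csq_le_sqnorm].
  apply: le_trans sK _; rewrite [leRHS]mulrDl lerDr mulr_ge0//.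
Qed.

End range.

Section grid.
Variable R : realType.

Lemma grid_cells (J : finType) (T : Type) (D : T -> Prop) (u : T -> J -> R -> R) (B L : R) :
  (forall x j s, D x -> 0 <= s <= 1 -> `|u x j s| <= B) ->
  (forall x j s t, D x -> (u x j t - u x j s) ^+ 2 <= `|t - s| * L) ->
  0 <= L -> forall e, 0 < e -> exists (K : finType) (cell : T -> K), forall x y,
    D x -> D y -> cell x = cell y ->
    forall j z, 0 <= z <= 1 -> (u x j z - u y j z) ^+ 2 <= e.
Proof.
move=> uB uL L0 e e0; pose m := (Num.truncn (3 * (2 * L + 1) / e)).+1.
have m0 : 0 < m%:R :> R by rewrite ltr0n.
have m1 : 1 <= m%:R :> R by rewrite ler1n.
have mE : 3 * (2 * L + 1) <= m%:R * e.
  by rewrite -ler_pdivrMr// ltW// truncnS_gt.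
pose Q := Num.truncn (m%:R * (2 * B)).
pose code x (p : 'I_m.+1 * J) := Num.truncn (m%:R * (u x p.2 (p.1%:R / m%:R) + B)).
pose cell x : {ffun 'I_m.+1 * J -> 'I_Q.+1} := [ffun p => inord (code x p)].
have grid_itv (k : 'I_m.+1) : 0 <= (k%:R / m%:R : R) <= 1.
  by rewrite divr_ge0//= ler_pdivrMr// mul1r ler_nat -ltnS.
have arg0 x (p : 'I_m.+1 * J) : D x -> 0 <= m%:R * (u x p.2 (p.1%:R / m%:R) + B).
  move=> Dx; rewrite mulr_ge0//.
  by have := uB x p.2 _ Dx (grid_itv p.1); rewrite ler_norml => /andP[h _]; lra.
exists {ffun 'I_m.+1 * J -> 'I_Q.+1}, cell => x y Dx Dy /ffunP exy j z /andP[z0 z1].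
have kz : (Num.truncn (m%:R * z) < m.+1)%N.
  rewrite truncn_lt_nat; last by rewrite mulr_ge0// ltW.
  by apply: le_lt_trans (_ : _ <= m%:R) _; [rewrite ler_piMr// ltW|rewrite ltr_nat].
pose k := Ordinal kz; pose t : R := k%:R / m%:R.
have codeQ w (p : 'I_m.+1 * J) : D w -> (code w p <= Q)%N.
  move=> Dw; apply: le_truncn; rewrite ler_pM2l//.
  by have := uB w p.2 _ Dw (grid_itv p.1); rewrite ler_norml => /andP[_ h]; lra.
have ec : code x (k, j) = code y (k, j).
  by have := congr1 val (exy (k, j)); rewrite !ffunE /= !inordK// ltnS codeQ.
have tz : `|z - t| <= m%:R^-1.
  have /andP[k1 k2] := truncn_itv (mulr_ge0 (ltW m0) z0).
  have t1 : t <= z by rewrite /t ler_pdivrMr// mulrC.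
  rewrite ger0_norm ?subr_ge0// lerBlDr /t -[X in X + _]div1r -mulrDl ler_pdivlMr//.
  by rewrite mulrC ltW// (lt_le_trans k2)// -natr1 addrC.
have h1 := uL x j t z Dx; have h2 := uL y j t z Dy.
have h3 : (u x j t - u y j t) ^+ 2 <= m%:R^-1.
  have /andP[a1 a2] := truncn_itv (arg0 x (k, j) Dx).
  have /andP[b1 b2] := truncn_itv (arg0 y (k, j) Dy).
  move: a1 a2 b1 b2; rewrite -!/(code _ _) ec /= -/t -natr1.
  move: ((code y (k, j))%:R : R) (u x j t) (u y j t) => c v w a1 a2 b1 b2.
  have ab : (m%:R * (v - w)) ^+ 2 <= 1.
    have s1 : 0 <= 1 - m%:R * (v - w) by lra.
    have s2 : 0 <= 1 + m%:R * (v - w) by lra.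
    by have := mulr_ge0 s1 s2; rewrite -subr_sqr expr1n subr_ge0.
  have m2 : m%:R <= m%:R ^+ 2 :> R by rewrite expr2 ler_peMl// ltW.
  rewrite exprMn in ab.
  rewrite -div1r ler_pdivlMr// mulrC; apply: le_trans ab; rewrite ler_wpM2r ?sqr_ge0//.
have h4 : `|z - t| * L <= m%:R^-1 * L by rewrite ler_wpM2r.
have h5 : 3 * (m%:R^-1 * L * 2 + m%:R^-1) <= e.
  have -> : 3 * (m%:R^-1 * L * 2 + m%:R^-1) = 3 * (2 * L + 1) / m%:R :> R.
    by move: (m%:R : R) m0 => w w0; field; rewrite gt_eqF.
  by rewrite ler_pdivrMr// [e * _]mulrC.
move: h1 h2 h3 h4 h5; move: (m%:R^-1 * L) (m%:R^-1) (`|z - t| * L).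
move: (u x j z) (u x j t) (u y j z) (u y j t) => a b c f p q r h1 h2 h3 h4 h5.
have := sqr_ge0 ((a - b) - (b - f)); have := sqr_ge0 ((a - b) + (c - f)).
have := sqr_ge0 ((b - f) + (c - f)).
have -> : (a - c) ^+ 2 = (a - b) ^+ 2 + (b - f) ^+ 2 + (c - f) ^+ 2 +
   2 * (a - b) * (b - f) - 2 * (a - b) * (c - f) - 2 * (b - f) * (c - f) by ring.
nra.
Qed.

End grid.

Section bounded_operators.
Variables (R : realType) (V : normedModType R[i]).

Lemma bounded_linear_ball (S : V -> V) : bounded_linear S ->
  exists2 K, 0 <= K & forall f, rnorm f <= 1 -> rnorm (S f) <= K.
Proof.
move=> [linS cS].
have S0 : S 0 = 0 by have := linS (-1) 0 0; rewrite scaler0 addr0 scaleN1r addNr.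
have SZ a f : S (a *: f) = a *: S f by rewrite -[a *: f]addr0 linS S0 addr0.
have c0 : S t @[t --> (0 : V)] --> S 0 := cS 0.
have near1 : \forall t \near (0 : V), rnorm (S 0 - S t) < 1.
  by move/cvg_rnorm : c0; exact: (fun h => h 1 ltr01).
have /nbhs_ballP [r /= r0 hr] := near1.
have rE : r = (complex.Re r)%:C.
  by case: r r0 {hr} => a b; rewrite ltcE /= => /andP[/eqP -> _].
have r0' : 0 < complex.Re r by move: r0; rewrite {1}rE ltcR.
pose q := 2^-1 * complex.Re r; have q0 : 0 < q by rewrite mulr_gt0.
exists q^-1; first by rewrite invr_ge0 ltW.
move=> f f1; have : rnorm (S 0 - S (q%:C *: f)) < 1.
  apply: hr; rewrite -ball_normE /= sub0r normrN rnormE rE ltcR.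
  rewrite rnormZr (ger0_norm (ltW q0)); apply: le_lt_trans (_ : q * 1 < _).
    by rewrite ler_pM2l.
  by rewrite mulr1 /q; lra.
rewrite S0 sub0r rnormN SZ rnormZr (ger0_norm (ltW q0)) => h.
rewrite -(ler_pM2l q0) mulfV ?gt_eqF//; exact: ltW.
Qed.

End bounded_operators.

Section compactness.
Variables (R : realType) (N d : nat).
Notation mu := (@lebesgue_measure R).
Notation I := (@I01 R).
Notation C := R[i].
Local Notation Re := (@complex.Re R).
Local Notation Im := (@complex.Im R).
Hypothesis N_ge1 : (1 <= N)%N.
Variable P : nat -> 'M[C]_d.
Hypothesis PN_unit : P N \in unitmx.
Variables (H : R -> 'M[C]_d) (hH : energy_density H).
Local Notation X := (energy_space hH).
Local Notation n := (blockdim N d).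
Variable W : 'M[C]_(n, n + n).
Local Notation A := (port_operator P hH W).
Local Notation ip := (energy_ip hH).
Local Notation chain_of := (@chain_of R d H hH N).
Local Notation L2d := (@square_integrable R d).
Hypothesis A_dissipative : dissipative ip A.
Variables (l : C) (S : X -> X).
Hypothesis S_res : is_resolvent A l S.

Let difference_equation (V : lmodType C) (k : C) (s u x v : V) :
  x - k *: v = s - k *: u -> (-1 *: x + s) - k *: (-1 *: v + u) = 0.
Proof.
move=> e; rewrite !scaleN1r scalerDr scalerN opprD opprK addrACA -e.
by rewrite [- x + _]addrC -opprB addNr.
Qed.

Definition controlled (K : R) (Y : nat -> R -> 'cV[C]_d) : Prop :=
  forall i, csq (Y 0%N 0 i 0) <= K /\ rint (fun z => csq (Y 1%N z i 0)) <= K.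

Lemma resolvent_controlled : exists2 K, 0 <= K & forall f : X, rnorm f <= 1 ->
  exists Y, chain_of (S f) Y /\ controlled K Y.
Proof.
have [Sb Sd SA] := S_res; have [K0 K00 hK0] := bounded_linear_ball Sb.
have [K1 K10 hK1] := resolvent_solution N_ge1 PN_unit (ltr01 : (0 : R) < 1) A_dissipative.
have [m0 [M0 [m00 _ hm]]] := energy_nsq_bounds hH.
have onec (v : X) : (1 : R)%:C *: v = v by rewrite scale1r.
pose B := 1 + complex.Re `|1 - l| * K0.
exists (K1 * (m0^-1 * B ^+ 2)).
  by rewrite mulr_ge0// mulr_ge0 ?sqr_ge0// invr_ge0 ltW.
move=> f f1; have [dS eS] := Sd f.
have [g gE] : exists g : X, g = f + (1 - l) *: S f by eexists.
have Ag : S f - (1 : R)%:C *: A (S f) = g.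
  rewrite onec gE scalerBl scale1r; move: eS; move: (A (S f)) (S f) => u v <-.
  by rewrite [RHS]addrC addrA subrK.
have gB : rnorm g <= B.
  have l0 : 0 <= complex.Re `|1 - l| by rewrite normc_def /= sqrtr_ge0.
  rewrite gE; apply: le_trans (rnormD f _) _; apply: lerD; first exact: f1.
  rewrite (rnormZ (1 - l) (S f)); exact: ler_wpM2l l0 _ _ (hK0 f f1).
have gn : nsq (L2_repr g) <= m0^-1 * B ^+ 2.
  have /andP[hmg _] := hm g; have eg := ip_rnorm (energy_real_ip hH) g.
  rewrite -(ler_pM2l m00) mulrA mulfV ?gt_eqF// mul1r; apply: le_trans hmg _.
  move: eg gB (rnorm_ge0 g); move: (rnorm g) (Re _) => a b -> aB a0.
  by rewrite ler_sqr// nnegrE (le_trans a0).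
have [x [Y [xY WY ex b0 b1]]] := hK1 g.
have dx : domain A x by apply/port_domainP; exists Y; split; [exact: xY|exact: WY].
have xS : S f - x = 0.
  have [d' e'] := port_operator_linear (-1) dx dS.
  have inj := dissipative_injective (ltr01 : (0 : R) < 1) A_dissipative d'.
  apply: etrans (_ : _ = -1 *: x + S f) (inj _); first by rewrite addrC scaleN1r.
  apply: etrans (congr1 (fun t => -1 *: x + S f - (1 : R)%:C *: t) e') _.
  exact: difference_equation (etrans ex (esym Ag)).
exists Y; split; first by rewrite (_ : S f = x)//; apply/eqP; rewrite -subr_eq0 xS.
move=> i; split; [apply: le_trans (b0 i) _|apply: le_trans (b1 i) _]; exact: ler_wpM2l.
Qed.

Definition component (Y : nat -> R -> 'cV[C]_d) (j : 'I_d * bool) (z : R) : R :=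
  if j.2 then Re (Y 0%N z j.1 0) else Im (Y 0%N z j.1 0).

Let component_sq (Y : nat -> R -> 'cV[C]_d) j s t :
  (component Y j t - component Y j s) ^+ 2 <= csq (Y 0%N t j.1 0 - Y 0%N s j.1 0).
Proof.
rewrite /component /csq; move: (Y 0%N t j.1 0) (Y 0%N s j.1 0) => [a b] [a' b'] /=.
by case: j.2; rewrite ?lerDl ?lerDr sqr_ge0.
Qed.

Lemma controlled_holder K Y j s t : sobolev_chain N Y -> controlled K Y ->
  (component Y j t - component Y j s) ^+ 2 <= `|t - s| * K.
Proof.
move=> [YL YV] cY; apply: le_trans (component_sq _ _ _ _) _.
rewrite (YV 0%N N_ge1 j.1 t) (YV 0%N N_ge1 j.1 s) opprD addrACA subrr add0r.
have /square_integrableP Y1 := YL 1%N N_ge1.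
apply: le_trans (vol_holder s t (Y1 j.1)) _; rewrite ler_wpM2l//; exact: (cY j.1).2.
Qed.

Lemma controlled_bound K Y j s : sobolev_chain N Y -> controlled K Y -> 0 <= s <= 1 ->
  `|component Y j s| <= 4 * K + 1.
Proof.
move=> [YL YV] cY s01; have /square_integrableP Y1 := YL 1%N N_ge1.
have h : csq (Y 0%N s j.1 0) <= 4 * K.
  rewrite (YV 0%N N_ge1 j.1 s); apply: le_trans (csqD _ _) _.
  have := vol_sq_le (Y1 j.1) s01; have [] := cY j.1.
  by move: (csq _) (rint _) (csq _) => a b c; lra.
have h2 : component Y j s ^+ 2 <= csq (Y 0%N s j.1 0).
  rewrite /component /csq; case: (Y 0%N s j.1 0) => a b /=.
  by case: j.2; rewrite ?lerDl ?lerDr sqr_ge0.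
move: (le_trans h2 h); move: (component Y j s) => v v2.
have := sqr_ge0 (v - 1); have := sqr_ge0 (v + 1).
by rewrite ler_norml => *; apply/andP; split; nra.
Qed.

Lemma component_close (Y Y' : nat -> R -> 'cV[C]_d) e z :
  (forall j, (component Y j z - component Y' j z) ^+ 2 <= e) ->
  sqnorm (Y 0%N z - Y' 0%N z) <= d%:R * (2 * e).
Proof.
move=> h; rewrite sqnormE; apply: le_trans (_ : _ <= \sum_(i < d) 2 * e) _.
  apply: ler_sum => i _; have := h (i, true); have := h (i, false).
  rewrite /component /csq !mxE /=; case: (Y 0%N z i 0) (Y' 0%N z i 0) => [a b] [a' b'] /=.
  by lra.
by rewrite sumr_const card_ord -[X in X <= _]mulr_natl.
Qed.

Lemma resolvent_compact : compact_operator S.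
Proof.
apply: small_cells_compact; first exact: energy_complete.
move=> e e0; have [K K0 hK] := resolvent_controlled.
have [M0 [M00 hM]] : exists M0 : R, 0 < M0 /\ forall x : X, Re (ip x x) <= M0 * nsq (L2_repr x).
  have [m0 [M0 [_ M00 hm]]] := energy_nsq_bounds hH.
  by exists M0; split=> // x; case/andP: (hm x).
have [K1 K10 hK1] := nsq_mul (density_inverse_multiplier hH).
pose q := M0 * (K1 * (d%:R * 2)).
have q0 : 0 <= q by rewrite /q !mulr_ge0// ltW.
pose del := e ^+ 2 / (q + 1).
have q1 : 0 < q + 1 by rewrite ltr_wpDl.
have del0 : 0 < del by rewrite divr_gt0// exprn_gt0.
have FE (f : X) : exists Y, rnorm f <= 1 -> chain_of (S f) Y /\ controlled K Y.
  have [f1|f1] := boolP (rnorm f <= 1); last by exists (fun _ _ => 0).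
  by have [Y YE] := hK f f1; exists Y => _.
have [F hF] := choice FE.
have [T [cell hcell]] := @grid_cells R ('I_d * bool)%type X (fun f => rnorm f <= 1)
  (fun f => component (F f)) (4 * K + 1) K
  (fun f j s f1 s01 => controlled_bound j (hF f f1).1.1 (hF f f1).2 s01)
  (fun f j s t f1 => controlled_holder j s t (hF f f1).1.1 (hF f f1).2) K0 del del0.
exists T, cell => x y x1 y1 exy; have close := hcell x y x1 y1 exy.
have [[xN xE] _] := hF x x1; have [[yN yE] _] := hF y y1.
have [r -> rE] : exists2 r : X, rnorm (S x - S y) = rnorm r &
    {ae mu, forall z, I z -> L2_repr r z = L2_repr (S x) z - L2_repr (S y) z}.
  by exists (S x - S y); [reflexivity|exact: (@L2_reprB R d _ hH (S x) (S y))].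
pose w z := F x 0%N z - F y 0%N z.
have wL : w \in L2d := rpredB (chain_in xN (leq0n N)) (chain_in yN (leq0n N)).
have rw : {ae mu, forall z, I z -> L2_repr r z = cramer_inverse (H z) *m w z}.
  have hxy : {ae mu, forall z, I z ->
      density_mul (S x) z = F x 0%N z /\ density_mul (S y) z = F y 0%N z}.
    by apply: filterS2 xE yE => z a b zI; split; [exact: a|exact: b].
  apply: filterS3 rE (density_inverseK hH) hxy => z h1 h2 h3 zI.
  have [e1 e2] := h3 zI; move: e1 e2; rewrite (h1 zI) /w /density_mul => <- <-.
  by rewrite mulmxBr !mulmxA (h2 zI).2 !mul1mx.
have rn : nsq (L2_repr r) <= K1 * (d%:R * (2 * del)).
  rewrite (nsq_ae (@L2_repr_L2 R d _ hH r) (mulmx_L2 (density_inverse_multiplier hH) wL) rw).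
  apply: le_trans (hK1 _ wL) _; rewrite ler_wpM2l//.
  rewrite -[leRHS]rint_cst; apply: rint_le; [exact: nsq_L1|exact: L1_cst|].
  move=> z; rewrite /I01/= in_itv/= => /andP[/ltW z0 /ltW z1].
  by apply: component_close => j; apply: close; rewrite z0.
have := ip_rnorm (energy_real_ip hH) r; have := hM r.
move: (rnorm_ge0 r); move: (rnorm r) (Re _) => a b a0 h1 h2; move: h1; rewrite h2 => h1.
rewrite -(@ler_sqr R) ?nnegrE ?(ltW e0)//; apply: le_trans h1 _.
apply: le_trans (_ : M0 * (K1 * (d%:R * (2 * del))) <= _); first by rewrite ler_pM2l.
have -> : M0 * (K1 * (d%:R * (2 * del))) = q * del by rewrite /q; ring.
rewrite /del mulrA ler_pdivrMr// [q * _]mulrC ler_wpM2l ?sqr_ge0//.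
by rewrite lerDl.
Qed.

End compactness.

Section generation.
Variables (R : realType) (N d : nat).
Notation C := R[i].
Local Notation Re := (@complex.Re R).
Hypothesis N_ge1 : (1 <= N)%N.
Variable P : nat -> 'M[C]_d.
Hypothesis P_sym : forall k : nat, (1 <= k <= N)%N ->
  (P k) ^t* = (-1) ^+ k.-1 *: P k.
Hypothesis PN_unit : P N \in unitmx.
Variables (H : R -> 'M[C]_d) (hH : energy_density H).
Local Notation X := (energy_space hH).
Local Notation n := (blockdim N d).
Variable W : 'M[C]_(n, n + n).
Local Notation A := (port_operator P hH W).
Local Notation ip := (energy_ip hH).

Lemma generation_dissipative : generates_contraction_semigroup A -> dissipative ip A.
Proof.
move=> [T [T_C0 T_contr T_gen]] x dx.
apply: (contraction_derivative_dissipative (energy_real_ip hH) T_contr).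
by apply/T_gen; split.
Qed.

Section dissipative.
Hypothesis A_dissipative : dissipative ip A.

Lemma port_operator_range h (g : X) : 0 < h ->
  exists2 x : X, domain A x & x - h%:C *: A x = g.
Proof.
move=> h0; have [K _ hK] := resolvent_solution N_ge1 PN_unit h0 A_dissipative.
have [x [Y [xY WY e _ _]]] := hK g; exists x; last exact: e.
by apply/port_domainP; exists Y; split; [exact: xY|exact: WY].
Qed.

Lemma dissipative_generation : generates_contraction_semigroup A.
Proof.
exact: (m_dissipative_generates (energy_real_ip hH) (@energy_complete R d H hH)
  (fun a x y => @port_operator_linear R N d P H hH W a x y) A_dissipative
  (fun h x h0 => port_operator_range x h0)).
Qed.

Lemma dissipative_compact_resolvent : compact_resolvent A.
Proof.
split; last by move=> l S hS; exact: (resolvent_compact N_ge1 PN_unit A_dissipative hS).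
exists 1; eexists; exact: (m_dissipative_resolvent (energy_real_ip hH)
  (fun a x y => @port_operator_linear R N d P H hH W a x y) A_dissipative
  (fun h x h0 => port_operator_range x h0)).
Qed.

End dissipative.
End generation.

Theorem theorem2p3 (R : realType) (N d : nat)
    (N_ge1 : (1 <= N)%N) (d_ge1 : (1 <= d)%N)
    (P : nat -> 'M[R[i]]_d)
    (P_sym : forall k : nat, (1 <= k <= N)%N ->
      (P k) ^t* = (-1) ^+ k.-1 *: P k)
    (PN_unit : P N \in unitmx)
    (H : R -> 'M[R[i]]_d) (H_density : energy_density H)
    (W : 'M[R[i]]_(blockdim N d, blockdim N d + blockdim N d))
    (W_full_rank : \rank W = blockdim N d) :
  let A := port_operator P H_density W in
  [/\ generates_contraction_semigroup A <->
        dissipative (energy_ip H_density) A,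
      dissipative (energy_ip H_density) A <->
        (psdmx (W *m swap_mx R (blockdim N d) *m W ^t*) /\
         nsdmx (herm_part (P 0%N))) &
      generates_contraction_semigroup A -> compact_resolvent A].
Proof.
move=> A; split.
- split; first exact: generation_dissipative.
  exact: dissipative_generation.
- split=> [dA|[Wpsd P0nsd]].
    split; last exact: dissipative_potential dA.
    exact: dissipative_boundary dA.
  exact: boundary_dissipative.
- by move=> /generation_dissipative dA; exact: dissipative_compact_resolvent dA.
Qed.
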